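(* Let $n\ge 2$ and let $(\mathcal{M},\omega)$ be a $2n$-dimensional symplectic manifold. For every differential 2-form $\alpha$ on $\mathcal{M}$ there is a vector field $X\in\mathcal{X}_{\mathrm{H}}^{2n-1}(\mathcal{M},\omega)$ (in particular $X$ is volume-preserving, $\mathcal{L}_X(\omega^n)=0$) with $$\mathrm{d}(\alpha\wedge\omega^{n-2})=-\frac{1}{n(n-1)}\,i_X(\omega^n),$$ and if in Darboux coordinates $(q^i,p_i)$ $$\alpha=\tfrac12 A_{ij}\,\mathrm{d}q^i\wedge\mathrm{d}q^j+A^i_j\,\mathrm{d}p_i\wedge\mathrm{d}q^j+\tfrac12 A^{ij}\,\mathrm{d}p_i\wedge\mathrm{d}p_j$$ with $A_{ij}=-A_{ji}$ and $A^{ij}=-A^{ji}$, then $$X=\left(\frac{\partial A^{ij}}{\partial q^j}+\frac{\partial A^j_j}{\partial p_i}-\frac{\partial A^i_j}{\partial p_j}\right)\frac{\partial}{\partial q^i}+\left(\frac{\partial A_{ij}}{\partial p_j}-\frac{\partial A^j_j}{\partial q^i}+\frac{\partial A^j_i}{\partial q^j}\right)\frac{\partial}{\partial p_i}.$$ Moreover, every $X\in\mathcal{X}_{\mathrm{H}}^{2n-1}(\mathcal{M},\omega)$ arises in this way from some 2-form $\alpha$ on $\mathcal{M}$. In the special case $\alpha=\frac{1}{n-1}H\omega$ with $H$ a smooth function on $\mathcal{M}$, the equations for the integral curves of $X$ are the canonical Hamilton equations $\dot q^{\,i}=\frac{\partial H}{\partial p_i}$, $\dot p_i=-\frac{\partial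 H}{\partial q^i}$.
   Context: Repeated indices are summed from $1$ to $n$. Darboux coordinates are local coordinates in which $\omega=\mathrm{d}p_i\wedge\mathrm{d}q^i$. $i_X$ denotes contraction with $X$, $\omega^k$ is the $k$-fold wedge product of $\omega$, and $\omega^0=1$. $\mathcal{X}_{\mathrm{H}}^{2n-1}(\mathcal{M},\omega)$ is the space of smooth vector fields $X$ on $\mathcal{M}$ such that $-i_X(\omega^n)$ is an exact $(2n-1)$-form. *)

(* Defs.v *)
From HB Require Import structures.
From mathcomp Require Import all_boot all_order all_algebra all_fingroup.
From mathcomp Require Import all_classical all_reals all_analysis.
Set Implicit Arguments.
Unset Strict Implicit.
Unset Printing Implicit Defensive.
Import Order.TTheory GRing.Theory Num.Theory.
Import numFieldNormedType.Exports.
Local Open Scope classical_set_scope.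
Local Open Scope ring_scope.

(* Smooth manifolds and differential forms over mathcomp-analysis.            *)
(*                                                                            *)
(* Vectors of R^m are rows, and a k-tuple of vectors is a k x m matrix.       *)
(* Tensor fields on a manifold are given by their local representatives in    *)
(* all charts of the (maximal) atlas, subject to the usual transformation law *)
(* under changes of charts; a representative is a function on R^m of which    *)
(* only the values on the image of the chart are meaningful.                  *)

Section Smooth.
Variables (R : realType) (V W : normedModType R).

(* On an open set U this is C^k: all iterated directional derivatives of      *)
(* order at most k exist and are continuous.                                  *)
Fixpoint Ck (k : nat) (U : set V) (f : V -> W) : Prop :=
  (forall x, U x -> {for x, continuous f}) /\
  if k is k'.+1 then
    forall v, (forall x, U x -> derivable f x v) /\ Ck k' U ('D_v f)
  else True.

Definition smooth_on (U : set V) (f : V -> W) := forall k, Ck k U f.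

End Smooth.

Section Manifold.
Variables (R : realType) (m : nat).

(* cinv is only meaningful on the image of cmap. *)
Record chart (T : Type) := Chart {
  cdom : set T;
  cmap : T -> 'rV[R]_m;
  cinv : 'rV[R]_m -> T }.

Definition cim (T : Type) (c : chart T) : set 'rV[R]_m := cmap c @` cdom c.

Definition is_chart (T : topologicalType) (c : chart T) : Prop :=
  [/\ open (cdom c), open (cim c),
      (forall x, cdom c x -> cinv c (cmap c x) = x),
      (forall x, cdom c x -> {for x, continuous (cmap c)})
    & (forall u, cim c u -> {for u, continuous (cinv c)})].

Definition overlap (T : Type) (c c' : chart T) : set 'rV[R]_m :=
  cmap c @` (cdom c `&` cdom c').

Definition transition (T : Type) (c c' : chart T) : 'rV[R]_m -> 'rV[R]_m :=
  cmap c' \o cinv c.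

Definition compatible (T : Type) (c c' : chart T) : Prop :=
  smooth_on (overlap c c') (transition c c') /\
  smooth_on (overlap c' c) (transition c' c).

Record manifold := Manifold {
  points :> topologicalType;
  atlas : set (chart points);
  manifold_hausdorff : hausdorff_space points;
  manifold_second_countable : @second_countable points;
  atlas_chart : forall c, atlas c -> is_chart c;
  atlas_cover : forall x : points, exists2 c, atlas c & cdom c x;
  atlas_compatible : forall c c', atlas c -> atlas c' -> compatible c c';
  atlas_maximal : forall c, is_chart c ->
    (forall c', atlas c' -> compatible c c') -> atlas c }.

Variable M : manifold.

Definition smooth_function (H : M -> R) : Prop :=
  forall c, atlas c -> smooth_on (cim c) (H \o cinv c).

Definition local_vfield := chart M -> 'rV[R]_m -> 'rV[R]_m.

Definition is_vfield (X : local_vfield) : Prop :=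
  (forall c, atlas c -> smooth_on (cim c) (X c)) /\
  (forall c c' u, atlas c -> atlas c' -> overlap c c' u ->
     X c' (transition c c' u) = X c u *m jacobian (transition c c') u).

Definition alternating_multilinear k (a : 'M[R]_(k, m) -> R) : Prop :=
  (forall (i : 'I_k) (A B C : 'M[R]_(k, m)) (b c : R),
     row i A = b *: row i B + c *: row i C ->
     row' i B = row' i A -> row' i C = row' i A ->
     a A = b * a B + c * a C) /\
  (forall (i j : 'I_k) (A : 'M[R]_(k, m)),
     i != j -> row i A = row j A -> a A = 0).

(* For a : local_form k, a c u A is the value of the k-form a at the point    *)
(* with coordinates u in the chart c, on the k vectors whose coordinates in   *)
(* c are the rows of A.                                                       *)
Definition local_form (k : nat) := chart M -> 'rV[R]_m -> 'M[R]_(k, m) -> R.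

Definition is_form k (a : local_form k) : Prop :=
  [/\ forall c u, atlas c -> cim c u -> alternating_multilinear (a c u),
      forall c A, atlas c -> smooth_on (cim c) (fun u => a c u A)
    & forall c c' u A, atlas c -> atlas c' -> overlap c c' u ->
        a c u A = a c' (transition c c' u)
                    (A *m jacobian (transition c c') u)].

(* Equality of a k-form with an l-form; the equation k = l is part of it, so  *)
(* that degrees need not agree up to conversion.                              *)
Definition form_eq k l (a : local_form k) (b : local_form l) : Prop :=
  exists e : k = l, forall c u A, atlas c -> cim c u ->
    a c u A = b c u (castmx (e, erefl m) A).

Definition zero_form k : local_form k := fun _ _ _ => 0.
Arguments zero_form k : clear implicits.

Definition scale_form k (r : R) (a : local_form k) : local_form k :=
  fun c u A => r * a c u A.

Definition fun_form k (H : M -> R) (a : local_form k) : local_form k :=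
  fun c u A => H (cinv c u) * a c u A.

(* Normalised so that dx /\ dy (v, w) = dx v * dy w - dx w * dy v. *)
Definition wedge_cov k l (a : 'M[R]_(k, m) -> R) (b : 'M[R]_(l, m) -> R)
    (A : 'M[R]_(k + l, m)) : R :=
  ((k`! * l`!)%:R)^-1 *
  \sum_(s : 'S_(k + l))
     (-1) ^+ s * a (usubmx (row_perm s A)) * b (dsubmx (row_perm s A)).

Definition wedge k l (a : local_form k) (b : local_form l) :
    local_form (k + l) :=
  fun c u => wedge_cov (a c u) (b c u).

Fixpoint wpow (w : local_form 2) (j : nat) : local_form (j * 2) :=
  match j return local_form (j * 2) with
  | 0 => fun _ _ _ => 1
  | j'.+1 => wedge w (@wpow w j')
  end.
Arguments wpow w j : clear implicits.

Definition ext_d k (a : local_form k) : local_form k.+1 :=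
  fun c u A => \sum_(i < k.+1)
    (-1) ^+ i * 'D_(row i A) (fun y => a c y (row' i A)) u.

Definition interior_prod (X : local_vfield) k :
    local_form k -> local_form k.-1 :=
  match k return local_form k -> local_form k.-1 with
  | 0 => fun _ => zero_form 0
  | k'.+1 => fun a c u A => a c u (col_mx (X c u) A)
  end.

(* (L_X a)(v_1, .., v_k) =                                                    *)
(*   D_X (a (v_1, .., v_k)) + \sum_i a (v_1, .., D_(v_i) X, .., v_k)          *)
(* for constant vectors v_i in a chart.                                       *)
Definition lie_deriv (X : local_vfield) k (a : local_form k) : local_form k :=
  fun c u A =>
    'D_(X c u) (fun y => a c y A) u
    + \sum_(i < k)
        a c u (\matrix_(j < k)
                 if j == i then 'D_(row i A) (X c) u else row j A).

Definition exact_form k (a : local_form k) : Prop :=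
  exists j (b : local_form j), is_form b /\ form_eq (ext_d b) a.

Definition nondegenerate (w : local_form 2) : Prop :=
  forall c u, atlas c -> cim c u ->
    forall v : 'rV[R]_m,
      (forall v' : 'rV[R]_m, w c u (col_mx v v') = 0) -> v = 0.

Definition symplectic (w : local_form 2) : Prop :=
  [/\ is_form w, form_eq (ext_d w) (zero_form 3) & nondegenerate w].

Definition integral_curve (X : local_vfield) (I : set R) (g : R -> M) : Prop :=
  forall t, I t ->
    {for t, continuous g} /\
    forall c, atlas c -> cdom c (g t) ->
      is_derive t 1 (cmap c \o g) (X c (cmap c (g t))).

End Manifold.
Arguments zero_form {R m} M k.
Arguments wpow {R m M} w j.

(* In dimension n + n, the coordinates of a chart are (q^1..q^n, p_1..p_n). *)
Section Symplectic.
Variables (R : realType) (n : nat).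

Definition dq (i : 'I_n) (A : 'M[R]_(1, n + n)) : R := A 0 (lshift n i).
Definition dp (i : 'I_n) (A : 'M[R]_(1, n + n)) : R := A 0 (rshift n i).

Definition partial_q (i : 'I_n) (f : 'rV[R]_(n + n) -> R) :
  'rV[R]_(n + n) -> R := 'D_(delta_mx 0 (lshift n i)) f.
Definition partial_p (i : 'I_n) (f : 'rV[R]_(n + n) -> R) :
  'rV[R]_(n + n) -> R := 'D_(delta_mx 0 (rshift n i)) f.

Variable M : manifold R (n + n).

Definition darboux (w : local_form M 2) (c : chart R (n + n) M) : Prop :=
  atlas c /\
  forall u A, cim c u -> w c u A = \sum_(i < n) wedge_cov (dp i) (dq i) A.

Definition hamiltonian_vfield (w : local_form M 2) (X : local_vfield M) :
    Prop :=
  is_vfield X /\ exact_form (scale_form (-1) (interior_prod X (wpow w n))).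

Definition generates (w a : local_form M 2) (X : local_vfield M) : Prop :=
  form_eq (ext_d (wedge a (wpow w (n - 2))))
    (scale_form (- ((n * (n - 1))%:R)^-1) (interior_prod X (wpow w n))).

(* Aqq i j = A_ij, Apq i j = A^i_j (i upper, j lower), App i j = A^ij. *)
Definition components (a : local_form M 2) (c : chart R (n + n) M)
    (Aqq Apq App : 'I_n -> 'I_n -> 'rV[R]_(n + n) -> R) : Prop :=
  forall u, cim c u ->
    [/\ forall i j, Aqq i j u = - Aqq j i u,
        forall i j, App i j u = - App j i u
      & forall A, a c u A =
          2^-1 * (\sum_(i < n) \sum_(j < n)
                    Aqq i j u * wedge_cov (dq i) (dq j) A)
          + \sum_(i < n) \sum_(j < n) Apq i j u * wedge_cov (dp i) (dq j) A
          + 2^-1 * (\sum_(i < n) \sum_(j < n)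
                      App i j u * wedge_cov (dp i) (dp j) A)].

Definition darboux_expression (w a : local_form M 2) (X : local_vfield M) :
    Prop :=
  forall (c : chart R (n + n) M) Aqq Apq App,
    darboux w c -> components a c Aqq Apq App ->
    forall u, cim c u -> forall i : 'I_n,
      X c u 0 (lshift n i) =
        \sum_(j < n) (partial_q j (App i j) u + partial_p i (Apq j j) u
                      - partial_p j (Apq i j) u) /\
      X c u 0 (rshift n i) =
        \sum_(j < n) (partial_p j (Aqq i j) u - partial_q i (Apq j j) u
                      + partial_q j (Apq j i) u).

End Symplectic.

(* Main.v *)
Require Import Defs.
From HB Require Import structures.
From mathcomp Require Import all_boot all_order all_algebra all_fingroup.
From mathcomp Require Import all_classical all_reals all_analysis.
From mathcomp Require Import zify ring lra.
Set Implicit Arguments.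
Unset Strict Implicit.
Unset Printing Implicit Defensive.
Import Order.TTheory GRing.Theory Num.Theory.
Import numFieldNormedType.Exports.
Local Open Scope classical_set_scope.
Local Open Scope ring_scope.

(* Everything reduces to pointwise exterior algebra and to two facts about d.
   A form on R^m is encoded as a function on lists of vectors, a k-form
   vanishing on the lists whose length is not k; wedge product and exterior
   derivative are then defined by recursion on the list, by the Leibniz rule
   for contractions and by Cartan's formula for constant vectors, and their
   identities follow by induction on lists without any cast between degrees.

   Let m = 2n and let w be nondegenerate. Contracting the vanishing form
   t /\ w^(n-1) of degree 2n + 1 shows that, for a 3-form t,
     n (n - 1) t /\ w^(n-2) = - i_X w^n   iff   w(Y, X) = tr_w (i_Y t) for all Y,
   where n s /\ w^(n-1) = tr_w(s) w^n for 2-forms s. Since dw = 0, the equation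
   d(a /\ w^(n-2)) = - i_X w^n / (n (n - 1)) is the left side for t = da, hence
   has exactly one solution X, given explicitly by the right side, which is
   also the coordinate formula in a Darboux chart. Conversely, contracting
   a /\ e /\ w^(n-1) = 0 for a covector e gives an explicit inverse of
   a |-> a /\ w^(n-2) from 2-forms to (2n-2)-forms, so a primitive of
   - i_X w^n yields a. *)

(** * Forms as functions on lists of vectors *)

(** Smoothness is defined by continuity of iterated directional derivatives, so neither the
    linearity of ['D_v f] in [v] nor the symmetry of second derivatives is given. Both are derived
    from the mean value theorem, and every property of d rests on them. Global objects are built
    from chart formulas, and their transformation laws come from uniqueness, not from computation.
    The field X is a rational expression in the Gram matrix of w, which gives smoothness; it
    transforms correctly because its equation is natural and has one solution. The inverse of a |->
    a /\ w^(n-2) is written with the standard basis of the chart, so its smoothness is visible but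
    its invariance is not; invariance follows from injectivity of the map. For this reason d has to
    be natural only on 2-forms. The constant n (n - 1) arises from two contractions, i_Y w^n = n i_Y
    w /\ w^(n-1) and the same rule for w^(n-1). Volume preservation is Cartan's formula: w^n is
    closed, and i_X w^n is closed because it is exact. *)

Section ListForms.
Variables (R : numFieldType) (m : nat).
Local Notation V := 'rV[R]_m.
Implicit Types (a b c : seq V -> R) (s p q : seq V) (u v w : V) (k : 'I_m).

Definition lscale (r : R) a : seq V -> R := fun s => r * a s.
Local Notation "r *L a" := (lscale r a) (at level 40).

Definition lcontract v a : seq V -> R := fun s => a (v :: s).

(** The parity involution of the exterior algebra. Reading the sign off the length of the list makes
    it meaningful for functions of mixed degree, so the Leibniz rule for contractions never mentions
    a degree. *)
Definition grade_sign a : seq V -> R := fun s => (-1) ^+ size s * a s.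

(* The shuffle product, through i_v(a /\ b) = i_v a /\ b + (-1)^deg(a) a /\ i_v b. *)
Fixpoint shuffle s a b : R :=
  if s is v :: s' then
    shuffle s' (lcontract v a) b + shuffle s' (grade_sign a) (lcontract v b)
  else a [::] * b [::].

Definition lwedge a b : seq V -> R := fun s => shuffle s a b.

Definition lunit : seq V -> R := fun s => if s is [::] then 1 else 0.

Definition lone (f : V -> R) : seq V -> R := fun s => if s is [:: v] then f v else 0.

Definition dual_coord k : seq V -> R := lone (fun v => v 0 k).

Definition bvec k : V := delta_mx 0 k.

Fixpoint lpow a j : seq V -> R := if j is j'.+1 then lwedge a (lpow a j') else lunit.

Definition homogeneous d a := forall s, size s != d -> a s = 0.

Definition even_form a := grade_sign a = a.
Definition odd_form a := grade_sign a = - a.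

Definition lmultilinear a := forall p u v r s,
  a (p ++ (r *: u + v) :: s) = r * a (p ++ u :: s) + a (p ++ v :: s).
Definition lantisymmetric a := forall p u v s,
  a (p ++ u :: v :: s) = - a (p ++ v :: u :: s).
Definition lalternating a := lmultilinear a /\ lantisymmetric a.

Lemma lf_add a b s : (a + b) s = a s + b s. Proof. by []. Qed.
Lemma lf_opp a s : (- a) s = - a s. Proof. by []. Qed.
Lemma lf_zero s : (0 : seq V -> R) s = 0. Proof. by []. Qed.
Lemma lf_scale r a s : (r *L a) s = r * a s. Proof. by []. Qed.
Lemma lf_sum (I : finType) (F : I -> seq V -> R) s :
  (\sum_i F i) s = \sum_i F i s.
Proof. by apply: (big_morph (fun a => a s)). Qed.
Definition lfE := (lf_add, lf_opp, lf_zero, lf_scale, lf_sum).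

Lemma lscale1 a : 1 *L a = a.
Proof. by apply/funext => s; exact: mul1r. Qed.
Lemma lscaleN1 a : -1 *L a = - a.
Proof. by apply/funext => s; exact: mulN1r. Qed.
Lemma lscale0l a : 0 *L a = 0.
Proof. by apply/funext => s; exact: mul0r. Qed.
Lemma lscale0r r : r *L 0 = 0.
Proof. by apply/funext => s; exact: mulr0. Qed.
Lemma lscaleDr r a b : r *L (a + b) = r *L a + r *L b.
Proof. by apply/funext => s; exact: mulrDr. Qed.
Lemma lscaleDl r t a : (r + t) *L a = r *L a + t *L a.
Proof. by apply/funext => s; exact: mulrDl. Qed.
Lemma lscaleN r a : r *L (- a) = - (r *L a).
Proof. by apply/funext => s; exact: mulrN. Qed.
Lemma lscaleA r t a : r *L (t *L a) = (r * t) *L a.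
Proof. by apply/funext => s; exact: mulrA. Qed.
Lemma lscale_sumr r (I : finType) (F : I -> seq V -> R) :
  r *L (\sum_i F i) = \sum_i r *L F i.
Proof. by apply: (big_morph (lscale r)) => [x y|]; [exact: lscaleDr|exact: lscale0r]. Qed.
Lemma lscale_suml a (I : finType) (F : I -> R) :
  (\sum_i F i) *L a = \sum_i F i *L a.
Proof. by apply: (big_morph (lscale^~ a)) => [x y|]; [exact: lscaleDl|exact: lscale0l]. Qed.
Lemma lwedge_cons a b v s : lwedge a b (v :: s) =
  lwedge (lcontract v a) b s + lwedge (grade_sign a) (lcontract v b) s.
Proof. by []. Qed.

Lemma contract_lwedge v a b : lcontract v (lwedge a b) =
  lwedge (lcontract v a) b + lwedge (grade_sign a) (lcontract v b).
Proof. by []. Qed.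

Lemma contractD v a b : lcontract v (a + b) = lcontract v a + lcontract v b.
Proof. by []. Qed.
Lemma contractN v a : lcontract v (- a) = - lcontract v a.
Proof. by []. Qed.
Lemma contractZ v r a : lcontract v (r *L a) = r *L lcontract v a.
Proof. by []. Qed.
Lemma contract0 v : lcontract v 0 = 0.
Proof. by []. Qed.
Lemma grade_signD a b : grade_sign (a + b) = grade_sign a + grade_sign b.
Proof. by apply/funext => s; rewrite /grade_sign !lfE mulrDr. Qed.
Lemma grade_signZ r a : grade_sign (r *L a) = r *L grade_sign a.
Proof. by apply/funext => s; exact: mulrCA. Qed.
Lemma grade_signK a : grade_sign (grade_sign a) = a.
Proof. by apply/funext => s; rewrite /grade_sign mulrA -expr2 sqrr_sign mul1r. Qed.
Lemma contract_grade_sign v a : lcontract v (grade_sign a) = - grade_sign (lcontract v a).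
Proof.
by apply/funext => s; rewrite /lcontract /grade_sign /= !lfE exprS mulN1r mulNr.
Qed.

Lemma lwedgeDl a b c : lwedge (a + b) c = lwedge a c + lwedge b c.
Proof.
apply/funext => s; rewrite lfE; elim: s a b c => [|v s IH] a b c.
  by rewrite /lwedge /= !lfE mulrDl.
by rewrite !lwedge_cons contractD grade_signD !IH addrACA.
Qed.

Lemma lwedgeDr a b c : lwedge a (b + c) = lwedge a b + lwedge a c.
Proof.
apply/funext => s; rewrite lfE; elim: s a b c => [|v s IH] a b c.
  by rewrite /lwedge /= !lfE mulrDr.
by rewrite !lwedge_cons contractD !IH addrACA.
Qed.

Lemma lwedgeZl r a b : lwedge (r *L a) b = r *L lwedge a b.
Proof.
apply/funext => s; rewrite lfE; elim: s a b => [|v s IH] a b.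
  by apply/esym; exact: mulrA.
by rewrite !lwedge_cons contractZ grade_signZ !IH mulrDr.
Qed.

Lemma lwedgeZr r a b : lwedge a (r *L b) = r *L lwedge a b.
Proof.
apply/funext => s; rewrite lfE; elim: s a b => [|v s IH] a b.
  by exact: mulrCA.
by rewrite !lwedge_cons contractZ !IH mulrDr.
Qed.

Lemma lwedgeNl a b : lwedge (- a) b = - lwedge a b.
Proof. by rewrite -lscaleN1 lwedgeZl lscaleN1. Qed.
Lemma lwedgeNr a b : lwedge a (- b) = - lwedge a b.
Proof. by rewrite -lscaleN1 lwedgeZr lscaleN1. Qed.
Lemma lwedge0l a : lwedge 0 a = 0.
Proof. by rewrite -[X in lwedge X _](lscale0l 0) lwedgeZl lscale0l. Qed.
Lemma lwedge0r a : lwedge a 0 = 0.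
Proof. by rewrite -[X in lwedge _ X](lscale0l 0) lwedgeZr lscale0l. Qed.
Lemma lwedge_suml (I : finType) (F : I -> seq V -> R) b :
  lwedge (\sum_i F i) b = \sum_i lwedge (F i) b.
Proof.
by apply: (big_morph (lwedge^~ b)) => [x y|]; rewrite ?lwedge0l ?lwedgeDl.
Qed.

Lemma grade_sign_lwedge a b :
  grade_sign (lwedge a b) = lwedge (grade_sign a) (grade_sign b).
Proof.
apply/funext => s; elim: s a b => [|v s IH] a b.
  by rewrite /grade_sign /lwedge /= expr0 !mul1r.
rewrite {1}/grade_sign [size _]/= exprS -mulrA !lwedge_cons mulrDr.
have h x : (-1) ^+ size s * x s = grade_sign x s by [].
rewrite !h !IH !contract_grade_sign lwedgeNl lwedgeNr !lfE mulN1r opprD.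
by [].
Qed.

(** Contracting with the head vector gives the same three terms on both sides because [grade_sign]
    is multiplicative. *)
Lemma lwedgeA a b c : lwedge (lwedge a b) c = lwedge a (lwedge b c).
Proof.
apply/funext => s; elim: s a b c => [|v s IH] a b c.
  by rewrite /lwedge /= mulrA.
rewrite !lwedge_cons !contract_lwedge lwedgeDl lwedgeDr !lfE.
by rewrite grade_sign_lwedge !IH addrA.
Qed.

(** The even and the odd case are proved together: contraction flips the parity of [a], so each case
    calls the other on the shorter list. *)
Lemma even_odd_comm s : forall a b,
  (even_form a -> lwedge a b s = lwedge b a s) /\
  (odd_form a -> lwedge a b s = lwedge (grade_sign b) a s).
Proof.
elim: s => [|v s IH] a b.
  by split=> _; rewrite /lwedge /= ?mul1r mulrC // /grade_sign /= expr0 mul1r.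
split=> ha; rewrite !lwedge_cons ha.
  have oa : odd_form (lcontract v a).
    by rewrite /odd_form -{2}ha contract_grade_sign opprK.
  by rewrite (proj1 (IH a _) ha) (proj2 (IH _ b) oa) addrC.
have ea : even_form (lcontract v a).
  have := contract_grade_sign v a; rewrite ha contractN => /eqP.
  by rewrite eqr_opp => /eqP; rewrite /even_form => <-.
rewrite grade_signK contract_grade_sign !lwedgeNl !lfE.
by rewrite (proj1 (IH _ _) ea) (proj2 (IH a _) ha) addrC.
Qed.

Lemma even_comm a b : even_form a -> lwedge a b = lwedge b a.
Proof. by move=> ha; apply/funext => s; case: (even_odd_comm s a b) => /(_ ha). Qed.

Lemma odd_comm a b : odd_form a -> lwedge a b = lwedge (grade_sign b) a.
Proof. by move=> ha; apply/funext => s; case: (even_odd_comm s a b) => _ /(_ ha). Qed.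

Lemma lwedge1l a : lwedge lunit a = a.
Proof.
apply/funext => s; elim: s a => [|v s IH] a; first by rewrite /lwedge /= mul1r.
rewrite lwedge_cons.
have -> : lcontract v lunit = 0 by [].
have -> : grade_sign lunit = lunit.
  by apply/funext => -[|x t]; rewrite /grade_sign /= ?expr0 ?mul1r ?mulr0.
by rewrite lwedge0l lfE add0r IH.
Qed.

Lemma contract_lone v f : lcontract v (lone f) = f v *L lunit.
Proof.
by apply/funext => -[|x s]; rewrite /lcontract lfE /= ?mulr1 ?mulr0.
Qed.

Lemma hom_grade_sign d a : homogeneous d a -> grade_sign a = (-1) ^+ d *L a.
Proof.
move=> ha; apply/funext => s; rewrite /grade_sign lfE.
have [->//|/ha ->] := eqVneq (size s) d.
by rewrite !mulr0.
Qed.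

Lemma hom_even d a : homogeneous d a -> ~~ odd d -> even_form a.
Proof. by move=> /hom_grade_sign ha /negbTE od; rewrite /even_form ha -signr_odd od lscale1. Qed.
Lemma hom_odd d a : homogeneous d a -> odd d -> odd_form a.
Proof. by move=> /hom_grade_sign ha od; rewrite /odd_form ha -signr_odd od lscaleN1. Qed.

Lemma hom_contract v d a : homogeneous d.+1 a -> homogeneous d (lcontract v a).
Proof. by move=> ha s sd; apply: ha. Qed.
Lemma hom_contract0 v a : homogeneous 0 a -> lcontract v a = 0.
Proof. by move=> ha; apply/funext => s; apply: ha. Qed.
Lemma hom_contract_pred v d a : homogeneous d a -> homogeneous d.-1 (lcontract v a).
Proof. by case: d => [|d] /=; [move=> /hom_contract0 ->|exact: hom_contract]. Qed.

Lemma homD d a b : homogeneous d a -> homogeneous d b -> homogeneous d (a + b).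
Proof. by move=> ha hb s sd; rewrite lfE ha // hb // addr0. Qed.
Lemma homZ d r a : homogeneous d a -> homogeneous d (r *L a).
Proof. by move=> ha s sd; rewrite lfE ha //; exact: mulr0. Qed.
Lemma homN d a : homogeneous d a -> homogeneous d (- a).
Proof. by move=> ha s sd; rewrite lfE ha // oppr0. Qed.
Lemma hom_sign d a : homogeneous d a -> homogeneous d (grade_sign a).
Proof. by move=> ha; rewrite (hom_grade_sign ha); exact: homZ. Qed.

Lemma hom_lwedge d e a b : homogeneous d a -> homogeneous e b ->
  homogeneous (d + e)%N (lwedge a b).
Proof.
move=> + + s; elim: s d e a b => [|v s IH] d e a b ha hb.
  case: d ha => [|d] ha; first by case: e hb => // e hb _; rewrite /lwedge /= hb ?mulr0.
  by move=> _; rewrite /lwedge /= ha ?mul0r.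
move=> sz; rewrite lwedge_cons.
have -> : lwedge (lcontract v a) b s = 0.
  case: d ha sz => [|d] ha sz; first by rewrite hom_contract0 // lwedge0l.
  by apply: (IH d e) => //; exact: hom_contract.
rewrite add0r; case: e hb sz => [|e] hb sz; first by rewrite (hom_contract0 v hb) lwedge0r.
apply: (IH d e) => //; [exact: hom_sign | exact: hom_contract|].
by move: sz; rewrite addnS.
Qed.

Lemma hom_lunit : homogeneous 0 lunit. Proof. by case. Qed.
Lemma hom_lone f : homogeneous 1 (lone f). Proof. by case=> [|x []]. Qed.
Lemma hom_lpow d a j : homogeneous d a -> homogeneous (j * d)%N (lpow a j).
Proof.
move=> ha; elim: j => [|j IH] /=; first exact: hom_lunit.
by rewrite mulSn; exact: hom_lwedge.
Qed.

Lemma alt_contract v a : lalternating a -> lalternating (lcontract v a).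
Proof. by move=> [la sa]; split=> p *; [exact: (la (v :: p))|exact: (sa (v :: p))]. Qed.
Lemma altD a b : lalternating a -> lalternating b -> lalternating (a + b).
Proof.
move=> [la sa] [lb sb]; split=> p *; rewrite !lfE.
  by rewrite la lb mulrDr addrACA.
by rewrite sa sb opprD.
Qed.
Lemma altZ r a : lalternating a -> lalternating (r *L a).
Proof.
move=> [la sa]; split=> p *; rewrite !lfE.
  by rewrite la mulrDr; congr (_ + _); exact: mulrCA.
by rewrite sa mulrN.
Qed.
Lemma altN a : lalternating a -> lalternating (- a).
Proof. by move=> ha; rewrite -lscaleN1; exact: altZ. Qed.
Lemma alt_sign a : lalternating a -> lalternating (grade_sign a).
Proof.
move=> [la sa]; split=> p *; rewrite /grade_sign !size_cat /=.
  by rewrite la mulrDr; congr (_ + _); exact: mulrCA.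
by rewrite sa mulrN.
Qed.

Lemma alt_linear a : lalternating a -> forall u v r,
  lcontract (r *: u + v) a = r *L lcontract u a + lcontract v a.
Proof. by move=> [la _] u v r; apply/funext => s; exact: (la [::]). Qed.
Lemma alt_swap a : lalternating a -> forall u v,
  lcontract u (lcontract v a) = - lcontract v (lcontract u a).
Proof. by move=> [_ sa] u v; apply/funext => s; exact: (sa [::]). Qed.

(** For the first two arguments the Leibniz rule is applied twice; the mixed terms change sign
    because contraction anticommutes with [grade_sign]. *)
Lemma alt_lwedge a b : lalternating a -> lalternating b -> lalternating (lwedge a b).
Proof.
move=> ha hb; split=> p; elim: p a b ha hb => [|x p IH] a b ha hb.
- move=> u v r s; rewrite !cat0s !lwedge_cons !alt_linear //.
  rewrite lwedgeDl lwedgeDr lwedgeZl lwedgeZr !lfE.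
  by rewrite mulrDr addrACA.
- move=> u v r s; rewrite !cat_cons !lwedge_cons.
  rewrite !IH //; do ?[exact: alt_contract|exact: alt_sign].
  by rewrite mulrDr addrACA.
- move=> u v s; rewrite !cat0s !lwedge_cons !contract_grade_sign !lwedgeNl !lfE.
  rewrite (alt_swap ha v u) (alt_swap hb v u) grade_signK lwedgeNl lwedgeNr !lfE.
  rewrite !opprD !opprK -!addrA; congr (_ + _).
  by rewrite addrCA.
- move=> u v s; rewrite !cat_cons !lwedge_cons.
  rewrite (IH (lcontract x a)) 1?[lwedge (grade_sign a) _ _]IH ?opprD //;
  do ?[exact: alt_contract|exact: alt_sign].
Qed.

Lemma alt_lunit : lalternating lunit.
Proof.
by split=> [] [|x p] * /=; rewrite ?mulr0 ?addr0 ?oppr0.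
Qed.

Lemma alt_dual_coord k : lalternating (dual_coord k).
Proof.
split=> [[|x [|y p]] u v r s|[|x [|y p]] u v s] /=; rewrite /dual_coord /lone /= ?oppr0 //.
- by case: s => [|? ?]; rewrite ?mxE ?mulr0 ?addr0.
- by rewrite mulr0 addr0.
- by rewrite mulr0 addr0.
Qed.

Lemma alt_lpow a j : lalternating a -> lalternating (lpow a j).
Proof. by move=> ha; elim: j => [|j IH] /=; [exact: alt_lunit|exact: alt_lwedge]. Qed.

End ListForms.

Local Notation "r *L a" := (lscale r a) (at level 40).

Arguments dual_coord R {m} k _.

(** * Alternating forms: expansion in a basis and criteria for vanishing *)

Section Alternating.
Variables (R : numFieldType) (m : nat).
Local Notation V := 'rV[R]_m.
Implicit Types (a b c : seq V -> R) (s p q : seq V) (u v w : V) (k : 'I_m).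

Lemma contract_zero a : lalternating a -> lcontract 0 a = 0.
Proof.
move=> ha; have := alt_linear ha 0 0 1; rewrite scaler0 addr0 lscale1 => /esym/eqP.
by rewrite -subr_eq0 addrK => /eqP.
Qed.

Lemma contract_vecD a u v : lalternating a ->
  lcontract (u + v) a = lcontract u a + lcontract v a.
Proof. by move=> ha; have := alt_linear ha u v 1; rewrite scale1r lscale1. Qed.

Lemma contract_vecZ a r u : lalternating a ->
  lcontract (r *: u) a = r *L lcontract u a.
Proof.
by move=> ha; have := alt_linear ha u 0 r; rewrite !addr0 contract_zero // addr0.
Qed.

Lemma contract_vec_sum a (I : finType) (F : I -> V) : lalternating a ->
  lcontract (\sum_i F i) a = \sum_i lcontract (F i) a.
Proof.
move=> ha; apply: (big_morph (fun v => lcontract v a)) => [u v|].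
  exact: contract_vecD.
exact: contract_zero.
Qed.

Lemma contract_expand a v : lalternating a ->
  lcontract v a = \sum_k v 0 k *L lcontract (bvec R k) a.
Proof.
move=> ha; rewrite {1}(row_sum_delta v) contract_vec_sum //.
by apply: eq_bigr => k _; rewrite contract_vecZ.
Qed.

Lemma alt_move a p x q s : lalternating a ->
  a (p ++ x :: q ++ s) = (-1) ^+ size q * a (p ++ q ++ x :: s).
Proof.
move=> ha; elim: q p => [|y q IH] p /=; first by rewrite mul1r.
have [_ ->] := ha; rewrite -cat_rcons IH exprS mulN1r mulNr cat_rcons.
by [].
Qed.

Lemma alt_repeat a p x q s : lalternating a -> a (p ++ x :: q ++ x :: s) = 0.
Proof.
move=> ha; rewrite (alt_move p x q (x :: s) ha) catA.
have [_ h] := ha; have := h (p ++ q) x x s => /eqP.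
by rewrite -addr_eq0 -mulr2n mulrn_eq0 /= => /eqP ->; rewrite mulr0.
Qed.

(** The step required by [catCA_perm_ind]. Only vanishing is transported, so no permutation sign has
    to be tracked. *)
Lemma alt_swap_blocks a p q r s : lalternating a ->
  a (p ++ q ++ r ++ s) = 0 -> a (p ++ r ++ q ++ s) = 0.
Proof.
move=> ha; elim: q p => [//|x q IH] p /=.
rewrite -cat_rcons => /IH; rewrite cat_rcons alt_move // => /eqP.
by rewrite mulf_eq0 signr_eq0 => /eqP.
Qed.

Definition basis_list : seq V := [seq bvec R k | k <- enum 'I_m].

Lemma alt_top_eq0 a : lalternating a -> homogeneous m a -> a basis_list = 0 -> a = 0.
Proof.
move=> ha hom a0; apply/funext => s; rewrite lfE.
have [sz|/hom //] := eqVneq (size s) m.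
(* The arguments are expanded in the basis one after the other; [l] records the indices chosen so
   far. *)
suff h : forall (l : seq 'I_m), (size l + size s)%N = m ->
    a ([seq bvec R k | k <- l] ++ s) = 0 by apply: (h [::]).
elim: s {sz} => [|v s IH] l.
  (* A repetition-free list of m indices is a permutation of all of them; otherwise two arguments
     coincide. *)
  rewrite addn0 cats0 => sl; have [ul|] := boolP (uniq l).
    have pl : perm_eq (enum 'I_m) l.
      apply: uniq_perm => //; first exact: enum_uniq.
      move=> i; apply/esym; apply: (uniq_min_size ul _ _).2 => [j _|]; rewrite ?mem_enum //.
      by rewrite sl size_enum_ord.
    apply: (catCA_perm_ind (P := fun l => a [seq bvec R k | k <- l] = 0) _ pl a0).
    by move=> l1 l2 l3; rewrite !map_cat; exact: (alt_swap_blocks (p := [::])).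
  case: l sl => [//|x0 l0]; set l := x0 :: l0 => sl /(uniqPn x0)[i [j [ij jl e]]].
  have il : (i < size l)%N by exact: ltn_trans jl.
  rewrite -(cat_take_drop i l) (drop_nth x0) // map_cat map_cons.
  have dj : (j - i.+1 < size (drop i.+1 l))%N by rewrite size_drop ltn_sub2r // (leq_trans _ jl).
  rewrite -[drop i.+1 l](cat_take_drop (j - i.+1)) [drop (j - _) _](drop_nth x0) //.
  rewrite nth_drop subnKC // -e !map_cat map_cons.
  exact: alt_repeat.
move=> sl.
have [la _] := ha.
have lin p t : a (p ++ v :: t) = \sum_k v 0 k * a (p ++ bvec R k :: t).
  rewrite {1}(row_sum_delta v).
  have h0 : a (p ++ 0 :: t) = 0.
    by have := la p 0 0 1 t; rewrite scaler0 addr0 mul1r => /esym/eqP; rewrite -subr_eq0 addrK => /eqP.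
  elim/big_rec2: _ => // k y x _ <-.
  by rewrite la.
rewrite lin big1 // => k _.
by rewrite -cat_rcons -map_rcons IH ?mulr0 // size_rcons addSnnS.
Qed.

(** The sum of the operators e^k /\ i_(e_k) counts the degree: contracting it with [v] yields
    [lcontract v a] once, plus the same sum applied to [lcontract v a]. *)
Lemma euler_identity a s : lalternating a ->
  (\sum_k lwedge (dual_coord R k) (lcontract (bvec R k) a)) s = (size s)%:R * a s.
Proof.
elim: s a => [|v s IH] a ha.
  by rewrite mul0r lfE big1 // => k _; rewrite /lwedge /= mul0r.
rewrite lfE /= mulrS mulrDl mul1r.
have -> : a (v :: s) = lcontract v a s by [].
rewrite -(IH (lcontract v a)); last exact: alt_contract.
rewrite {1}(contract_expand v ha) !lfE -big_split /=; apply: eq_bigr => k _.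
rewrite contract_lone lwedgeZl lwedge1l lfE; congr (_ + _).
rewrite (hom_odd (hom_lone _)) // lwedgeNl alt_swap // lwedgeNr.
by rewrite !lfE opprK.
Qed.

(* Induction on s: J collects the basis vectors whose contraction with a is zero. *)
Lemma alt_vanish a s : lalternating a -> (m < size s)%N -> a s = 0.
Proof.
move=> ha sz.
suff h : forall (J : {set 'I_m}) a, lalternating a ->
    (forall j, j \in J -> lcontract (bvec R j) a = 0) ->
    (m < size s + #|J|)%N -> a s = 0.
  by apply: (h finset.set0) => // [j|]; rewrite ?inE // cards0 addn0.
elim: s {a ha sz} => [|v s IH] J a ha hJ sz.
  by move: sz; rewrite add0n ltnNge -[leqRHS](card_ord m) max_card.
have -> : a (v :: s) = lcontract v a s by [].
rewrite contract_expand // lfE big1 // => k _; rewrite lfE.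
have [kJ|kJ] := boolP (k \in J); first by rewrite hJ // lfE mulr0.
rewrite (IH (k |: J)) ?mulr0 //; first exact: alt_contract.
  move=> j; rewrite !inE => /orP[/eqP ->|/hJ e].
    by apply/funext => t; exact: (alt_repeat [::] _ [::]).
  by rewrite alt_swap // e contract0 oppr0.
by rewrite cardsU1 kJ addnCA add1n.
Qed.

Lemma alt_hom_vanish a d : lalternating a -> homogeneous d a -> (m < d)%N -> a = 0.
Proof.
move=> ha hd md; apply/funext => s; rewrite lfE.
have [sz|/hd //] := eqVneq (size s) d.
by rewrite alt_vanish // sz.
Qed.

(* The sum over k of i_(e_k)(e^k /\ a) is (m - d) a. *)
Lemma alt_dual_coord_eq0 a d : lalternating a -> homogeneous d a -> (d < m)%N ->
  (forall k, lwedge (dual_coord R k) a = 0) -> a = 0.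
Proof.
move=> ha hd dm h0; apply/funext => s; rewrite lfE.
have [sz|/hd //] := eqVneq (size s) d.
have := euler_identity s ha; rewrite lfE.
have -> : \sum_k lwedge (dual_coord R k) (lcontract (bvec R k) a) s = m%:R * a s.
  rewrite -[in RHS](card_ord m) -sum1_card natr_sum mulr_suml; apply: eq_bigr => k _.
  have : lcontract (bvec R k) (lwedge (dual_coord R k) a) s = 0 by rewrite h0.
  rewrite contract_lwedge contract_lone !mxE !eqxx lscale1 lwedge1l.
  rewrite (hom_odd (hom_lone _)) // lwedgeNl !lfE => /eqP.
  by rewrite subr_eq0 mul1r => /eqP <-.
rewrite sz => /eqP; rewrite -subr_eq0 -mulrBl mulf_eq0 subr_eq0 eqr_nat.
by rewrite (gtn_eqF dm) => /eqP.
Qed.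

Definition gram a : 'M[R]_m := \matrix_(i, j) a [:: bvec R i; bvec R j].

Lemma gramE a u v : lalternating a -> a [:: u; v] = (u *m gram a *m v^T) 0 0.
Proof.
move=> ha; have -> : a [:: u; v] = lcontract u a [:: v] by [].
have E i : lcontract (bvec R i) a [:: v] = \sum_j v 0 j * a [:: bvec R i; bvec R j].
  have -> : lcontract (bvec R i) a [:: v] = lcontract v (lcontract (bvec R i) a) [::] by [].
  rewrite contract_expand; last exact: alt_contract.
  by rewrite lfE; apply: eq_bigr => j _; rewrite lfE.
rewrite contract_expand // lfE.
under eq_bigr => i _ do rewrite lfE E mulr_sumr.
rewrite exchange_big mxE; apply: eq_bigr => j _ /=.
rewrite !mxE mulr_suml; apply: eq_bigr => i _; rewrite mxE.
by rewrite mulrA mulrAC.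
Qed.

Lemma contract_gram a b u v : lalternating a -> lalternating b ->
  homogeneous 2 a -> homogeneous 2 b ->
  u *m gram a = v *m gram b -> lcontract u a = lcontract v b.
Proof.
move=> aa ab ha hb e; apply/funext => s.
have [|sz] := eqVneq (size s) 1%N; last first.
  by rewrite (hom_contract u ha sz) (hom_contract v hb sz).
case: s => [|x [|]] // _; rewrite /lcontract !gramE // e //.
Qed.

Lemma gram_alt a u : lalternating a -> (u *m gram a *m u^T) 0 0 = 0.
Proof. by move=> ha; rewrite -gramE //; exact: (alt_repeat [::] _ [::]). Qed.

End Alternating.

(** * Linear symplectic algebra *)

Section Lefschetz.
Variables (R : numFieldType) (n : nat).
Local Notation m := (n + n)%N.
Local Notation V := 'rV[R]_m.
Implicit Types (a b c : seq V -> R) (s p q : seq V) (u v w : V) (k : 'I_m).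

Variable om : seq V -> R.
Hypothesis altom : lalternating om.
Hypothesis homom : homogeneous 2 om.
Hypothesis gramom : gram om \in unitmx.

Let omev : even_form om. Proof. exact: (hom_even homom). Qed.
Let powev j : even_form (lpow om j).
Proof. by apply: (hom_even (hom_lpow homom)); rewrite oddM andbF. Qed.

(** Contraction acts on powers of an even form as an ordinary derivation. For j = 0 the coefficient
    is zero, so the truncated [j.-1] is harmless. *)
Lemma contract_lpow v j :
  lcontract v (lpow om j) = j%:R *L lwedge (lcontract v om) (lpow om j.-1).
Proof.
elim: j => [|j IH]; first by rewrite lscale0l.
rewrite /= contract_lwedge omev IH; case: j IH => [|j] IH.
  by rewrite lscale0l lwedge0r addr0 lscale1.
rewrite /= lwedgeZr -[X in _ + _ *L X]lwedgeA (even_comm (lcontract v om) omev).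
by rewrite lwedgeA -[X in X + _]lscale1 -lscaleDl nat1r.
Qed.

(** By nondegeneracy every coordinate covector is i_Y w for a row Y of the inverse Gram matrix.
    Identities proved for all i_Y w can therefore be fed to [alt_dual_coord_eq0]. *)
Lemma contract_om_dual k : lcontract (row k (invmx (gram om))) om = dual_coord R k.
Proof.
apply/funext => s; have [|sz] := eqVneq (size s) 1%N; last first.
  by rewrite (hom_contract _ homom sz) /dual_coord hom_lone.
case: s => [|x [|]] // _; rewrite /lcontract gramE // -row_mul mulVmx // /dual_coord /=.
by rewrite row1 -rowE !mxE.
Qed.

Definition top_power := lpow om n.

Let alttop : lalternating top_power. Proof. exact: alt_lpow. Qed.
Let homtop : homogeneous m top_power.
Proof. by have := hom_lpow (j := n) homom; rewrite muln2 -addnn. Qed.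
Let homp j : homogeneous j.*2 (lpow om j).
Proof. by rewrite -muln2; exact: hom_lpow. Qed.

(* If w^(j+1) = 0 then contraction gives e /\ w^j = 0 for every covector e. *)
Lemma lpow_neq0 j : (j <= n)%N -> lpow om j != 0.
Proof.
elim: j => [_|j IH jn] /=.
  by apply/eqP => /(congr1 (fun f => f [::])) /eqP; rewrite oner_eq0.
apply: contra_neq (IH (ltnW jn)) => h0.
apply: (@alt_dual_coord_eq0 _ _ _ j.*2); [exact: alt_lpow|exact: homp|lia|].
move=> k; rewrite -contract_om_dual.
have := contract_lpow (row k (invmx (gram om))) j.+1.
rewrite /= h0 contract0 => /(congr1 (lscale j.+1%:R^-1)).
by rewrite lscale0r lscaleA mulVf ?pnatr_eq0 // lscale1.
Qed.

Lemma lwedge_lone_top a : lalternating a -> homogeneous 1 a -> lwedge a top_power = 0.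
Proof.
move=> aa ha; apply: (alt_hom_vanish (alt_lwedge aa alttop) (hom_lwedge ha homtop)).
by rewrite add1n.
Qed.

(** The form a /\ w^n has degree 2n + 1, hence is zero, and so is its contraction with [v]. *)
Lemma lwedge_contract_top a v : lalternating a -> homogeneous 1 a ->
  lwedge a (lcontract v top_power) = a [:: v] *L top_power.
Proof.
move=> aa ha; have : lcontract v (lwedge a top_power) = 0 by rewrite lwedge_lone_top.
rewrite contract_lwedge (hom_odd ha) // lwedgeNl => /eqP; rewrite subr_eq0 => /eqP <-.
have -> : lcontract v a = a [:: v] *L (lunit (R:=R) (m:=m)).
  apply/funext => -[|x s]; rewrite /lcontract lfE /= ?mulr1 ?mulr0 //.
  by rewrite ha.
by rewrite lwedgeZl lwedge1l.
Qed.

Lemma lwedge_one_one_pow k v :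
  n%:R *L lwedge (dual_coord R k) (lwedge (lcontract v om) (lpow om n.-1)) =
  v 0 k *L top_power.
Proof.
rewrite -lwedgeZr -contract_lpow lwedge_contract_top //; first exact: alt_dual_coord.
exact: hom_lone.
Qed.

(** The factor 1/2 compensates for the trace over all 2n directions; with it the trace of [om]
    itself is n. *)
Definition om_trace a : R := 2^-1 * \tr (gram a *m invmx (gram om)).

(** The Euler identity writes 2 a as the sum of e^k /\ i_(e_k) a. Each i_(e_k) a equals i_Y w for Y
    the k-th row of S W^-1, with S and W the Gram matrices of a and w, so the k-th term contributes
    the k-th diagonal entry. *)
Lemma lwedge_two_pow a : lalternating a -> homogeneous 2 a ->
  n%:R *L lwedge a (lpow om n.-1) = om_trace a *L top_power.
Proof.
move=> aa ha.
pose Y k := row k (gram a *m invmx (gram om)).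
have cY k : lcontract (Y k) om = lcontract (bvec R k) a.
  apply: contract_gram => //; rewrite /Y row_mul -mulmxA mulVmx // mulmx1.
  by rewrite rowE.
have e2 : 2 *L a = \sum_k lwedge (dual_coord R k) (lcontract (Y k) om).
  apply/funext => s; under eq_bigr => k _ do rewrite cY.
  rewrite euler_identity // lfE.
  by have [->//|/ha->] := eqVneq (size s) 2%N; rewrite !mulr0.
have -> : a = 2^-1 *L (2 *L a) by rewrite lscaleA mulVf ?pnatr_eq0 // lscale1.
rewrite {1}e2 lwedgeZl lscaleA mulrC -lscaleA lwedge_suml lscale_sumr.
under eq_bigr => k _ do rewrite lwedgeA lwedge_one_one_pow.
rewrite -lscale_suml lscaleA; congr (_ *L _).
rewrite lscaleA mulVf ?pnatr_eq0 // lscale1 /om_trace; congr (_ * _).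
by apply: eq_bigr => k _; rewrite /Y mxE.
Qed.

Lemma contract_lpow_pred v : (2 <= n)%N ->
  lcontract v (lpow om n.-1) = n.-1%:R *L lwedge (lcontract v om) (lpow om (n - 2)).
Proof. by move=> hn; rewrite contract_lpow; congr (_ *L lwedge _ (lpow _ _)); lia. Qed.

(* Contraction of t /\ w^(n-1) = 0 and of w^n with a vector Y. *)
Section Three.
Variables (tau : seq V -> R) (X : V).
Hypotheses (hn : (2 <= n)%N) (alttau : lalternating tau) (homtau : homogeneous 3 tau).

Lemma lwedge_three_pow Y :
  (n%:R * n.-1%:R) *L
    lwedge (lcontract Y om) (lwedge tau (lpow om (n - 2))) =
  - (om_trace (lcontract Y tau) *L top_power).
Proof.
have : lwedge tau (lpow om n.-1) = 0.
  apply: (@alt_hom_vanish _ _ _ (3 + n.-1.*2)); [exact/alt_lwedge/alt_lpow|exact: hom_lwedge|].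
  by lia.
move=> /(congr1 (lcontract Y)) /(congr1 (lscale n%:R)).
rewrite contract0 lscale0r contract_lwedge (hom_odd homtau) // lwedgeNl lscaleDr.
rewrite lwedge_two_pow; [|exact: alt_contract|exact: hom_contract].
rewrite contract_lpow_pred // lwedgeZr lscaleN lscaleA -!lwedgeA => /eqP.
rewrite subr_eq0 => /eqP ->; rewrite (odd_comm (lcontract Y om) (hom_odd homtau _)) //.
by rewrite (hom_odd (hom_contract Y homom)) // !lwedgeNl lscaleN opprK.
Qed.

(** A (2n-1)-form is determined by its products with the covectors i_Y w, which exhaust all
    covectors. Each such product is a multiple of w^n, and this turns the equation of forms into
    scalar equations. *)
Lemma lwedge_three_powP :
  (n%:R * n.-1%:R) *L lwedge tau (lpow om (n - 2)) = - lcontract X top_power <->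
  forall Y, om [:: Y; X] = om_trace (lcontract Y tau).
Proof.
have key Y : (n%:R * n.-1%:R) *L lwedge (lcontract Y om) (lwedge tau (lpow om (n - 2))) +
     lwedge (lcontract Y om) (lcontract X top_power) =
   (om [:: Y; X] - om_trace (lcontract Y tau)) *L top_power.
  rewrite lwedge_three_pow lwedge_contract_top; [|exact: alt_contract|exact: hom_contract].
  by rewrite lscaleDl addrC; congr (_ + _); apply/funext => s; rewrite !lfE mulNr.
split=> h.
  move=> Y; have := key Y; rewrite -lwedgeZr h lwedgeNr addNr => e.
  apply/eqP; rewrite -subr_eq0; apply: contraT => nz.
  have : (om [:: Y; X] - om_trace (lcontract Y tau))^-1 *L 0 = top_power.
    by rewrite [X in _ *L X]e lscaleA mulVf // lscale1.
  rewrite lscale0r => /esym/eqP; rewrite (negbTE (lpow_neq0 _)) //.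
apply/eqP; rewrite -subr_eq0 opprK; apply/eqP.
apply: (@alt_dual_coord_eq0 _ _ _ m.-1); last first.
- by move=> k; rewrite -contract_om_dual lwedgeDr lwedgeZr key h subrr lscale0l.
- by lia.
- apply: homD; last exact: hom_contract_pred.
  apply: homZ; have := hom_lwedge homtau (@homp (n - 2)%N); congr (homogeneous _ _).
  by lia.
- apply: altD; last exact: alt_contract.
  by apply/altZ/alt_lwedge => //; exact: alt_lpow.
Qed.

End Three.

(** The k-th coordinate of a vector is recovered from e^k /\ i_u w^n = u_k w^n, and w^n is not
    zero. *)
Lemma contract_top_inj u v : (0 < n)%N -> lcontract u top_power = lcontract v top_power -> u = v.
Proof.
move=> n0 e; apply/rowP => k; apply/eqP; rewrite -subr_eq0; apply: contraT => nz.
have : (u 0 k - v 0 k) *L top_power = 0.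
  rewrite lscaleDl; have -> : - v 0 k *L top_power = - (v 0 k *L top_power).
    by apply/funext => s; rewrite !lfE mulNr.
  have h w : w 0 k *L top_power = lwedge (dual_coord R k) (lcontract w top_power).
    by rewrite lwedge_contract_top //; [exact: alt_dual_coord|exact: hom_lone].
  by rewrite !h e subrr.
move=> /(congr1 (lscale (u 0 k - v 0 k)^-1)); rewrite lscaleA mulVf // lscale1 lscale0r.
by move/eqP; rewrite (negbTE (lpow_neq0 _)).
Qed.

Lemma top_power_neq0 : top_power (basis_list R m) != 0.
Proof.
apply: contraNneq (lpow_neq0 (leqnn n)) => h.
by apply/eqP; exact: (alt_top_eq0 alttop homtop h).
Qed.

Lemma top_unique a : lalternating a -> homogeneous m a ->
  a = (a (basis_list R m) / top_power (basis_list R m)) *L top_power.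
Proof.
move=> aa ha; apply/eqP; rewrite -subr_eq0; apply/eqP; apply: alt_top_eq0.
- by apply: altD => //; apply/altN/altZ.
- by apply: homD => //; apply/homN/homZ.
- by rewrite !lfE divfK ?subrr // top_power_neq0.
Qed.

(* Contraction of a /\ e^k /\ w^(n-1) = 0 with Y. *)
Lemma lwedge_lefschetz_pairing a k Y : (2 <= n)%N -> lalternating a -> homogeneous 2 a ->
  (n%:R * n.-1%:R) *L lwedge (dual_coord R k)
     (lwedge (lcontract Y om) (lwedge a (lpow om (n - 2)))) =
  (om_trace a * Y 0 k - (Y *m gram a *m invmx (gram om)) 0 k) *L top_power.
Proof.
move=> hn aa ha; pose th := dual_coord R k; pose P1 := lpow om n.-1.
have oth : odd_form th by exact: (hom_odd (hom_lone _)).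
have ea : even_form a by exact: (hom_even ha).
set Z := Y *m gram a *m invmx (gram om).
have cZ : lcontract Y a = lcontract Z om.
  by apply: contract_gram => //; rewrite /Z -mulmxA mulVmx // mulmx1.
have : lwedge a (lwedge th P1) = 0.
  apply: (@alt_hom_vanish _ _ _ (2 + (1 + n.-1.*2))); last by lia.
    apply: alt_lwedge => //; apply: alt_lwedge; first exact: alt_dual_coord.
    exact: alt_lpow.
  by apply: hom_lwedge => //; apply: hom_lwedge => //; exact: hom_lone.
move=> /(congr1 (lcontract Y)) /(congr1 (lscale n%:R)).
rewrite contract0 lscale0r !contract_lwedge ea cZ oth lwedgeNl.
rewrite contract_lpow_pred // contract_lone lwedgeZl lwedge1l lwedgeZr.
rewrite lwedgeDr lwedgeZr lwedgeNr lwedgeZr.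
have -> : lwedge (lcontract Z om) (lwedge th P1) = - lwedge th (lwedge (lcontract Z om) P1).
  by rewrite -!lwedgeA (odd_comm th (hom_odd (hom_contract Z homom) _)) // oth !lwedgeNl.
have -> : lwedge th (lwedge (lcontract Y om) (lwedge a (lpow om (n - 2)))) =
          lwedge a (lwedge th (lwedge (lcontract Y om) (lpow om (n - 2)))).
  by rewrite (even_comm (lwedge th _) ea) !lwedgeA (even_comm a (powev _)).
rewrite !lscaleDr !lscaleN lwedge_one_one_pow !lscaleA (mulrC n%:R (Y 0 k)) -(lscaleA (Y 0 k)).
rewrite lwedge_two_pow // addrA => /eqP; rewrite subr_eq0 => /eqP <-.
by apply/funext => s; rewrite !lfE; ring.
Qed.

(** The pairing identity makes S W^-1 a scalar matrix, so [a] is a multiple of [om]; the trace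
    excludes a nonzero multiple. *)
Lemma om_trace_lefschetz a : (2 <= n)%N -> lalternating a -> homogeneous 2 a ->
  lwedge a (lpow om (n - 2)) = 0 -> a = 0.
Proof.
move=> hn aa ha h0.
have key (Y : V) k : (Y *m gram a *m invmx (gram om)) 0 k = om_trace a * Y 0 k.
  have := lwedge_lefschetz_pairing k Y hn aa ha; rewrite h0 !lwedge0r lscale0r => /esym e.
  apply/eqP; rewrite -subr_eq0 -opprB oppr_eq0; apply: contraT => nz.
  have := congr1 (lscale (om_trace a * Y 0 k - (Y *m gram a *m invmx (gram om)) 0 k)^-1) e.
  by rewrite lscaleA mulVf // lscale1 lscale0r => /eqP; rewrite (negbTE (lpow_neq0 _)).
have eN : gram a *m invmx (gram om) = (om_trace a)%:M.
  apply/row_matrixP => i; apply/rowP => k.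
  have := key (delta_mx 0 i) k; rewrite -mulmxA -rowE => ->.
  by rewrite !mxE /= mulr_natr eq_sym.
(* Half the trace of [t%:M] in dimension 2n is n t, so t = n t, and n >= 2 leaves t = 0. *)
have t0 : om_trace a = 0.
  have := erefl (om_trace a); rewrite {1}/om_trace eN mxtrace_scalar => /eqP.
  rewrite -subr_eq0 -(mulr_natr (om_trace a)) natrD.
  have -> : 2^-1 * (om_trace a * (n%:R + n%:R)) - om_trace a = om_trace a * (n%:R - 1).
    by field.
  rewrite mulf_eq0 subr_eq0 => /orP[/eqP//|].
  by rewrite (eqr_nat R n 1) => /eqP n1; move: hn; rewrite n1.
have g0 : gram a = 0.
  have := congr1 (mulmx^~ (gram om)) eN.
  by rewrite -mulmxA mulVmx // mulmx1 t0 mul_scalar_mx scale0r.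
apply/funext => s; rewrite lfE; have [|/ha//] := eqVneq (size s) 2%N.
by case: s => [|x [|y [|]]] // _; rewrite gramE // g0 mulmx0 mul0mx mxE.
Qed.

End Lefschetz.

(** * The permutation sum in [wedge_cov] as an iterated contraction *)

Section Permutations.
Variables (R : numFieldType) (m : nat).
Local Notation V := 'rV[R]_m.
Implicit Types (a b c : seq V -> R) (s p q : seq V) (u v w : V).

Definition perm_seq N (sg : 'S_N) s : seq V := [seq nth 0 s (sg j) | j <- enum 'I_N].

Lemma size_perm_seq N (sg : 'S_N) s : size (perm_seq sg s) = N.
Proof. by rewrite size_map size_enum_ord. Qed.

Lemma nth_perm_seq N (sg : 'S_N) s (j : 'I_N) : nth 0 (perm_seq sg s) j = nth 0 s (sg j).
Proof. by rewrite (nth_map j) ?size_enum_ord // nth_ord_enum. Qed.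

Lemma perm_seq_lift N (sg : 'S_N) (i : 'I_N.+1) v s :
  perm_seq (lift_perm i ord0 sg) (v :: s) =
  take i (perm_seq sg s) ++ v :: drop i (perm_seq sg s).
Proof.
have iN : (i <= N)%N by rewrite -ltnS.
apply: (@eq_from_nth _ 0) => [|j].
  rewrite size_cat /= size_take size_drop !size_perm_seq; case: ltnP => h; lia.
rewrite size_perm_seq => jN; rewrite -[j]/(nat_of_ord (Ordinal jN)); move: (Ordinal jN) => {jN}j.
rewrite nth_perm_seq nth_cat size_take size_perm_seq.
have -> : (if (i < N)%N then nat_of_ord i else N) = i by case: ltnP => h //; lia.
case: (unliftP i j) => [j'|] ->; last by rewrite lift_perm_id ltnn subnn.
rewrite lift_perm_lift lift0 /= /bump; case: (leqP i j') => h /=.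
  rewrite add1n ltnNge leqW //= subSn //= nth_drop subnKC //.
  by rewrite nth_perm_seq.
by rewrite add0n h nth_take // nth_perm_seq.
Qed.

Lemma lift_perm_bij N :
  bijective (fun x : 'I_N.+1 * 'S_N => lift_perm x.1 ord0 x.2).
Proof.
apply: inj_card_bij; last by rewrite card_prod card_ord !card_Sn factS.
move=> [i s] [j t] /= e.
have ij : i = j.
  by apply: (@perm_inj _ (lift_perm i ord0 s)); rewrite lift_perm_id e lift_perm_id.
congr (_, _) => //; apply/permP => k; apply: (@lift_inj _ ord0).
by rewrite -!(lift_perm_lift i) e ij.
Qed.

Lemma alt_insert a i v s : lalternating a -> (i <= size s)%N ->
  a (take i s ++ v :: drop i s) = (-1) ^+ i * a (v :: s).
Proof.
move=> ha si; have := alt_move [::] v (take i s) (drop i s) ha.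
rewrite /= cat_take_drop size_takel // => ->.
by rewrite mulrA -expr2 sqrr_sign mul1r.
Qed.

(* The permutations are split according to the position of the first vector. *)
Lemma perm_shuffle N : forall s k l a b, size s = N -> N = (k + l)%N ->
  lalternating a -> lalternating b -> homogeneous k a -> homogeneous l b ->
  ((k`! * l`!)%:R)^-1 * \sum_(sg : 'S_N)
     (-1) ^+ sg * a (take k (perm_seq sg s)) * b (drop k (perm_seq sg s)) =
  lwedge a b s.
Proof.
elim: N => [|N IH] [|v s] k l a b //.
  case: k l => [|k] [|l] // _ _ _ _ _ _.
  rewrite muln1 invr1 mul1r (bigD1 1%g) //= big1 ?addr0.
    rewrite odd_perm1 expr0 mul1r /perm_seq enum_ord0 //.
  by move=> sg /eqP []; apply/permP => -[].
move=> [sN] Nkl aa ab ha hb.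
rewrite (reindex _ (onW_bij _ (lift_perm_bij N))) /=.
rewrite -(pair_big xpredT xpredT (fun i sg => (-1) ^+ lift_perm i ord0 sg *
   a (take k (perm_seq (lift_perm i ord0 sg) (v :: s))) *
   b (drop k (perm_seq (lift_perm i ord0 sg) (v :: s))))) /=.
pose A := \sum_(sg : 'S_N) (-1) ^+ sg * lcontract v a (take k.-1 (perm_seq sg s)) *
            b (drop k.-1 (perm_seq sg s)).
pose B := \sum_(sg : 'S_N) (-1) ^+ sg * grade_sign a (take k (perm_seq sg s)) *
            lcontract v b (drop k (perm_seq sg s)).
(* Here [i] is the position of [v] in the permuted list: for i < k it is an argument of [a],
   otherwise of [b]. Moving [v] to the front of its block costs a sign that cancels the sign of
   [lift_perm], up to (-1)^k in the second case, which [grade_sign] absorbs. Only the side on which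
   [v] falls matters. *)
have term (i : 'I_N.+1) : \sum_(sg : 'S_N) (-1) ^+ lift_perm i ord0 sg *
   a (take k (perm_seq (lift_perm i ord0 sg) (v :: s))) *
   b (drop k (perm_seq (lift_perm i ord0 sg) (v :: s))) = if (i < k)%N then A else B.
  have iN : (i <= N)%N by rewrite -ltnS.
  case: ltnP => ik; apply: eq_bigr => sg _; rewrite odd_lift_perm addbF perm_seq_lift;
    set t := perm_seq sg s; have st : size t = N by exact: size_perm_seq.
  - have -> : take k (take i t ++ v :: drop i t) =
        take i (take k.-1 t) ++ v :: drop i (take k.-1 t).
      rewrite take_cat size_take st.
      have -> : (if (i < N)%N then nat_of_ord i else N) = i by case: ltnP => h //; lia.
      rewrite ltnNge (ltnW ik) /= take_takel; last lia.
      have -> : (k - i = (k.-1 - i).+1)%N by lia.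
      by rewrite /= take_drop subnK //; lia.
    have -> : drop k (take i t ++ v :: drop i t) = drop k.-1 t.
      rewrite drop_cat size_take st.
      have -> : (if (i < N)%N then nat_of_ord i else N) = i by case: ltnP => h //; lia.
      rewrite ltnNge (ltnW ik) /=.
      have -> : (k - i = (k.-1 - i).+1)%N by lia.
      by rewrite /= drop_drop subnK //; lia.
    rewrite alt_insert //; last by rewrite size_take st; case: ltnP; lia.
    rewrite signr_addb signr_odd; rewrite -!mulrA mulrCA; congr (_ * _).
    by rewrite !mulrA -expr2 sqrr_sign mul1r.
  - have -> : take k (take i t ++ v :: drop i t) = take k t.
      rewrite take_cat size_take st.
      have -> : (if (i < N)%N then nat_of_ord i else N) = i by case: ltnP => h //; lia.
      case: ltnP => h; first by rewrite take_takel.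
      have -> : nat_of_ord i = k by lia.
      by rewrite subnn take0 cats0 //.
    have -> : drop k (take i t ++ v :: drop i t) =
        take (i - k) (drop k t) ++ v :: drop (i - k) (drop k t).
      rewrite drop_cat size_take st.
      have -> : (if (i < N)%N then nat_of_ord i else N) = i by case: ltnP => h //; lia.
      rewrite drop_drop subnK //; case: ltnP => h.
        by rewrite take_drop subnK.
      have -> : nat_of_ord i = k by lia.
      by rewrite subnn take0 drop0.
    rewrite alt_insert //; last by rewrite size_drop st; lia.
    rewrite signr_addb signr_odd /grade_sign size_takel ?st; last lia.
    rewrite -[X in (-1) ^+ X](subnK ik) exprD /lcontract.
    have e1 : (-1) ^+ (i - k) * (-1) ^+ (i - k) = 1 :> R by rewrite -expr2 sqrr_sign.
    move: ((-1) ^+ (i - k)) e1 ((-1) ^+ k) ((-1) ^+ sg) (a _) (b _) => x e1 y z p q.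
    by rewrite -[RHS]mul1r -e1; ring.
under eq_bigr => i _ do rewrite term.
(* There are k positions on the left and l on the right. These factors turn 1/(k! l!) into 1/((k-1)!
   l!) and 1/(k! (l-1)!), the constants of the induction hypothesis. *)
have -> : \sum_(i < N.+1) (if (i < k)%N then A else B) = A *+ k + B *+ l.
  rewrite Nkl big_split_ord /=; congr (_ + _).
    by under eq_bigr => i _ do rewrite ltn_ord; rewrite sumr_const card_ord.
  under eq_bigr => i _ do rewrite ltnNge leq_addr /=.
  by rewrite sumr_const card_ord.
rewrite mulrDr; congr (_ + _).
  case: k @A {term B} Nkl ha => [|k] A Nkl ha.
    by rewrite mulr0n mulr0 hom_contract0 // lwedge0l.
  rewrite -(IH s k l) //; do ?[lia|exact: alt_contract|exact: hom_contract].
  rewrite -/A factS -(mulr_natl A) mulrA; congr (_ * _).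
  rewrite !natrM !invfM; field.
  by rewrite nat1r !pnatr_eq0 -!lt0n !fact_gt0 /=.
case: l @B {term A} Nkl hb => [|l] B Nkl hb.
  by rewrite mulr0n mulr0 [lcontract v b]hom_contract0 // lwedge0r.
rewrite -(IH s k l) //; do ?[lia|exact: alt_sign|exact: alt_contract|exact: hom_sign|exact: hom_contract].
rewrite -/B factS -(mulr_natl B) mulrA; congr (_ * _).
rewrite !natrM !invfM; field.
by rewrite nat1r !pnatr_eq0 -!lt0n !fact_gt0 /=.
Qed.

Definition bilinear_form (S : 'M[R]_m) : seq V -> R :=
  fun s => if s is [:: u; v] then (u *m S *m v^T) 0 0 else 0.

Lemma hom_bilinear_form S : homogeneous 2 (bilinear_form S).
Proof. by case=> [|x [|y []]]. Qed.

Lemma gram_bilinear_form S : gram (bilinear_form S) = S.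
Proof. by apply/matrixP => i j; rewrite mxE /bilinear_form -rowE trmx_delta -colE !mxE. Qed.

Lemma alt_bilinear_form S : (forall u : V, (u *m S *m u^T) 0 0 = 0) ->
  lalternating (bilinear_form S).
Proof.
move=> h; split.
  move=> [|x [|y [|z p]]] u v r [|x' [|y' s]] /=; rewrite ?mulr0 ?addr0 //.
    by rewrite !mulmxDl -!scalemxAl !mxE.
  by rewrite linearD linearZ /= mulmxDr -scalemxAr !mxE.
move=> [|x p] u v s; last by case: p => [|? []]; rewrite /= oppr0.
case: s => [|? ?]; rewrite /= ?oppr0 //.
have e : (u + v)^T = u^T + v^T by rewrite linearD.
have := h (u + v); rewrite e mulmxDl mulmxDr !mulmxDl.
rewrite mxE [X in X + _]mxE [X in _ + X]mxE !h add0r addr0 => /eqP.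
by rewrite addrC addr_eq0 => /eqP ->.
Qed.

End Permutations.

Section Pullback.
Variables (R : numFieldType) (m m' : nat) (f : 'rV[R]_m -> 'rV[R]_m').

Lemma lwedge_map (a b : seq 'rV[R]_m' -> R) s :
  lwedge (a \o map f) (b \o map f) s = lwedge a b (map f s).
Proof.
elim: s a b => [//|v s IH] a b; rewrite map_cons !lwedge_cons -!IH; congr (_ + _).
congr (lwedge _ _ s); apply/funext => t.
by rewrite /grade_sign /= size_map.
Qed.

Lemma lpow_map (a : seq 'rV[R]_m' -> R) j :
  lpow (a \o map f) j = lpow a j \o map f.
Proof.
elim: j => [|j IH] /=; first by apply/funext => -[|x s].
by rewrite IH; apply/funext => s; rewrite lwedge_map.
Qed.

End Pullback.

(** * An explicit inverse of wedging with w^(n-2) *)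

Section LefschetzInverse.
Variables (R : numFieldType) (n : nat).
Local Notation m := (n + n)%N.
Local Notation V := 'rV[R]_m.
Variables (om be : seq V -> R).

(* If e^j /\ i_Y w /\ b = (Y N)_j w^n, then [lwedge_lefschetz_pairing] forces
   tr_w(a) - S W^-1 = n (n - 1) N for the Gram matrices S of a and W of w, and
   taking traces gives tr_w(a) = n tr(N) / 2. *)
Definition lefschetz_coef : 'M[R]_m := \matrix_(k, j)
  (lwedge (dual_coord R j) (lwedge (lcontract (bvec R k) om) be) (basis_list R m)
   / top_power om (basis_list R m)).

Definition lefschetz_matrix : 'M[R]_m :=
  (((2^-1 * n%:R * \tr lefschetz_coef)%:M - (n%:R * n.-1%:R) *: lefschetz_coef) *m gram om).

Definition lefschetz_inverse := bilinear_form lefschetz_matrix.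

Hypothesis hn : (2 <= n)%N.
Hypothesis altom : lalternating om.
Hypothesis homom : homogeneous 2 om.
Hypothesis gramom : gram om \in unitmx.
Hypothesis altbe : lalternating be.
Hypothesis hombe : homogeneous n.-1.*2 be.

Local Notation N := lefschetz_coef.

(** A top-degree form is a multiple of w^n, and both sides are linear in [Y], so the coefficients on
    basis vectors suffice. *)
Let pairing (Y : V) k : lwedge (dual_coord R k) (lwedge (lcontract Y om) be) =
  (Y *m N) 0 k *L top_power om.
Proof.
rewrite (contract_expand Y altom) lwedge_suml.
under eq_bigr => i _ do rewrite lwedgeZl.
have -> (F : 'I_m -> seq V -> R) : lwedge (dual_coord R k) (\sum_i F i) = \sum_i lwedge (dual_coord R k) (F i).
  by apply: (big_morph (lwedge _)) => [x y|]; [exact: lwedgeDr|exact: lwedge0r].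
rewrite mxE lscale_suml; apply: eq_bigr => i _; rewrite lwedgeZr -lscaleA; congr (_ *L _).
rewrite mxE; apply: top_unique => //.
  apply: alt_lwedge; first exact: alt_dual_coord.
  by apply: alt_lwedge => //; exact: alt_contract.
have := hom_lwedge (hom_lone (fun v => v 0 k)) (hom_lwedge (hom_contract (bvec R i) homom) hombe).
by congr (homogeneous _ _); lia.
Qed.

(** The covector th = i_Y w satisfies th /\ th /\ be = 0. Expanding one factor in the dual basis and
    using [pairing] yields the quadratic form of N W, with W the Gram matrix of [om]. This is what
    makes the candidate inverse alternating. *)
Let coef_alt (Y : V) : (Y *m N *m gram om *m Y^T) 0 0 = 0.
Proof.
pose th := lcontract Y om.
have oth : odd_form th by exact: (hom_odd (hom_contract Y homom)).
have th2 : lwedge th (lwedge th be) = 0.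
  rewrite -lwedgeA; have e : lwedge th th = - lwedge th th.
    by rewrite {1}(odd_comm th oth) oth lwedgeNl.
  have -> : lwedge th th = 0.
    apply/funext => s; have := congr1 (fun f => f s) e; rewrite !lfE => /eqP.
    by rewrite -addr_eq0 -mulr2n mulrn_eq0 /= => /eqP.
  by rewrite lwedge0l.
have thE : th = \sum_k (Y *m gram om) 0 k *L dual_coord R k.
  apply/funext => s; have [|sz] := eqVneq (size s) 1%N; last first.
    rewrite /th (hom_contract Y homom sz) lfE big1 // => k _.
    by rewrite lfE /dual_coord hom_lone ?mulr0.
  case: s => [|x [|]] // _; rewrite /th /lcontract gramE // mxE lfE.
  by apply: eq_bigr => k _; rewrite lfE /dual_coord /= !mxE.
have : (\sum_k (Y *m gram om) 0 k * (Y *m N) 0 k) *L top_power om = 0.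
  rewrite -th2 {1}thE lwedge_suml lscale_suml; apply: eq_bigr => k _.
  by rewrite lwedgeZl pairing lscaleA.
have skew : (gram om)^T = - gram om.
  by apply/matrixP => i j; rewrite !mxE; case: altom => _ /(_ [::] _ _ [::]) ->.
have -> : \sum_k (Y *m gram om) 0 k * (Y *m N) 0 k = - (Y *m N *m gram om *m Y^T) 0 0.
  transitivity (((Y *m N) *m (Y *m gram om)^T) 0 0).
    by rewrite [RHS]mxE; apply: eq_bigr => k _; rewrite mulrC [X in _ = _ * X]mxE.
  by rewrite trmx_mul skew mulNmx mulmxN mulmxA mxE.
move=> h; apply/eqP; rewrite -oppr_eq0; apply: contraT => nz.
have := congr1 (lscale (- (Y *m N *m gram om *m Y^T) 0 0)^-1) h.
rewrite lscaleA mulVf // lscale1 lscale0r => /eqP.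
by rewrite /top_power (negbTE (lpow_neq0 _ _ _ _)).
Qed.

Lemma alt_lefschetz_inverse : lalternating lefschetz_inverse.
Proof.
apply: alt_bilinear_form => u; rewrite /lefschetz_matrix.
rewrite mulmxA mulmxBr mulmxBl mulmxBl.
rewrite mul_mx_scalar -scalemxAr -!scalemxAl mxE [X in X + _]mxE.
by rewrite (gram_alt u altom) mulr0 add0r mxE [X in - X]mxE coef_alt mulr0 oppr0.
Qed.

(** The error [mu] of degree 2n - 2 vanishes once its products with all pairs of covectors do:
    [alt_dual_coord_eq0] removes one covector in degree 2n - 1 and the other in degree 2n - 2. *)
Lemma lwedge_lefschetz_inverse : lwedge lefschetz_inverse (lpow om (n - 2)) = be.
Proof.
have nn0 : n%:R * n.-1%:R != 0 :> R by rewrite mulf_eq0 !pnatr_eq0; lia.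
set al := lefschetz_inverse; set t := 2^-1 * n%:R * \tr N.
have alal := alt_lefschetz_inverse.
have hal : homogeneous 2 al by exact: hom_bilinear_form.
have gal : gram al *m invmx (gram om) = t%:M - (n%:R * n.-1%:R) *: N.
  by rewrite gram_bilinear_form /lefschetz_matrix mulmxK.
(* Consistency of the ansatz: since tr N = 2 t / n, half the trace of t - n (n - 1) N is n t - (n -
   1) t = t. *)
have trt : om_trace om al = t.
  rewrite /om_trace gal linearB linearZ /= mxtrace_scalar.
  have -> : \tr N = 2 * t / n%:R.
    by rewrite /t; field; rewrite pnatr_eq0; lia.
  rewrite -(mulr_natr t) natrD.
  have -> : n.-1%:R = n%:R - 1 :> R.
    by rewrite -[in RHS](@prednK n); [rewrite -natr1 addrK|lia].
  by field; rewrite pnatr_eq0; lia.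
set mu := lwedge al (lpow om (n - 2)) - be.
have amu : lalternating mu.
  by apply: altD; [apply: alt_lwedge => //; exact: alt_lpow|exact: altN].
have hmu : homogeneous n.-1.*2 mu.
  apply: homD; last exact: homN.
  have := hom_lwedge hal (hom_lpow (j := (n - 2)%N) homom).
  have -> : (2 + (n - 2) * 2 = n.-1.*2)%N by lia.
  by [].
(* By the choice of [lefschetz_matrix], n (n - 1) [mu] pairs to zero with every e^j and every i_Y w;
   e^k is one of the latter. *)
have mu0 k j : lwedge (dual_coord R j) (lwedge (dual_coord R k) mu) = 0.
  rewrite -(contract_om_dual altom homom gramom k); set Y := row k _.
  have -> : mu = (n%:R * n.-1%:R)^-1 *L ((n%:R * n.-1%:R) *L mu).
    by rewrite lscaleA mulVf // lscale1.
  rewrite !lwedgeZr /mu lwedgeDr lwedgeNr lwedgeDr lwedgeNr lscaleDr lscaleN.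
  rewrite lwedge_lefschetz_pairing // pairing trt -mulmxA gal mulmxBr mul_mx_scalar.
  rewrite -scalemxAr.
  apply/funext => s; rewrite !lfE !mxE; ring.
have mu1 k : lwedge (dual_coord R k) mu = 0.
  apply: (@alt_dual_coord_eq0 _ _ _ (1 + n.-1.*2)) => //; last lia.
    by apply: alt_lwedge => //; exact: alt_dual_coord.
  by apply: hom_lwedge => //; exact: hom_lone.
have : mu = 0.
  by apply: (@alt_dual_coord_eq0 _ _ _ n.-1.*2) => //; lia.
by move/eqP; rewrite subr_eq0 => /eqP.
Qed.

End LefschetzInverse.

(** * Calculus of smooth functions on open sets *)

Section SmoothBasics.
Variables (R : realType) (V W : normedModType R) (U : set V).
Hypothesis oU : open U.
Implicit Types (f g : V -> W).

Lemma near_open_eq f g x : U x -> (forall y, U y -> f y = g y) ->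
  \forall y \near x, f y = g y.
Proof. by move=> Ux fg; move: (open_nbhs_nbhs (conj oU Ux)); apply: filterS. Qed.

Lemma continuous_ext f g x : U x -> (forall y, U y -> f y = g y) ->
  {for x, continuous f} -> {for x, continuous g}.
Proof.
move=> Ux fg fc; have {}fc : f @ x --> f x := fc.
suff : g @ x --> g x by [].
rewrite -(fg x Ux); apply: cvg_trans fc; apply: near_eq_cvg.
exact: near_open_eq.
Qed.

(** Since [U] is open, equality on [U] is equality of germs at each of its points, so it passes to
    all iterated derivatives. *)
Lemma Ck_ext k f g : (forall x, U x -> f x = g x) -> Ck k U f -> Ck k U g.
Proof.
elim: k f g => [|k IH] f g fg [fc fd]; split=> //; try by
  move=> x Ux; apply: continuous_ext Ux fg (fc x Ux).
move=> v; have [fv Cv] := fd v; split=> [x Ux|].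
  by apply: near_eq_derivable (fv x Ux); exact: near_open_eq.
by apply: IH Cv => x Ux; apply: near_eq_derive; exact: near_open_eq.
Qed.

Lemma CkS k f : Ck k.+1 U f -> Ck k U f.
Proof.
elim: k f => [|k IH] f [fc fd]; split=> // v.
by have [fv /IH] := fd v.
Qed.

Lemma Ck_cst k (c : W) : Ck k U (fun=> c).
Proof.
elim: k c => [|k IH] c; split=> //; try by move=> x _; exact: cst_continuous.
move=> v; split=> [x _|]; first exact: derivable_cst.
by apply: (Ck_ext _ (IH 0)) => x _; rewrite derive_cst.
Qed.

Lemma CkD k f g : Ck k U f -> Ck k U g -> Ck k U (fun x => f x + g x).
Proof.
elim: k f g => [|k IH] f g [fc fd] [gc gd]; split=> //; try by
  move=> x Ux; apply: continuousD; [exact: fc|exact: gc].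
move=> v; have [fv Cf] := fd v; have [gv Cg] := gd v; split=> [x Ux|].
  by apply: derivableD; [exact: fv|exact: gv].
apply: (Ck_ext _ (IH _ _ Cf Cg)) => x Ux.
by rewrite -deriveD //; [exact: fv|exact: gv].
Qed.

Lemma smooth_ext f g : (forall x, U x -> f x = g x) -> smooth_on U f -> smooth_on U g.
Proof. by move=> fg sf k; exact: Ck_ext (sf k). Qed.

Lemma smooth_cst (c : W) : smooth_on U (fun=> c).
Proof. by move=> k; exact: Ck_cst. Qed.

Lemma smoothD f g : smooth_on U f -> smooth_on U g -> smooth_on U (fun x => f x + g x).
Proof. by move=> sf sg k; exact: CkD. Qed.

Lemma smooth_sum (I : finType) (F : I -> V -> W) :
  (forall i, smooth_on U (F i)) -> smooth_on U (fun x => \sum_i F i x).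
Proof.
move=> sF; rewrite /index_enum; elim: (Finite.enum _) => [|i r IH].
  by apply: smooth_ext (smooth_cst 0) => x _; rewrite big_nil.
by apply: smooth_ext (smoothD (sF i) IH) => x _; rewrite big_cons.
Qed.

Lemma smooth_continuous f x : smooth_on U f -> U x -> {for x, continuous f}.
Proof. by move=> /(_ 0%N) [fc _] /fc. Qed.

Lemma smooth_derivable f x v : smooth_on U f -> U x -> derivable f x v.
Proof. by move=> /(_ 1%N) [_ /(_ v)[fv _]] /fv. Qed.

Lemma smooth_derive f v : smooth_on U f -> smooth_on U ('D_v f).
Proof. by move=> sf k; have [_ /(_ v)[]] := sf k.+1. Qed.

End SmoothBasics.

Section SmoothReal.
Variables (R : realType) (V : normedModType R) (U : set V).
Hypothesis oU : open U.
Implicit Types (f g : V -> R).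

Lemma CkM k f g : Ck k U f -> Ck k U g -> Ck k U (fun x => f x * g x).
Proof.
elim: k f g => [|k IH] f g Cf Cg; have [fc fd] := Cf; have [gc gd] := Cg.
  by split=> // x Ux; apply: continuousM; [exact: fc|exact: gc].
split; first by move=> x Ux; apply: continuousM; [exact: fc|exact: gc].
move=> v; have [fv Df] := fd v; have [gv Dg] := gd v; split=> [x Ux|].
  by apply: derivableM; [exact: fv|exact: gv].
apply: (Ck_ext oU _ (CkD oU (IH _ _ (CkS Cf) Dg) (IH _ _ (CkS Cg) Df))) => x Ux.
by rewrite [RHS](@deriveM _ _ f g x v (fv x Ux) (gv x Ux)).
Qed.

Lemma smoothM f g : smooth_on U f -> smooth_on U g -> smooth_on U (fun x => f x * g x).
Proof. by move=> sf sg k; exact: CkM. Qed.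

Lemma smoothZ r f : smooth_on U f -> smooth_on U (fun x => r * f x).
Proof. by move=> sf; apply: smoothM => //; exact: smooth_cst. Qed.

Lemma smoothN f : smooth_on U f -> smooth_on U (fun x => - f x).
Proof. by move=> sf; apply: smooth_ext (smoothZ (-1) sf) => // x _; rewrite mulN1r. Qed.

Lemma smoothB f g : smooth_on U f -> smooth_on U g -> smooth_on U (fun x => f x - g x).
Proof. by move=> sf sg; apply: smoothD => //; exact: smoothN. Qed.

Lemma smooth_prod (I : finType) (F : I -> V -> R) :
  (forall i, smooth_on U (F i)) -> smooth_on U (fun x => \prod_i F i x).
Proof.
move=> sF; rewrite /index_enum; elim: (Finite.enum _) => [|i r IH].
  by apply: (smooth_ext oU _ (@smooth_cst R V R U oU 1)) => x _; rewrite big_nil.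
by apply: (smooth_ext oU _ (smoothM (sF i) IH)) => x _; rewrite big_cons.
Qed.

Lemma CkV k f : (forall x, U x -> f x != 0) -> Ck k U f -> Ck k U (fun x => (f x)^-1).
Proof.
move=> f0; elim: k => [|k IH] Cf; have [fc fd] := Cf.
  by split=> // x Ux; apply: continuousV; [exact: f0|exact: fc].
split; first by move=> x Ux; apply: continuousV; [exact: f0|exact: fc].
move=> v; have [fv Df] := fd v; split=> [x Ux|].
  by apply: derivableV; [exact: f0|exact: fv].
have CV := IH (CkS Cf).
apply: (Ck_ext oU _ (CkM (@Ck_cst R V R U oU k (-1)) (CkM (CkM CV CV) Df))) => x Ux.
by rewrite (deriveV (f0 x Ux) (fv x Ux)) mulN1r scaleNr expr2 invfM.
Qed.

Lemma smoothV f : (forall x, U x -> f x != 0) -> smooth_on U f ->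
  smooth_on U (fun x => (f x)^-1).
Proof. by move=> f0 sf k; exact: CkV. Qed.

Lemma smooth_det m (F : V -> 'M[R]_m) : (forall i j, smooth_on U (fun x => F x i j)) ->
  smooth_on U (fun x => \det (F x)).
Proof.
move=> sF; rewrite /determinant; apply: smooth_sum => // s; apply: smoothZ.
exact: smooth_prod.
Qed.

(** Cramer's rule: the entries of the inverse are cofactors over a nonvanishing determinant. *)
Lemma smooth_invmx m (F : V -> 'M[R]_m) : (forall i j, smooth_on U (fun x => F x i j)) ->
  (forall x, U x -> F x \in unitmx) ->
  forall i j, smooth_on U (fun x => invmx (F x) i j).
Proof.
move=> sF uF i j.
have : smooth_on U (fun x => (\det (F x))^-1 * cofactor (F x) j i).
  apply: smoothM.
    by apply: smoothV; [move=> x /uF; rewrite unitmxE unitfE|exact: smooth_det].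
  apply: smoothZ; apply: smooth_det => k l.
  by apply: smooth_ext (sF (lift j k) (lift i l)) => // x _; rewrite !mxE.
by apply: smooth_ext => // x /uF u; rewrite /invmx u !mxE.
Qed.

Lemma smooth_mulmx m n p (F : V -> 'M[R]_(m, n)) (G : V -> 'M[R]_(n, p)) :
  (forall i j, smooth_on U (fun x => F x i j)) ->
  (forall i j, smooth_on U (fun x => G x i j)) ->
  forall i j, smooth_on U (fun x => (F x *m G x) i j).
Proof.
move=> sF sG i j.
have : smooth_on U (fun x => \sum_k F x i k * G x k j).
  by apply: smooth_sum => // k; apply: smoothM.
by apply: smooth_ext => // x _; rewrite !mxE.
Qed.

Lemma continuous_mx m n (F : V -> 'M[R]_(m, n)) x :
  (forall i j, {for x, continuous (fun y => F y i j)}) -> {for x, continuous F}.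
Proof.
move=> cF; apply/cvgrPdist_le => /= e e0; near=> y.
rewrite /Num.Def.normr /= mx_normrE (bigmax_le _ (ltW e0)) //= => i _; rewrite !mxE.
move: i; near: y; apply: filter_forall => /= i.
exact: ((cvgrPdist_le _ _).1 (cF i.1 i.2)).
Unshelve. all: by end_near. Qed.

Lemma smooth_rowP m (F : V -> 'rV[R]_m) :
  smooth_on U F <-> forall j, smooth_on U (fun x => F x 0 j).
Proof.
split=> sF.
  move=> j k; elim: k F sF => [|k IH] F sF;
    (have cF x : U x -> {for x, continuous (fun y => F y 0 j)} by move=> Ux; exact: (@continuous_comp _ _ _ F (fun M : 'rV[R]_m => M 0 j) x (smooth_continuous sF Ux) (@coord_continuous _ _ _ _ _ _))).
    by split.
  split=> // v; split=> [x Ux|].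
    by have /derivable_mxP := smooth_derivable (v := v) sF Ux; apply.
  apply: (Ck_ext oU _ (IH _ (smooth_derive v sF))) => x Ux.
  by rewrite derive_mx ?mxE //; exact: smooth_derivable sF Ux.
move=> k; elim: k F sF => [|k IH] F sF.
  split=> // x Ux; apply: continuous_mx => i j; rewrite (ord1 i).
  exact: smooth_continuous (sF j) Ux.
split=> [x Ux|v].
  by apply: continuous_mx => i j; rewrite (ord1 i); exact: smooth_continuous (sF j) Ux.
have dF x : U x -> derivable F x v.
  by move=> Ux; apply/derivable_mxP => i j; rewrite (ord1 i); exact: smooth_derivable (sF j) Ux.
split=> //; apply: (IH ('D_v F)) => j.
apply: (smooth_ext oU _ (smooth_derive v (sF j))) => x Ux.
by rewrite derive_mx ?mxE //; exact: dF.
Qed.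

End SmoothReal.

(** * Mean value theorem along lines and symmetry of second derivatives *)

Section MeanValue.
Variables (R : realType) (V : normedModType R).
Implicit Types (f : V -> R) (x y u v w : V).

Lemma is_derive_line f y v (c s : R) : derivable f (y + (s * c) *: v) v ->
  is_derive s 1 (fun r : R => f (y + (r * c) *: v)) (c * 'D_v f (y + (s * c) *: v)).
Proof.
set z := y + _ => df.
have d1 : is_derive (s * c) (1 : R) (fun r : R => f (y + r *: v)) ('D_v f z).
  have E : (fun h : R => h^-1 *: ((fun r : R => f (y + r *: v)) (h *: 1 + s * c) - (fun r : R => f (y + r *: v)) (s * c)))
    = (fun h : R => h^-1 *: (f (h *: v + z) - f z)).
    apply/funext => h; congr (_ *: (f _ - _)).
    by rewrite scalerDl [h *: 1]mulr1 addrCA.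
  split; last by rewrite /derive E.
  by rewrite /derivable E.
have d2 : is_derive s (1 : R) (fun r : R => r * c) c.
  have := @is_deriveM R R id (cst c) s 1 _ _ (is_derive_id _ _) (is_derive_cst _ _ _).
  by rewrite scaler0 add0r [c *: 1]mulr1.
have := @is_derive1_comp R _ _ s _ _ d1 d2.
by rewrite mulrC.
Qed.

(** The segment is parametrised by [0, 1] and not by its length, so that [c] may be negative or
    zero. *)
Lemma line_mvt f y v (c : R) :
  (forall s : R, 0 <= s <= 1 -> derivable f (y + (s * c) *: v) v) ->
  exists2 s : R, 0 <= s <= 1 & f (y + c *: v) - f y = c * 'D_v f (y + (s * c) *: v).
Proof.
move=> df; set g := fun r : R => f (y + (r * c) *: v).
have dg (s : R) : 0 <= s <= 1 -> is_derive s 1 g (c * 'D_v f (y + (s * c) *: v)).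
  by move=> /df; exact: is_derive_line.
have H1 (s : R) : s \in `]0, 1[ -> is_derive s 1 g (c * 'D_v f (y + (s * c) *: v)).
  by rewrite in_itv /= => /andP[s0 s1]; apply: dg; rewrite !ltW.
have H2 : {within `[0, 1], continuous g}.
  apply: derivable_within_continuous => s; rewrite in_itv /= => s01.
  by have [] := dg s s01.
have [s] := MVT_segment ler01 H1 H2; rewrite in_itv /= => s01.
by rewrite subr0 mulr1 /g mul1r mul0r scale0r addr0 => e; exists s.
Qed.

Lemma shift_growth_rate f w y u :
  (fun h : R => h^-1 *: (f (h *: u + y + w) - f (y + w))) =
  (fun h => h^-1 *: (f (h *: u + (y + w)) - f (y + w))).
Proof. by apply/funext => h; rewrite addrA. Qed.

Lemma derive_shift_arg f w y u : 'D_u (fun z => f (z + w)) y = 'D_u f (y + w).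
Proof. by rewrite /derive /= shift_growth_rate. Qed.

Lemma derivable_shift_arg f w y u :
  derivable f (y + w) u -> derivable (fun z => f (z + w)) y u.
Proof. by rewrite /derivable /= shift_growth_rate. Qed.

Lemma continuous_near_le (g : V -> R) x (e : R) : {for x, continuous g} -> 0 < e ->
  \forall y \near x, `|g x - g y| <= e.
Proof. by move=> cg e0; exact: ((cvgrPdist_le _ _).1 cg _ e0). Qed.

(** The mean value theorem is used twice: along [u] for G(y) = f(y + t v) - f(y), then along [v] for
    ['D_u f]. *)
Lemma second_difference f (U : set V) x u v (t : R) :
  (forall r s : R, `|r| <= `|t| -> `|s| <= `|t| -> U (x + r *: u + s *: v)) ->
  (forall y, U y -> derivable f y u) ->
  (forall y, U y -> derivable ('D_u f) y v) ->
  exists r s : R, [/\ `|r| <= `|t|, `|s| <= `|t| &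
    f (x + t *: u + t *: v) - f (x + t *: u) - f (x + t *: v) + f x =
    t * (t * 'D_v ('D_u f) (x + r *: u + s *: v))].
Proof.
move=> hU du dv.
have small (s : R) : 0 <= s <= 1 -> `|s * t| <= `|t|.
  by move=> /andP[s0 s1]; rewrite normrM ger0_norm // ler_piMl.
have z0 : `|0 : R| <= `|t| by rewrite normr0.
set G := fun y => f (y + t *: v) - f y.
have dG y : U y -> U (y + t *: v) -> derivable G y u /\ 'D_u G y = 'D_u f (y + t *: v) - 'D_u f y.
  move=> Uy Uyt; have d1 := derivable_shift_arg (du _ Uyt).
  split; first exact: (derivableB d1 (du _ Uy)).
  by rewrite (deriveB d1 (du _ Uy)) derive_shift_arg.
have Us (s : R) : 0 <= s <= 1 -> U (x + (s * t) *: u) /\ U (x + (s * t) *: u + t *: v).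
  move=> /small s1; split; last exact: hU.
  by have := hU (s * t) 0 s1 z0; rewrite scale0r addr0.
have [s s01 e1] := @line_mvt G x u t (fun s hs => (dG _ (Us s hs).1 (Us s hs).2).1).
have [|s' s01' e2] := @line_mvt ('D_u f) (x + (s * t) *: u) v t.
  by move=> r r01; apply: dv; apply: hU; exact: small.
exists (s * t), (s' * t); split; [exact: small|exact: small|].
rewrite -e2 -(dG _ (Us s s01).1 (Us s s01).2).2 -e1 /G.
by rewrite opprB addrA addrAC.
Qed.

(** The second difference over a small parallelogram is symmetric in [u] and [v]. Divided by t^2 it
    is a value of either mixed derivative near [x], and both are continuous at [x]. *)
Lemma schwarz f (U : set V) x u v : open U -> U x ->
  (forall y w, U y -> derivable f y w) ->
  (forall y w w', U y -> derivable ('D_w f) y w') ->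
  (forall w w', {for x, continuous ('D_w' ('D_w f))}) ->
  'D_v ('D_u f) x = 'D_u ('D_v f) x.
Proof.
move=> oU Ux d1 d2 c2; apply/eqP; rewrite -subr_eq0 -normr_le0.
apply/ler_addgt0Pr => e e0; rewrite add0r.
have e20 : 0 < e / 2 by rewrite divr_gt0.
have h1 := continuous_near_le (c2 v u) e20.
have h2 := continuous_near_le (c2 u v) e20.
have hU := open_nbhs_nbhs (conj oU Ux).
have [d /= d0 hd] := (nbhs_ballP _ _).1 (filterI hU (filterI h1 h2)).
set N := `|u| + `|v| + 1; have N0 : 0 < N by rewrite ltr_wpDl // addr_ge0.
(* With this [t] the parallelogram with sides t u and t v lies in the ball of radius [d]; the
   summand 1 in [N] keeps [N] positive and the inclusion strict. *)
pose t := d / N; have t0 : 0 < t by rewrite divr_gt0.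
have hb (r s : R) : `|r| <= `|t| -> `|s| <= `|t| -> ball x d (x + r *: u + s *: v).
  rewrite (gtr0_norm t0) => rt st; rewrite -ball_normE /ball_ /= -addrA opprD addNKr normrN.
  rewrite (le_lt_trans (ler_normD _ _)) // !normrZ.
  rewrite (@le_lt_trans _ _ (t * (`|u| + `|v|))) //.
    by rewrite mulrDr lerD // ler_wpM2r.
  by rewrite /t -mulrA gtr_pMr // mulrC ltr_pdivrMr // mul1r /N ltrDl.
have [r [s [rt st E1]]] := @second_difference f U x u v t
  (fun r s hr hs => (hd _ (hb r s hr hs)).1) (fun y => d1 y u) (fun y => d2 y u v).
have hb' (r1 s1 : R) : `|r1| <= `|t| -> `|s1| <= `|t| -> ball x d (x + r1 *: v + s1 *: u).
  by move=> hr hs; rewrite addrAC; exact: hb.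
have [r' [s' [rt' st' E2]]] := @second_difference f U x v u t
  (fun r s hr hs => (hd _ (hb' r s hr hs)).1) (fun y => d1 y v) (fun y => d2 y v u).
have [_ [_ B1]] := hd _ (hb _ _ rt st).
have [_ [B2 _]] := hd _ (hb' _ _ rt' st').
have E : 'D_v ('D_u f) (x + r *: u + s *: v) = 'D_u ('D_v f) (x + r' *: v + s' *: u).
  apply: (mulfI (lt0r_neq0 t0)); apply: (mulfI (lt0r_neq0 t0)).
  refine (etrans (esym E1) (etrans _ E2)).
  rewrite (addrAC x (t *: v)).
  by move: (f _) (f (x + t *: u)) (f (x + t *: v)) (f x) => p q r0 s0; ring.
move: B1 B2; rewrite /= E; set D := 'D_u _ (_ + _) => B1 B2.
have -> : 'D_v ('D_u f) x - 'D_u ('D_v f) x = ('D_v ('D_u f) x - D) - ('D_u ('D_v f) x - D).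
  by rewrite opprB addrA subrK.
apply: (le_trans (ler_normB _ _)).
rewrite (splitr e).
apply: lerD.
  exact: B1.
exact: B2.
Qed.

Lemma continuous_bigsum (I : Type) (r : seq I) (F : I -> V -> R) y :
  (forall i, {for y, continuous (F i)}) ->
  {for y, continuous (fun z => \sum_(i <- r) F i z)}.
Proof.
move=> cF; elim: r => [|i r IH].
  have -> : (fun z => \sum_(i <- [::]) F i z) = cst 0.
    by apply/funext => z; rewrite big_nil.
  exact: cst_continuous.
have -> : (fun z => \sum_(j <- i :: r) F j z) = (fun z => F i z + \sum_(j <- r) F j z).
  by apply/funext => z; rewrite big_cons.
exact: continuousD.
Qed.

End MeanValue.

(** * Continuous partial derivatives imply differentiability *)

Section C1.
Variables (R : realType) (m : nat).
Local Notation V := 'rV[R]_m.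
Variables (f : V -> R) (U : set V) (x : V).
Hypotheses (oU : open U) (Ux : U x) (df : forall y v, U y -> derivable f y v)
  (cf : forall v, {for x, continuous ('D_v f)}).

Local Notation e_ j := (delta_mx 0 j : V).

Let partial_sum (l : seq 'I_m) (h : V) : V := \sum_(j <- l) h 0 j *: e_ j.

Lemma row_coord_norm (h : V) j : `|h 0 j| <= `|h|.
Proof.
rewrite [leRHS]/Num.Def.normr /= mx_normrE.
exact: (le_bigmax _ (fun ij : 'I_1 * 'I_m => `|h ij.1 ij.2|) (0, j)).
Qed.

Let norm_partial_sum l h : `|partial_sum l h| <= (size l)%:R * `|h|.
Proof.
rewrite /partial_sum; elim: l => [|j l IH]; first by rewrite big_nil normr0 mul0r.
rewrite big_cons (le_trans (ler_normD _ _)) //= mulrS mulrDl mul1r lerD //.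
rewrite normrZ -[leRHS]mulr1 ler_pM ?row_coord_norm //.
rewrite /Num.Def.normr /= mx_normrE bigmax_le // => i _; rewrite mxE.
by case: (_ && _); rewrite ?normr0 ?normr1.
Qed.

(** The path from [x] to x + h follows the coordinate axes in turn. On each edge the mean value
    theorem applies, and continuity of the partial derivative at [x] bounds the error by e |h|. *)
Let partial_increment l (e : R) : 0 < e ->
  \forall h \near (0 : V), `|f (x + partial_sum l h) - f x - \sum_(j <- l) h 0 j * 'D_(e_ j) f x|
     <= (size l)%:R * e * `|h|.
Proof.
move=> e0; elim: l => [|j l IH].
  by near=> h; rewrite /partial_sum !big_nil addr0 subrr subr0 normr0 !mul0r.
have hU := open_nbhs_nbhs (conj oU Ux).
have hc := continuous_near_le (@cf (e_ j)) e0.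
have [d /= d0 hd] := (nbhs_ballP _ _).1 (filterI hU hc).
near=> h.
(* The path has at most [(size l).+1] edges, each no longer than |h|, so it stays in the ball. *)
have hh : (size l).+1%:R * `|h| < d.
  rewrite mulrC -ltr_pdivlMr //; near: h; apply/nbhs_ballP.
  exists (d / (size l).+1%:R); first by rewrite /= divr_gt0.
  by move=> h; rewrite -ball_normE /ball_ /= sub0r normrN.
have IHh : `|f (x + partial_sum l h) - f x - \sum_(j <- l) h 0 j * 'D_(e_ j) f x|
     <= (size l)%:R * e * `|h| by near: h; exact: IH.
have hb (s : R) : 0 <= s <= 1 -> ball x d (x + partial_sum l h + (s * h 0 j) *: e_ j).
  move=> /andP[s0 s1]; rewrite -ball_normE /ball_ /= -addrA opprD addNKr normrN.
  apply: le_lt_trans hh; rewrite (le_trans (ler_normD _ _)) // -natr1 mulrDl mul1r lerD //.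
  have := norm_partial_sum [:: j] ((s *: h)); rewrite /partial_sum big_seq1 mxE mul1r => /le_trans -> //.
  by rewrite normrZ ger0_norm // ler_piMl.
have [s s01 E] := @line_mvt _ _ f (x + partial_sum l h) (e_ j) (h 0 j)
  (fun s hs => @df _ _ (hd _ (hb s hs)).1).
have [_ Ds] := hd _ (hb s s01).
have -> : f (x + partial_sum (j :: l) h) = f (x + partial_sum l h + h 0 j *: e_ j).
  by rewrite /partial_sum big_cons addrAC -addrA addrC addrAC -addrA addrC.
rewrite big_cons; set z := _ + (_ * _) *: _ in E Ds.
have -> : f (x + partial_sum l h + h 0 j *: e_ j) = f (x + partial_sum l h) + h 0 j * 'D_(e_ j) f z.
  by move/eqP: E; rewrite subr_eq => /eqP ->; exact: addrC.
set S := \sum_(_ <- _) _ in IHh *; set a := f _ in IHh *.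
have -> : a + h 0 j * 'D_(e_ j) f z - f x - (h 0 j * 'D_(e_ j) f x + S) =
   (a - f x - S) + h 0 j * ('D_(e_ j) f z - 'D_(e_ j) f x) by ring.
rewrite (le_trans (ler_normD _ _)) //= -natr1 mulrDl mul1r mulrDl lerD //.
by rewrite normrM mulrC ler_pM ?row_coord_norm // distrC.
Unshelve. all: by end_near. Qed.

Lemma C1_differentiable : differentiable f x.
Proof.
pose L (h : V) : R := \sum_j h 0 j * 'D_(e_ j) f x.
have linL : linear L.
  move=> r u v; rewrite /L scaler_sumr -big_split /=; apply: eq_bigr => j _.
  by rewrite !mxE mulrDl; congr (_ + _); rewrite -mulrA.
pose Ll : {linear V -> R} := HB.pack L (GRing.isLinear.Build R V R _ L linL).
have cL : continuous Ll.
  move=> h; apply: continuous_bigsum => j.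
  by apply: continuousM; [exact: coord_continuous|exact: cst_continuous].
have E : f \o shift x = cst (f x) + (Ll : V -> R) +o_ (0 : V) id.
  (* Each of the m coordinates receives an equal share of the error; dividing by m + 1 also covers m
     = 0. *)
  apply/eqaddoP => e e0; have e1 : 0 < e / m.+1%:R by rewrite divr_gt0.
  have sz : size (index_enum 'I_m) = m by rewrite /index_enum unlock -enumT size_enum_ord.
  have := partial_increment (index_enum 'I_m) e1; apply: filterS => h.
  have -> : partial_sum (index_enum 'I_m) h = h by rewrite [RHS]row_sum_delta.
  rewrite sz => le; rewrite /= !fctE /= (addrC h).
  apply: le_trans (_ : m%:R * (e / m.+1%:R) * `|h| <= _).
    by move: le; rewrite opprD addrA.
  rewrite ler_wpM2r // mulrCA ler_piMr ?ltW //.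
  by rewrite ltr_pdivrMr // mul1r ltr_nat.
have dE := diff_unique cL E.
by apply/diff_locallyP; rewrite dE; split.
Qed.

End C1.

(** * Exterior derivative *)

Section FieldCalculus.
Variables (R : realType) (m : nat).
Local Notation V := 'rV[R]_m.
Variables (U : set V).
Hypothesis (oU : open U).
Implicit Types (f g : V -> R) (a b : V -> seq V -> R) (u v : V) (s p : seq V).

Lemma derive_eq_on f g u v : U u -> (forall y, U y -> f y = g y) -> 'D_v f u = 'D_v g u.
Proof. by move=> Uu fg; apply: near_eq_derive; exact: (near_open_eq oU Uu fg). Qed.

Lemma smooth_differentiable f u : smooth_on U f -> U u -> differentiable f u.
Proof.
move=> sf Uu; apply: (C1_differentiable oU Uu) => [y v Uy|v].
  exact: smooth_derivable sf Uy.
exact: smooth_continuous (smooth_derive v sf) Uu.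
Qed.

(** Linearity in the direction comes from the differential, which exists by [C1_differentiable]. *)
Lemma smooth_derive_lin f u (r : R) x y : smooth_on U f -> U u ->
  'D_(r *: x + y) f u = r * 'D_x f u + 'D_y f u.
Proof.
move=> sf Uu; have df := smooth_differentiable sf Uu.
by rewrite !deriveE // linearD linearZ.
Qed.

Lemma smooth_schwarz f u x y : smooth_on U f -> U u -> 'D_y ('D_x f) u = 'D_x ('D_y f) u.
Proof.
move=> sf Uu; apply: (@schwarz R V f U u x y oU Uu) => [z w Uz|z w w' Uz|w w'].
- exact: smooth_derivable sf Uz.
- exact: smooth_derivable (smooth_derive w sf) Uz.
- exact: smooth_continuous (smooth_derive w' (smooth_derive w sf)) Uu.
Qed.

Lemma smooth_deriveD f g u v : smooth_on U f -> smooth_on U g -> U u ->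
  'D_v (fun y => f y + g y) u = 'D_v f u + 'D_v g u.
Proof. by move=> sf sg Uu; apply: deriveD; [exact: smooth_derivable sf Uu|exact: smooth_derivable sg Uu]. Qed.

Lemma smooth_deriveM f g u v : smooth_on U f -> smooth_on U g -> U u ->
  'D_v (fun y => f y * g y) u = f u * 'D_v g u + g u * 'D_v f u.
Proof.
move=> sf sg Uu.
exact: (deriveM (smooth_derivable (v := v) sf Uu) (smooth_derivable (v := v) sg Uu)).
Qed.

Lemma smooth_deriveZ (r : R) f u v : smooth_on U f -> U u ->
  'D_v (fun y => r * f y) u = r * 'D_v f u.
Proof.
move=> sf Uu; have := @smooth_deriveM (cst r) f u v (smooth_cst oU r) sf Uu.
by rewrite derive_cst mulr0 addr0.
Qed.

Lemma smooth_deriveN f u v : smooth_on U f -> U u ->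
  'D_v (fun y => - f y) u = - 'D_v f u.
Proof.
move=> sf Uu; rewrite -mulN1r -smooth_deriveZ //.
by congr ('D_v _ u); apply/funext => y; rewrite mulN1r.
Qed.

Lemma smooth_derive_sum (I : finType) (F : I -> V -> R) u v :
  (forall i, smooth_on U (F i)) -> U u ->
  'D_v (fun y => \sum_i F i y) u = \sum_i 'D_v (F i) u.
Proof.
move=> sF Uu; rewrite /index_enum; elim: (Finite.enum _) => [|i r IH].
  rewrite [RHS]big_nil -[RHS](derive_cst (0 : R) u v).
  by congr ('D_v _ u); apply/funext => y; rewrite big_nil.
rewrite [RHS]big_cons -IH -smooth_deriveD //.
  by congr ('D_v _ u); apply/funext => y; rewrite big_cons.
elim: r {IH} => [|j r IH].
  by apply: smooth_ext (smooth_cst oU (0 : R)) => // x _; rewrite big_nil.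
by apply: smooth_ext (smoothD oU (sF j) IH) => // x _; rewrite big_cons.
Qed.

Definition smooth_field a := forall s, smooth_on U (fun y => a y s).

Lemma sf_contract v a : smooth_field a -> smooth_field (fun y => lcontract v (a y)).
Proof. by move=> sa s; exact: sa. Qed.

Lemma sf_grade_sign a : smooth_field a -> smooth_field (fun y => grade_sign (a y)).
Proof. by move=> sa s; apply: smoothZ. Qed.

Lemma sf_cst (c : seq V -> R) : smooth_field (fun=> c).
Proof. by move=> s; exact: smooth_cst. Qed.

Lemma sf_opp a : smooth_field a -> smooth_field (fun y => - a y).
Proof. by move=> sa s; apply: smoothN. Qed.

Lemma sf_scale (f : V -> R) a : smooth_on U f -> smooth_field a -> smooth_field (fun y => f y *L a y).
Proof. by move=> sf sa s; apply: smoothM. Qed.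

Lemma sf_lwedge a b : smooth_field a -> smooth_field b ->
  smooth_field (fun y => lwedge (a y) (b y)).
Proof.
move=> + + s; elim: s a b => [|v s IH] a b sa sb; first by apply: smoothM.
have h1 := IH _ _ (sf_contract v sa) sb.
have h2 := IH _ _ (sf_grade_sign sa) (sf_contract v sb).
exact: (smoothD oU h1 h2).
Qed.

Lemma sf_lpow a j : smooth_field a -> smooth_field (fun y => lpow (a y) j).
Proof. by move=> sa; elim: j => [|j IH]; [exact: sf_cst|exact: sf_lwedge]. Qed.

Definition fderive v a u : seq V -> R := fun s => 'D_v (fun y => a y s) u.

Lemma sf_fderive v a : smooth_field a -> smooth_field (fderive v a).
Proof. by move=> sa s; exact: smooth_derive. Qed.

Lemma fderive_lwedge v a b u : smooth_field a -> smooth_field b -> U u ->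
  fderive v (fun y => lwedge (a y) (b y)) u =
  lwedge (fderive v a u) (b u) + lwedge (a u) (fderive v b u).
Proof.
move=> sa sb Uu; apply/funext => s; rewrite lfE.
elim: s a b sa sb => [|x s IH] a b sa sb.
  rewrite [LHS]smooth_deriveM //; rewrite /lwedge /= /fderive addrC mulrC.
  by [].
have s1 := sf_lwedge (sf_contract x sa) sb s.
have s2 := sf_lwedge (sf_grade_sign sa) (sf_contract x sb) s.
rewrite [LHS](smooth_deriveD v s1 s2 Uu).
have h1 := IH _ b (sf_contract x sa) sb.
have h2 := IH _ _ (sf_grade_sign sa) (sf_contract x sb).
rewrite [X in X + _]h1 [X in _ + X]h2 !lwedge_cons.
rewrite addrACA; congr (_ + _ + (_ + _)).
congr (lwedge _ _ s); apply/funext => t.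
by rewrite /grade_sign /fderive smooth_deriveZ.
Qed.

(* Cartan's formula i_v da = D_v a - d(i_v a) for a constant vector v. *)
Fixpoint ext_list s a u : R :=
  if s is v :: s' then
    'D_v (fun y => a y s') u - ext_list s' (fun y => lcontract v (a y)) u
  else 0.

Definition lext a u : seq V -> R := fun s => ext_list s a u.

Lemma contract_lext v a u :
  lcontract v (lext a u) = fderive v a u - lext (fun y => lcontract v (a y)) u.
Proof. by []. Qed.

(** The exterior derivative depends only on the germ, so a field may be replaced by any other that
    agrees with it on the image of the chart. *)
Lemma lext_ext a b u : U u -> (forall y, U y -> a y = b y) -> lext a u = lext b u.
Proof.
move=> Uu ab; apply/funext => s; elim: s a b ab => [//|v s IH] a b ab.
rewrite /lext /=; congr (_ - _); last by apply: IH => y /ab ->.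
by apply: derive_eq_on => // y /ab ->.
Qed.

Lemma lextD a b u : U u -> smooth_field a -> smooth_field b ->
  lext (fun y => a y + b y) u = lext a u + lext b u.
Proof.
move=> Uu sa sb; apply/funext => s; elim: s a b sa sb => [|v s IH] a b sa sb.
  by rewrite !lfE /lext /= addr0.
rewrite lfE {1}/lext /= smooth_deriveD // [X in _ - X]IH; try exact: sf_contract.
by rewrite opprD addrACA.
Qed.

Lemma lextZ (r : R) a u : U u -> smooth_field a -> lext (fun y => r *L a y) u = r *L lext a u.
Proof.
move=> Uu sa; apply/funext => s; elim: s a sa => [|v s IH] a sa.
  by rewrite lfE /lext /= mulr0.
rewrite lfE {1}/lext /= smooth_deriveZ // [X in _ - X]IH; last exact: sf_contract.
by rewrite -mulrBr.
Qed.

Lemma lextN a u : U u -> smooth_field a -> lext (fun y => - a y) u = - lext a u.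
Proof.
move=> Uu sa; rewrite -lscaleN1 -lextZ //; congr (lext _ u).
by apply/funext => y; rewrite lscaleN1.
Qed.

Lemma sf_lext a : smooth_field a -> smooth_field (lext a).
Proof.
move=> + s; elim: s a => [|v s IH] a sa; first exact: smooth_cst.
apply: smoothB => //; first exact: smooth_derive.
by apply: IH; exact: sf_contract.
Qed.

(** The derivative raises the degree by one, so it anticommutes with the parity sign. *)
Lemma lext_grade_sign a u : U u -> smooth_field a ->
  lext (fun y => grade_sign (a y)) u = - grade_sign (lext a u).
Proof.
move=> Uu sa; apply/funext => s; elim: s a sa => [|v s IH] a sa.
  by rewrite lfE /grade_sign /lext /= mulr0 oppr0.
have -> : lext (fun y => grade_sign (a y)) u (v :: s) =
    'D_v (fun y => grade_sign (a y) s) u - lext (fun y => lcontract v (grade_sign (a y))) u s by [].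
rewrite (lext_ext (b := fun y => - grade_sign (lcontract v (a y)))) //; last first.
  by move=> y _; rewrite contract_grade_sign.
rewrite lextN //; last by apply: sf_grade_sign; exact: sf_contract.
rewrite !lfE IH; last exact: sf_contract.
rewrite smooth_deriveZ // !lfE /grade_sign [size (v :: s)]/= exprS mulN1r !mulNr !opprK.
by rewrite /lext /= mulrBr.
Qed.

(** After contraction with the head vector, Cartan's formula and the induction hypothesis for the
    two products of the Leibniz rule make both sides agree term by term. *)
Lemma lext_lwedge a b u : U u -> smooth_field a -> smooth_field b ->
  lext (fun y => lwedge (a y) (b y)) u =
  lwedge (lext a u) (b u) + lwedge (grade_sign (a u)) (lext b u).
Proof.
move=> Uu sa sb; apply/funext => s; elim: s a b sa sb => [|v s IH] a b sa sb.
  by rewrite lfE /lwedge /= /lext /= mulr0 mul0r addr0.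
have -> : lext (fun y => lwedge (a y) (b y)) u (v :: s) =
   fderive v (fun y => lwedge (a y) (b y)) u s -
   lext (fun y => lwedge (lcontract v (a y)) (b y) + lwedge (grade_sign (a y)) (lcontract v (b y))) u s by [].
have sca := sf_contract v sa; have scb := sf_contract v sb; have sga := sf_grade_sign sa.
rewrite fderive_lwedge // lextD //; try exact: sf_lwedge.
rewrite !lfE !IH // !lwedge_cons !contract_lext lext_grade_sign //.
rewrite contract_grade_sign grade_signK.
rewrite lwedgeDl !lwedgeDr !lwedgeNl !lwedgeNr !lfE.
move: (lwedge (fderive v a u) (b u) s) (lwedge (a u) (fderive v b u) s)
  (lwedge (lext (fun y => lcontract v (a y)) u) (b u) s)
  (lwedge (grade_sign (lcontract v (a u))) (lext b u) s)
  (lwedge (grade_sign (lext a u)) (lcontract v (b u)) s)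
  (lwedge (a u) (lext (fun y => lcontract v (b y)) u) s) => p1 p2 p3 p4 p5 p6.
by ring.
Qed.

(** This commutation is the form in which symmetry of second derivatives enters d d = 0. *)
Lemma fderive_lext v a u : U u -> smooth_field a ->
  fderive v (lext a) u = lext (fderive v a) u.
Proof.
move=> Uu sa; apply/funext => s; elim: s a sa => [|x s IH] a sa.
  by rewrite /fderive /lext /= derive_cst.
rewrite /fderive {1}/lext /= smooth_deriveD //; last 2 first.
- exact: smooth_derive.
- by apply: smoothN => //; exact: (sf_lext (sf_contract x sa)).
rewrite smooth_deriveN //; last exact: (sf_lext (sf_contract x sa)).
have h1 := smooth_schwarz x v (sa s) Uu.
have h2 := IH _ (sf_contract x sa).
exact: (congr2 (fun p q : R => p - q) h1 h2).
Qed.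

(** Contracting with a constant [v] leaves D_v (da) - d(D_v a) + d d(i_v a): the first two terms
    cancel, and the last vanishes by induction. *)
Lemma lext_lext a u : U u -> smooth_field a -> lext (lext a) u = 0.
Proof.
move=> Uu sa; apply/funext => s; elim: s a sa => [//|v s IH] a sa.
have -> : lext (lext a) u (v :: s) = fderive v (lext a) u s -
   lext (fun y => fderive v a y - lext (fun z => lcontract v (a z)) y) u s by [].
have sc := sf_contract v sa.
rewrite fderive_lext // lextD //; [|exact: sf_fderive|by apply: sf_opp; exact: sf_lext].
by rewrite lextN ?lfE ?IH ?subr0 ?oppr0 ?addr0 ?subrr //; exact: sf_lext.
Qed.

Lemma hom_fderive v a u d : U u -> (forall y, U y -> homogeneous d (a y)) ->
  homogeneous d (fderive v a u).
Proof.
move=> Uu ha s sd; rewrite /fderive (derive_eq_on (g := cst 0) _ Uu) ?derive_cst //.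
by move=> y Uy; rewrite ha.
Qed.

Lemma hom_lext a u d : U u -> (forall y, U y -> homogeneous d (a y)) ->
  homogeneous d.+1 (lext a u).
Proof.
move=> Uu + s; elim: s d a => [//|v s IH] d a ha sd; rewrite /lext /=.
rewrite [X in X - _](hom_fderive v Uu ha) // sub0r.
case: d ha sd => [|d] ha sd.
  rewrite [X in - X](IH (size s)) ?oppr0 ?neq_ltn ?leqnn // => y Uy.
  by rewrite (hom_contract0 v (ha y Uy)).
by rewrite [X in - X](IH d) ?oppr0 // => y Uy; exact/hom_contract/ha.
Qed.

Lemma alt_fderive v a u : U u -> smooth_field a -> (forall y, U y -> lalternating (a y)) ->
  lalternating (fderive v a u).
Proof.
move=> Uu sa aa; split=> p x y => [r s|s]; rewrite /fderive.
  rewrite -smooth_deriveZ // -smooth_deriveD //; last exact: smoothZ.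
  by apply: derive_eq_on => // z /aa[-> _].
rewrite -smooth_deriveN //.
by apply: derive_eq_on => // z /aa[_ ->].
Qed.

(** Linearity in the head argument is that of the directional derivative. For a swap of the first
    two arguments, Cartan's formula is unfolded twice: the two derivative terms trade places, and
    the rest is antisymmetry of [a]. *)
Lemma alt_lext a u : U u -> smooth_field a -> (forall y, U y -> lalternating (a y)) ->
  lalternating (lext a u).
Proof.
move=> Uu sa aa; split=> p; elim: p a sa aa => [|z p IH] a sa aa x y.
- move=> r s; rewrite !cat0s.
  have E w : lext a u (w :: s) = 'D_w (fun z => a z s) u - lext (fun z => lcontract w (a z)) u s by [].
  rewrite (E (r *: x + y)) (E x) (E y) smooth_derive_lin //.
  rewrite (lext_ext (b := fun z => r *L lcontract x (a z) + lcontract y (a z))) //; last first.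
    by move=> z /aa az; rewrite alt_linear.
  have sx := sf_contract x sa; have sy := sf_contract y sa.
  rewrite lextD ?lextZ //; last by apply: sf_scale => //; exact: smooth_cst.
  by rewrite !lfE; move: (lext _ _ _) (lext _ _ _) => *; ring.
- move=> r s.
  have E t : lext a u ((z :: p) ++ t) = fderive z a u (p ++ t) - lext (fun y => lcontract z (a y)) u (p ++ t) by [].
  rewrite !E IH; [|exact: sf_contract|by move=> w /aa; exact: alt_contract].
  have [-> _] := alt_fderive z Uu sa aa.
  by move: (lext _ _ _) (lext _ _ _) => *; ring.
- move=> s; rewrite !cat0s.
  have E w w' : lext a u [:: w, w' & s] = fderive w (fun z => lcontract w' (a z)) u s -
     (fderive w' (fun z => lcontract w (a z)) u s - lext (fun z => lcontract w' (lcontract w (a z))) u s) by [].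
  rewrite !E (lext_ext (b := fun z => - lcontract x (lcontract y (a z)))) //; last first.
    by move=> z /aa az; rewrite alt_swap.
  rewrite lextN //; last by do 2 apply: sf_contract.
  by rewrite !lfE; move: (lext _ _ _) => *; ring.
- move=> s.
  have E t : lext a u ((z :: p) ++ t) = fderive z a u (p ++ t) - lext (fun y => lcontract z (a y)) u (p ++ t) by [].
  rewrite !E IH; [|exact: sf_contract|by move=> w /aa; exact: alt_contract].
  have [_ ->] := alt_fderive z Uu sa aa.
  by rewrite opprB opprK addrC.
Qed.

(** The variable vector [X y] is expanded in the fixed basis, so that only scalar products have to
    be differentiated. *)
Lemma derive_contract_field v a (X : V -> V) s u : U u -> smooth_field a ->
  (forall y, U y -> lalternating (a y)) -> smooth_on U X ->
  'D_v (fun y => a y (X y :: s)) u = fderive v a u (X u :: s) + a u ('D_v X u :: s).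
Proof.
move=> Uu sa aa /(smooth_rowP oU) sX.
rewrite (derive_eq_on (g := fun y => \sum_k X y 0 k * a y (bvec R k :: s)) v Uu); last first.
  move=> y /aa ay; have := congr1 (fun h => h s) (contract_expand (X y) ay).
  by rewrite lfE.
rewrite smooth_derive_sum //; last by move=> k; exact: smoothM.
under eq_bigr => k _ do rewrite smooth_deriveM //.
rewrite big_split /=; congr (_ + _).
  have := congr1 (fun h => h s) (contract_expand (X u) (alt_fderive v Uu sa aa)).
  by rewrite lfE.
have := congr1 (fun h => h s) (contract_expand ('D_v X u) (aa u Uu)).
move=> e; transitivity (lcontract ('D_v X u) (a u) s) => //.
rewrite e lfE; apply: eq_bigr => k _; rewrite lfE mulrC; congr (_ * _).
rewrite derive_mx ?mxE //; apply/derivable_mxP => i j; rewrite (ord1 i).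
exact: smooth_derivable (sX j) Uu.
Qed.

Lemma sf_contract_field a (X : V -> V) : smooth_field a ->
  (forall y, U y -> lalternating (a y)) -> smooth_on U X ->
  smooth_field (fun y => lcontract (X y) (a y)).
Proof.
move=> sa aa /(smooth_rowP oU) sX s.
have : smooth_on U (fun y => \sum_k X y 0 k * a y (bvec R k :: s)).
  by apply: smooth_sum => // k; exact: smoothM.
apply: smooth_ext => // y /aa ay.
have := congr1 (fun h => h s) (contract_expand (X y) ay).
by rewrite lfE.
Qed.

(** The list counterpart of the sum over argument positions in [lie_deriv]. *)
Fixpoint insert_sum (D : V -> V) s (c : seq V -> R) : R :=
  if s is v :: s' then c (D v :: s') + insert_sum D s' (lcontract v c) else 0.

(** L_X = d i_X + i_X d for variable X. Contraction with a constant [v] commutes with L_X up to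
    contraction with ['D_v X], the term that [derive_contract_field] produces inside d i_X; what
    remains is the induction hypothesis for i_v a. *)
Lemma cartan_formula a (X : V -> V) s u : U u -> smooth_field a ->
  (forall y, U y -> lalternating (a y)) -> smooth_on U X ->
  fderive (X u) a u s + insert_sum (fun v => 'D_v X u) s (a u) =
  lext (fun y => lcontract (X y) (a y)) u s + lext a u (X u :: s).
Proof.
move=> Uu + + sX; elim: s a => [|v s IH] a sa aa.
  by rewrite /lext /= addr0 add0r subr0.
have sc := sf_contract v sa.
have ac y : U y -> lalternating (lcontract v (a y)) by move=> /aa; exact: alt_contract.
have -> : fderive (X u) a u (v :: s) + insert_sum (fun v => 'D_v X u) (v :: s) (a u) =
  a u ('D_v X u :: s) + (fderive (X u) (fun y => lcontract v (a y)) u s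
    + insert_sum (fun v => 'D_v X u) s (lcontract v (a u))) by rewrite addrCA.
rewrite IH //.
have -> : lext (fun y => lcontract (X y) (a y)) u (v :: s) =
  'D_v (fun y => a y (X y :: s)) u - lext (fun y => lcontract v (lcontract (X y) (a y))) u s by [].
rewrite derive_contract_field //.
rewrite (lext_ext (a := fun y => lcontract v (lcontract (X y) (a y)))
  (b := fun y => - lcontract (X y) (lcontract v (a y)))) //; last first.
  by move=> y /aa ay; rewrite alt_swap.
rewrite lextN //; last exact: sf_contract_field.
have -> : lext a u [:: X u, v & s] = fderive (X u) (fun y => lcontract v (a y)) u s
  - (fderive v a u (X u :: s) - lext (fun y => lcontract v (lcontract (X u) (a y))) u s) by [].
rewrite (lext_ext (a := fun y => lcontract v (lcontract (X u) (a y)))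
  (b := fun y => - lcontract (X u) (lcontract v (a y)))) //; last first.
  by move=> y /aa ay; rewrite alt_swap.
rewrite lextN //; last exact: sf_contract.
have -> : lext (fun y => lcontract v (a y)) u (X u :: s) =
  fderive (X u) (fun y => lcontract v (a y)) u s - lext (fun y => lcontract (X u) (lcontract v (a y))) u s by [].
rewrite !lfE.
move: (lext (fun y => lcontract (X y) (lcontract v (a y))) u s)
  (lext (fun y => lcontract (X u) (lcontract v (a y))) u s)
  (fderive (X u) (fun y => lcontract v (a y)) u s) (fderive v a u (X u :: s))
  (a u ('D_v X u :: s)) => p1 p2 p3 p4 p5.
by ring.
Qed.

End FieldCalculus.

(** * From forms on matrices to forms on lists *)

Section MatrixForms.
Variables (R : realType) (m : nat).
Local Notation V := 'rV[R]_m.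

Definition mx_rows k (A : 'M[R]_(k, m)) : seq V := [seq row i A | i <- enum 'I_k].
Definition rows_mx k (s : seq V) : 'M[R]_(k, m) := \matrix_(i < k) nth 0 s i.

Definition list_form k (a : 'M[R]_(k, m) -> R) : seq V -> R :=
  fun s => if size s == k then a (rows_mx k s) else 0.

Lemma size_mx_rows k (A : 'M[R]_(k, m)) : size (mx_rows A) = k.
Proof. by rewrite size_map size_enum_ord. Qed.

Lemma nth_mx_rows k (A : 'M[R]_(k, m)) (i : 'I_k) : nth 0 (mx_rows A) i = row i A.
Proof. by rewrite (nth_map i) ?size_enum_ord // nth_ord_enum. Qed.

Lemma mx_rowsK k (A : 'M[R]_(k, m)) : rows_mx k (mx_rows A) = A.
Proof. by apply/row_matrixP => i; rewrite rowK nth_mx_rows. Qed.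

Lemma rows_mxK k s : size s = k -> mx_rows (rows_mx k s) = s.
Proof.
move=> sk; apply: (@eq_from_nth _ 0); rewrite size_mx_rows // => i ik.
by rewrite -[i]/(nat_of_ord (Ordinal ik)) nth_mx_rows rowK.
Qed.

Lemma list_form_rows k (a : 'M[R]_(k, m) -> R) A : list_form a (mx_rows A) = a A.
Proof. by rewrite /list_form size_mx_rows eqxx mx_rowsK. Qed.

Lemma hom_list_form k (a : 'M[R]_(k, m) -> R) : homogeneous k (list_form a).
Proof. by move=> s /negbTE sk; rewrite /list_form sk. Qed.

Lemma list_formK k (f : seq V -> R) : homogeneous k f ->
  list_form (fun A : 'M[R]_(k, m) => f (mx_rows A)) = f.
Proof.
move=> hf; apply/funext => s; rewrite /list_form; case: eqP => [sk|/eqP /hf //].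
by rewrite rows_mxK.
Qed.

Lemma list_form_ext k (a : 'M[R]_(k, m) -> R) (f : seq V -> R) : homogeneous k f ->
  (forall A, a A = f (mx_rows A)) -> list_form a = f.
Proof. by move=> hf af; rewrite -(list_formK hf); congr list_form; exact/funext. Qed.

Lemma mx_rows_cat k (i : 'I_k) (A : 'M[R]_(k, m)) :
  mx_rows A = take i (mx_rows A) ++ row i A :: drop i.+1 (mx_rows A).
Proof. by rewrite -nth_mx_rows -drop_nth ?cat_take_drop // size_mx_rows. Qed.

Lemma mx_rows_replace k (i : 'I_k) (A : 'M[R]_(k, m)) (w : V) :
  mx_rows (\matrix_(j < k) if j == i then w else row j A) =
  take i (mx_rows A) ++ w :: drop i.+1 (mx_rows A).
Proof.
have ik := ltn_ord i.
apply: (@eq_from_nth _ 0).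
  by rewrite size_cat /= size_take size_drop !size_mx_rows ltn_ord; lia.
rewrite size_mx_rows => j jk; rewrite -[j]/(nat_of_ord (Ordinal jk)).
move: (Ordinal jk) => {jk}j; rewrite nth_mx_rows rowK nth_cat size_take size_mx_rows ik.
rewrite -val_eqE /=; case: (ltngtP j i) => h; last by rewrite h subnn.
  by rewrite nth_take // nth_mx_rows.
have -> : (j - i = (j - i.+1).+1)%N by lia.
by rewrite /= nth_drop subnKC // nth_mx_rows.
Qed.

Lemma mx_rows_row' k (i : 'I_k.+1) (A : 'M[R]_(k.+1, m)) :
  mx_rows (row' i A) = take i (mx_rows A) ++ drop i.+1 (mx_rows A).
Proof.
have ik : (i <= k)%N by rewrite -ltnS.
apply: (@eq_from_nth _ 0).
  by rewrite size_cat size_take size_drop !size_mx_rows; case: ltnP => h; lia.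
rewrite size_mx_rows => j jk; rewrite -[j]/(nat_of_ord (Ordinal jk)).
move: (Ordinal jk) => {jk}j; rewrite nth_mx_rows nth_cat size_take size_mx_rows ltn_ord.
have -> : row j (row' i A) = row (lift i j) A by apply/rowP => l; rewrite !mxE.
rewrite -nth_mx_rows /= /bump; case: (leqP i j) => h.
  by rewrite add1n nth_drop addSn subnKC.
by rewrite add0n nth_take.
Qed.

Lemma mx_rows_col_mx k (v : V) (A : 'M[R]_(k, m)) :
  mx_rows (col_mx v A : 'M[R]_(k.+1, m)) = v :: mx_rows A.
Proof.
apply: (@eq_from_nth _ 0); first by rewrite /= !size_mx_rows.
rewrite size_mx_rows => j jk; rewrite -[j]/(nat_of_ord (Ordinal jk)).
move: (Ordinal jk) => {jk}j; rewrite nth_mx_rows; apply/rowP => l.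
rewrite mxE; case: (unliftP ord0 j) => [i|] ->.
  have -> : lift ord0 i = rshift 1 i by apply/val_inj.
  by rewrite (@col_mxEd _ 1 k m v A) /= nth_mx_rows mxE.
have -> : ord0 = lshift k (0 : 'I_1) by apply/val_inj.
by rewrite (@col_mxEu _ 1 k m v A) /=.
Qed.

Lemma mx_rows_mulmx k m' (A : 'M[R]_(k, m)) (J : 'M[R]_(m, m')) :
  [seq row i (A *m J) | i <- enum 'I_k] = map (fun v : V => v *m J) (mx_rows A).
Proof. by rewrite /mx_rows -map_comp; apply: eq_map => i /=; rewrite row_mul. Qed.

Lemma alt_list_form k (a : 'M[R]_(k, m) -> R) :
  alternating_multilinear a -> lalternating (list_form a).
Proof.
move=> [lin alt].
have L : lmultilinear (list_form a).
  move=> p u v r s; rewrite /list_form !size_cat /=.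
  case: eqP => [sz|_]; last by rewrite mulr0 addr0.
  have {}sz : (size p + (size s).+1)%N = k := sz.
  have pk : (size p < k)%N by lia.
  have nthx x : nth 0 (p ++ x :: s) (size p) = x by rewrite nth_cat ltnn subnn.
  have nthe x y (j : nat) : j != size p -> nth 0 (p ++ x :: s) j = nth 0 (p ++ y :: s) j.
    move=> jp; rewrite !nth_cat; case: ltnP => // h.
    by have -> : (j - size p = (j - size p).-1.+1)%N by rewrite prednK // subn_gt0 ltn_neqAle eq_sym jp.
  have rowe x y : row' (Ordinal pk) (rows_mx k (p ++ x :: s)) =
                  row' (Ordinal pk) (rows_mx k (p ++ y :: s)).
    apply/matrixP => i j; rewrite !mxE (nthe x y) //=.
    by rewrite eq_sym neq_bump.
  rewrite (lin (Ordinal pk) _ (rows_mx k (p ++ u :: s)) (rows_mx k (p ++ v :: s)) r 1) ?mul1r //.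
  by rewrite !rowK !nthx scale1r.
split=> // p u v s.
have z x : list_form a (p ++ x :: x :: s) = 0.
  rewrite /list_form !size_cat /=; case: eqP => // sz.
  have {}sz : (size p + (size s).+2)%N = k := sz.
  have pk : (size p < k)%N by lia.
  have pk1 : ((size p).+1 < k)%N by lia.
  apply: (alt (Ordinal pk) (Ordinal pk1)); first by rewrite -val_eqE /= neq_ltn ltnSn.
  rewrite !rowK /= !nth_cat ltnn subnn.
  by rewrite ltnNge leqnSn /= subSn // subnn.
have LD (q : seq V) (x y : V) (t : seq V) : list_form a (q ++ (x + y) :: t) = list_form a (q ++ x :: t) + list_form a (q ++ y :: t).
  by have := L q x y 1 t; rewrite scale1r mul1r.
(* Polarisation: the value on two adjacent arguments u + v, u + v is zero and expands into the two
   mixed terms. *)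
have h1 := LD p u v (u + v :: s).
have h2 := LD (rcons p u) u v s; have h3 := LD (rcons p v) u v s.
rewrite !cat_rcons !z ?add0r ?addr0 in h1 h2 h3.
by apply/eqP; rewrite -addr_eq0 -h2 -h3 -h1.
Qed.

Lemma list_alternating_multilinear k (f : seq V -> R) :
  lalternating f -> alternating_multilinear (fun A : 'M[R]_(k, m) => f (mx_rows A)).
Proof.
move=> ff; have [lf _] := ff; split=> [i A B C b c rA rB rC|i j A ij rij].
  (* Matrices that agree off row [i] have lists with the same prefix and the same suffix. *)
  have tk D : row' i D = row' i A -> take i (mx_rows D) = take i (mx_rows A) /\
       drop i.+1 (mx_rows D) = drop i.+1 (mx_rows A).
    case: k i A B C rA rB rC D => [[]//|k] i A B C rA rB rC D e.
    have := mx_rows_row' i A; rewrite -e mx_rows_row' => /eqP.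
    by rewrite eqseq_cat ?size_take ?size_mx_rows // => /andP[/eqP -> /eqP ->].
  have [tB dB] := tk _ rB; have [tC dC] := tk _ rC.
  rewrite (mx_rows_cat i A) (mx_rows_cat i B) (mx_rows_cat i C) tB dB tC dC rA lf; congr (_ + _).
  have f0 q t : f (q ++ 0 :: t) = 0.
    have := lf q 0 0 1 t; rewrite scaler0 addr0 mul1r => /esym/eqP.
    by rewrite -subr_eq0 addrK => /eqP.
  have := lf (take i (mx_rows A)) (row i C) 0 c (drop i.+1 (mx_rows A)).
  by rewrite addr0 f0 addr0.
wlog ltij : i j ij rij / (i < j)%N.
  move=> H; case: (ltngtP i j) => h; first exact: (H i j).
    by apply: (H j i) => //; rewrite eq_sym.
  by move: ij; rewrite -val_eqE /= h eqxx.
rewrite (mx_rows_cat i A); set d := drop _ _.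
have jd : (j - i.+1 < size d)%N by rewrite size_drop size_mx_rows ltn_sub2r // (leq_ltn_trans ltij).
rewrite -(cat_take_drop (j - i.+1) d) (drop_nth 0 jd) nth_drop subnKC // nth_mx_rows -rij.
exact: alt_repeat.
Qed.

Lemma list_form_wedge k l (a : 'M[R]_(k, m) -> R) (b : 'M[R]_(l, m) -> R) :
  alternating_multilinear a -> alternating_multilinear b ->
  list_form (wedge_cov a b) = lwedge (list_form a) (list_form b).
Proof.
move=> aa ab; apply: list_form_ext => [|A].
  by apply: hom_lwedge; exact: hom_list_form.
rewrite -(@perm_shuffle _ _ (k + l)%N _ k l) ?size_mx_rows //;
  try exact: alt_list_form; try exact: hom_list_form.
congr (_ * _); apply: eq_bigr => s _; congr (_ * _ * _).
  rewrite /list_form size_takel ?size_perm_seq ?leq_addr // eqxx; congr a.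
  apply/row_matrixP => i; rewrite rowK nth_take // -[nat_of_ord i]/(nat_of_ord (lshift l i)).
  by rewrite nth_perm_seq nth_mx_rows; apply/rowP => j; rewrite !mxE.
rewrite /list_form size_drop size_perm_seq addKn eqxx; congr b.
apply/row_matrixP => i; rewrite rowK nth_drop -[(k + i)%N]/(nat_of_ord (rshift k i)).
by rewrite nth_perm_seq nth_mx_rows; apply/rowP => j; rewrite !mxE.
Qed.

Lemma ext_list_sum s (a : V -> seq V -> R) u : ext_list s a u =
  \sum_(i < size s) (-1) ^+ i * 'D_(nth 0 s i) (fun y => a y (take i s ++ drop i.+1 s)) u.
Proof.
elim: s a => [|v s IH] a; first by rewrite big_ord0.
rewrite /= big_ord_recl /= ?take0 ?drop0 expr0 mul1r; congr (_ + _).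
rewrite IH -sumrN; apply: eq_bigr => i _ /=.
by rewrite /bump /= add1n exprS mulN1r mulNr.
Qed.

Lemma insert_sumE (D : V -> V) s (c : seq V -> R) : insert_sum D s c =
  \sum_(i < size s) c (take i s ++ D (nth 0 s i) :: drop i.+1 s).
Proof.
elim: s c => [|v s IH] c; first by rewrite big_ord0.
by rewrite /= big_ord_recl /= ?take0 ?drop0 IH.
Qed.

End MatrixForms.

(** * The operations on local forms, translated to lists *)

Section LocalForms.
Variables (R : realType) (m : nat) (M : manifold R m).
Local Notation V := 'rV[R]_m.

Definition list_field k (a : local_form M k) (c : chart R m M) (u : V) : seq V -> R :=
  list_form (a c u).

Lemma list_field_ext_d k (a : local_form M k) c u :
  list_field (ext_d a) c u = lext (list_field a c) u.
Proof.
apply: list_form_ext => [|A].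
  apply: (@hom_lext _ _ setT) => //; first exact: openT.
  by move=> y _; exact: hom_list_form.
rewrite /lext ext_list_sum size_mx_rows; apply: eq_bigr => i _; rewrite nth_mx_rows.
congr (_ * _); congr ('D__ _ u); apply/funext => y.
by rewrite -mx_rows_row' /list_field list_form_rows.
Qed.

Lemma list_field_wedge k l (a : local_form M k) (b : local_form M l) c u :
  alternating_multilinear (a c u) -> alternating_multilinear (b c u) ->
  list_field (wedge a b) c u = lwedge (list_field a c u) (list_field b c u).
Proof. exact: list_form_wedge. Qed.

Lemma alternating_list_form k (a : 'M[R]_(k, m) -> R) :
  lalternating (list_form a) -> alternating_multilinear a.
Proof.
move=> h; have := @list_alternating_multilinear R m k _ h.
by congr alternating_multilinear; apply/funext => A; rewrite list_form_rows.
Qed.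

(** Both claims go through one induction: translating the wedge requires the previous power to be
    alternating, and this is read off its translation. *)
Lemma list_field_wpow (w : local_form M 2) j c u : alternating_multilinear (w c u) ->
  alternating_multilinear (wpow w j c u) /\
  list_field (wpow w j) c u = lpow (list_field w c u) j.
Proof.
move=> aw; elim: j => [|j [IHa IHe]].
  have e : list_field (wpow w 0) c u = lpow (list_field w c u) 0.
    by apply/funext => -[|x s].
  by split=> //; apply: alternating_list_form; rewrite [list_form _]e; exact: alt_lunit.
have e : list_field (wpow w j.+1) c u = lpow (list_field w c u) j.+1.
  exact: (etrans (list_field_wedge aw IHa) (congr1 _ IHe)).
split=> //; apply: alternating_list_form; rewrite [list_form _]e.
by apply: alt_lpow; exact: alt_list_form.
Qed.

Lemma list_field_interior k (X : local_vfield M) (a : local_form M k) c u :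
  list_field (interior_prod X a) c u = lcontract (X c u) (list_field a c u).
Proof.
case: k a => [|k] a.
  rewrite (hom_contract0 _ (hom_list_form _)); apply: list_form_ext => //.
apply: list_form_ext => [|A]; first exact/hom_contract/hom_list_form.
by rewrite /lcontract -mx_rows_col_mx /list_field list_form_rows.
Qed.

Lemma list_field_scale k r (a : local_form M k) c u :
  list_field (scale_form r a) c u = r *L list_field a c u.
Proof.
apply: list_form_ext => [|A]; first exact/homZ/hom_list_form.
by rewrite lf_scale /list_field list_form_rows.
Qed.

Lemma list_field_fun H k (a : local_form M k) c u :
  list_field (fun_form H a) c u = H (cinv c u) *L list_field a c u.
Proof.
apply: list_form_ext => [|A]; first exact/homZ/hom_list_form.
by rewrite lf_scale /list_field list_form_rows.
Qed.

Lemma list_field_lie k (X : local_vfield M) (a : local_form M k) c u A :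
  lie_deriv X a c u A =
  fderive (X c u) (list_field a c) u (mx_rows A) +
  insert_sum (fun v => 'D_v (X c) u) (mx_rows A) (list_field a c u).
Proof.
rewrite insert_sumE size_mx_rows /lie_deriv; congr (_ + _).
  by congr ('D__ _ u); apply/funext => y; rewrite /list_field list_form_rows.
apply: eq_bigr => i _; rewrite nth_mx_rows.
by rewrite -[LHS](list_form_rows (a c u)) mx_rows_replace.
Qed.

(** List forms of all degrees have one type, so the cast along k = l disappears. *)
Lemma form_eqP k l (a : local_form M k) (b : local_form M l) :
  form_eq a b <-> k = l /\
    forall c u, atlas c -> cim c u -> list_field a c u = list_field b c u.
Proof.
split=> [[e h]|[e]].
  split=> // c u hc hu; move: a b h; case: _ / e => a b h.
  by congr list_form; apply/funext => A; rewrite h // castmx_id.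
move: b; case: _ / e => b h; exists erefl => c u A hc hu; rewrite castmx_id.
by rewrite -(list_form_rows (a c u)) -(list_form_rows (b c u)) -!/(list_field _ _ _) h.
Qed.

End LocalForms.

Section BilinearDerivative.
Variables (R : realType) (V : normedModType R) (m : nat).

Lemma derivable_sum_fun (I : finType) (F : I -> V -> R) u v :
  (forall i, derivable (F i) u v) ->
  is_derive u v (fun y => \sum_i F i y) (\sum_i 'D_v (F i) u).
Proof.
move=> dF; rewrite /index_enum; elim: (Finite.enum _) => [|i r IH].
  rewrite big_nil (_ : (fun y => _) = cst 0); first exact: is_derive_cst.
  by apply/funext => y; rewrite big_nil.
rewrite big_cons (_ : (fun y => _) = F i + (fun y => \sum_(j <- r) F j y)).
  by apply: is_deriveD; exact/derivableP.
by apply/funext => y; rewrite big_cons.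
Qed.

(** Models the value of a pulled-back 2-form: [p] and [q] will be the images of constant vectors
    under the differential of the coordinate change, and [G] the Gram matrix along it. *)
Lemma derive_bilinear (p q : V -> 'rV[R]_m) (G : V -> 'M[R]_m)
    (p' q' : 'rV[R]_m) (G' : 'M[R]_m) u v :
  (forall k, is_derive u v (fun y => p y 0 k) (p' 0 k)) ->
  (forall k, is_derive u v (fun y => q y 0 k) (q' 0 k)) ->
  (forall k l, is_derive u v (fun y => G y k l) (G' k l)) ->
  'D_v (fun y => (p y *m G y *m (q y)^T) 0 0) u =
  (p' *m G u *m (q u)^T) 0 0 + (p u *m G' *m (q u)^T) 0 0 + (p u *m G u *m q'^T) 0 0.
Proof.
move=> dp dq dG.
pose F l k y := p y 0 k * G y k l * q y 0 l.
have dF l k : is_derive u v (F l k)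
    (p u 0 k * G u k l * q' 0 l + q u 0 l * (p u 0 k * G' k l + G u k l * p' 0 k)).
  exact: (is_deriveM (is_deriveM (dp k) (dG k l)) (dq l)).
have -> : (fun y => (p y *m G y *m (q y)^T) 0 0) = (fun y => \sum_l \sum_k F l k y).
  by apply/funext => y; rewrite mxE; apply: eq_bigr => l _; rewrite !mxE mulr_suml.
have d1 l : is_derive u v (fun y => \sum_k F l k y) (\sum_k 'D_v (F l k) u).
  by apply: derivable_sum_fun => k; have [] := dF l k.
have d1' l : derivable (fun y => \sum_k F l k y) u v by have [] := d1 l.
have [_ ->] := @derivable_sum_fun _ (fun l y => \sum_k F l k y) u v d1'.
have E l : 'D_v (fun y => \sum_k F l k y) u =
    (p' *m G u) 0 l * q u 0 l + (p u *m G') 0 l * q u 0 l + (p u *m G u) 0 l * q' 0 l.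
  have [_ ->] := d1 l; rewrite !mxE !mulr_suml -!big_split /=; apply: eq_bigr => k _.
  have [_ ->] := dF l k.
  by move: (p u 0 k) (q u 0 l) (G u k l) (p' 0 k) (q' 0 l) (G' k l) => *; ring.
under eq_bigr => l _ do rewrite E.
rewrite !big_split /= ![in RHS]mxE.
by congr (_ + _ + _); apply: eq_bigr => l _; rewrite [X in _ = _ * X]mxE.
Qed.

End BilinearDerivative.

(** * Naturality of d on 2-forms under a smooth change of coordinates *)

Section Naturality.
Variables (R : realType) (m : nat).
Local Notation V := 'rV[R]_m.
Variables (O U : set V) (tau : V -> V).
Hypotheses (oO : open O) (oU : open U) (stau : smooth_on O tau)
  (tauU : forall y, O y -> U (tau y)).

Lemma smooth_map_differentiable u : O u -> differentiable tau u.
Proof.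
move=> Ou; have scoord := (smooth_rowP oO tau).1 stau.
have -> : tau = \sum_(j < m) (fun y => tau y 0 j *: (delta_mx 0 j : V)).
  by apply/funext => y; rewrite fct_sumE {1}(row_sum_delta (tau y)).
apply: differentiable_sum => j; apply: differentiableZl.
exact: (smooth_differentiable oO (scoord j) Ou).
Qed.

Lemma derive_jacobian u v : O u -> 'D_v tau u = v *m jacobian tau u.
Proof. by move=> /smooth_map_differentiable; exact: deriveEjacobian. Qed.

Lemma derive_chain (g : V -> R) u v : smooth_on U g -> O u ->
  is_derive u v (g \o tau) ('D_('D_v tau u) g (tau u)).
Proof.
move=> sg Ou; have dt := smooth_map_differentiable Ou.
have dg := smooth_differentiable oU sg (tauU Ou).
have dc : differentiable (g \o tau) u by exact: differentiable_comp.
split; first exact: diff_derivable.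
rewrite (@deriveE _ _ _ _ u v dc) (@deriveE _ _ _ _ u v dt) (@deriveE _ _ _ _ _ _ dg).
exact: (congr1 (fun h : V -> R => h v) (diff_comp dt dg)).
Qed.

Variables (a b : V -> seq V -> R).
Hypotheses (sb : smooth_field U b) (ab : forall y, U y -> lalternating (b y))
  (hb : forall y, U y -> homogeneous 2 (b y))
  (pull : forall y, O y -> a y = b (tau y) \o map (fun v => v *m jacobian tau y)).

(** On constant vectors [a] is the value of [b] on the moving vectors ['D_w1 tau] and ['D_w2 tau];
    the product rule gives two terms with second derivatives of [tau] and one with a derivative of
    [b]. *)
Let derive_pair u v w1 w2 : O u ->
  'D_v (fun y => a y [:: w1; w2]) u =
  b (tau u) [:: 'D_v ('D_w1 tau) u; 'D_w2 tau u] +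
  fderive ('D_v tau u) b (tau u) [:: 'D_w1 tau u; 'D_w2 tau u] +
  b (tau u) [:: 'D_w1 tau u; 'D_v ('D_w2 tau) u].
Proof.
move=> Ou; have Ut := tauU Ou.
have sd w : smooth_on O ('D_w tau) by exact: smooth_derive.
have sdk w k := (smooth_rowP oO _).1 (sd w) k.
rewrite (derive_eq_on (U := O) oO (g := fun y => ('D_w1 tau y *m gram (b (tau y)) *m ('D_w2 tau y)^T) 0 0)) //; last first.
  move=> y Oy; rewrite pull //= -!derive_jacobian // gramE //.
  exact/ab/tauU.
have dG k l : is_derive u v (fun y => gram (b (tau y)) k l)
    ('D_('D_v tau u) (fun z => b z [:: bvec R k; bvec R l]) (tau u)).
  have := derive_chain v (sb [:: bvec R k; bvec R l]) Ou.
  congr (is_derive _ _ _ _); apply/funext => y; by rewrite mxE.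
have dT w k : is_derive u v (fun y => 'D_w tau y 0 k) ('D_v ('D_w tau) u 0 k).
  split; first exact: (smooth_derivable (sdk w k) Ou).
  by rewrite derive_mx ?mxE //; exact: (smooth_derivable (sd w) Ou).
have dG' k l : is_derive u v (fun y => gram (b (tau y)) k l)
    (gram (fderive ('D_v tau u) b (tau u)) k l).
  by rewrite [X in is_derive _ _ _ X]mxE; exact: dG.
rewrite (derive_bilinear (dT w1) (dT w2) dG').
by rewrite !gramE //; [exact: ab|exact: (alt_fderive oU _ Ut sb ab)|exact: ab].
Qed.

Let mixed_derivative u v w : O u -> 'D_v ('D_w tau) u = 'D_w ('D_v tau) u.
Proof.
move=> Ou; have sd z : smooth_on O ('D_z tau) by exact: smooth_derive.
have sk := (smooth_rowP oO tau).1 stau.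
apply/rowP => k.
have Dk x y : 'D_x ('D_y tau) u 0 k = 'D_x (fun z => 'D_y tau z 0 k) u.
  by rewrite derive_mx ?mxE //; exact: (smooth_derivable (sd y) Ou).
have E x y : O y -> 'D_x tau y 0 k = 'D_x (fun z => tau z 0 k) y.
  by move=> Oy; rewrite derive_mx ?mxE //; exact: smooth_derivable stau Oy.
refine (etrans (Dk v w) (etrans (derive_eq_on oO v Ou (E w)) _)).
refine (etrans (smooth_schwarz oO w v (sk k) Ou) (esym _)).
exact: (etrans (Dk w v) (derive_eq_on oO w Ou (E v))).
Qed.

(* The terms with second derivatives of tau cancel in pairs, these being symmetric. *)
Lemma lext_natural u s : O u -> (forall y, O y -> homogeneous 2 (a y)) ->
  lext a u s = lext b (tau u) (map (fun v => v *m jacobian tau u) s).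
Proof.
move=> Ou ha; have Ut := tauU Ou.
have [|sz] := eqVneq (size s) 3%N; last first.
  by rewrite (hom_lext oO Ou ha) // (hom_lext oU Ut hb) // size_map.
case: s => [|v0 [|v1 [|v2 [|]]]] // _; rewrite [map _ _]/=.
rewrite -!derive_jacobian //.
(* The second derivative of [tau] is abstracted to a symmetric [H], which leaves an identity between
   finitely many real numbers. *)
have [H [Hsym E]] : exists H : V -> V -> V, (forall v w, H v w = H w v) /\
    forall v w1 w2, 'D_v (fun y => a y [:: w1; w2]) u =
      b (tau u) [:: H v w1; 'D_w2 tau u] +
      fderive ('D_v tau u) b (tau u) [:: 'D_w1 tau u; 'D_w2 tau u] +
      b (tau u) [:: 'D_w1 tau u; H v w2].
  exists (fun v w => 'D_v ('D_w tau) u); split=> [v w|v w1 w2].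
    exact: mixed_derivative.
  exact: derive_pair.
have L (c : V -> seq V -> R) (z x0 x1 x2 : V) : lext c z [:: x0; x1; x2] = 'D_x0 (fun y => c y [:: x1; x2]) z -
    ('D_x1 (fun y => c y [:: x0; x2]) z - 'D_x2 (fun y => c y [:: x0; x1]) z).
  by rewrite /lext /= subr0.
rewrite (L a u) (L b (tau u)).
rewrite (E v0 v1 v2) (E v1 v0 v2) (E v2 v0 v1) (Hsym v1 v0) (Hsym v2 v0) (Hsym v2 v1).
have sw x y : b (tau u) [:: x; y] = - b (tau u) [:: y; x].
  by have [_ /(_ [::] x y [::])] := ab Ut.
rewrite /fderive; move: ('D_v0 tau u) ('D_v1 tau u) ('D_v2 tau u) => x0 x1 x2.
rewrite (sw (H v0 v2)).
move: ('D_x0 _ _) ('D_x1 _ _) ('D_x2 _ _) => d0 d1 d2.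
move: (b (tau u) [:: H v0 v1; x2]) (b (tau u) [:: x1; H v0 v2]) (b (tau u) [:: x0; H v1 v2]) => p q r.
by ring.
Qed.

End Naturality.

(** * Forms on manifolds *)

Section PullbackForms.
Variables (R : realType) (m m' : nat) (J : 'M[R]_(m, m')).

Lemma alt_map (a : seq 'rV[R]_m' -> R) : lalternating a ->
  lalternating (a \o map (fun v : 'rV[R]_m => v *m J)).
Proof.
move=> [la sa]; split=> p u v => [r s|s] /=; rewrite !map_cat /=.
  by rewrite mulmxDl -scalemxAl la.
exact: sa.
Qed.

Lemma hom_map d (a : seq 'rV[R]_m' -> R) : homogeneous d a ->
  homogeneous d (a \o map (fun v : 'rV[R]_m => v *m J)).
Proof. by move=> ha s sd; rewrite /= ha // size_map. Qed.

End PullbackForms.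

Lemma om_trace_sum (R : numFieldType) (n : nat) (om : seq 'rV[R]_(n + n) -> R)
    (I : finType) (c : I -> R) (F : I -> seq 'rV[R]_(n + n) -> R) :
  om_trace om (\sum_i c i *L F i) = \sum_i c i * om_trace om (F i).
Proof.
rewrite /om_trace; under [RHS]eq_bigr => i _ do rewrite mulrCA -mxtraceZ scalemxAl.
rewrite -mulr_sumr; congr (_ * _); rewrite -raddf_sum -mulmx_suml; congr (\tr (_ *m _)).
apply/matrixP => i j; rewrite !mxE lfE summxE; apply: eq_bigr => k _.
by rewrite !mxE lfE.
Qed.

Section ManifoldForms.
Variables (R : realType) (m : nat) (M : manifold R m).
Local Notation V := 'rV[R]_m.
Implicit Types (c : chart R m M) (u v : V).

Lemma cim_open c : atlas c -> open (cim c).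
Proof. by move=> /atlas_chart []. Qed.

Lemma cinvK c u : atlas c -> cim c u -> cdom c (cinv c u) /\ cmap c (cinv c u) = u.
Proof. by move=> /atlas_chart[_ _ K _ _] [x dx <-]; rewrite K. Qed.

Lemma overlapP c c' u : atlas c -> overlap c c' u <-> cim c u /\ cdom c' (cinv c u).
Proof.
move=> ac; have [_ _ K _ _] := atlas_chart ac; split.
  by move=> [x [dx dx'] <-]; split; [exists x|rewrite K].
by move=> [cu d']; have [d e] := cinvK ac cu; exists (cinv c u).
Qed.

Lemma overlap_sub c c' u : atlas c -> overlap c c' u -> cim c u.
Proof. by move=> ac /(overlapP _ _ ac)[]. Qed.

Lemma overlap_im c c' u : atlas c -> overlap c c' u -> cim c' (transition c c' u).
Proof. by move=> ac /(overlapP _ _ ac)[_ d]; exists (cinv c u). Qed.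

Lemma overlap_open c c' : atlas c -> atlas c' -> open (overlap c c').
Proof.
move=> ac ac'; rewrite openE => u /(overlapP _ _ ac)[cu d'].
have [_ oc _ _ ci] := atlas_chart ac; have [od' _ _ _ _] := atlas_chart ac'.
rewrite /interior.
have h1 := open_nbhs_nbhs (conj oc cu).
have h2 : nbhs u (cinv c @^-1` cdom c') by apply: (ci u cu); exact: open_nbhs_nbhs.
apply: filterS (filterI h1 h2) => y [cy dy].
by apply/(overlapP _ _ ac).
Qed.

Lemma transition_smooth c c' : atlas c -> atlas c' ->
  smooth_on (overlap c c') (transition c c').
Proof. by move=> ac ac'; have [] := atlas_compatible ac ac'. Qed.

Definition pull c c' u (a : seq V -> R) : seq V -> R :=
  a \o map (fun v => v *m jacobian (transition c c') u).

Definition is_list_form k (F : chart R m M -> V -> seq V -> R) : Prop :=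
  [/\ forall c u, atlas c -> cim c u -> lalternating (F c u),
      forall c u, atlas c -> cim c u -> homogeneous k (F c u),
      forall c, atlas c -> smooth_field (cim c) (F c)
    & forall c c' u, atlas c -> atlas c' -> overlap c c' u ->
        F c u = pull c c' u (F c' (transition c c' u))].

Definition unlist_form k (F : chart R m M -> V -> seq V -> R) : local_form M k :=
  fun c u A => F c u (mx_rows A).

Lemma is_form_list k (a : local_form M k) : is_form a -> is_list_form k (list_field a).
Proof.
move=> [alt sm tr]; split.
- by move=> c u ac cu; exact/alt_list_form/alt.
- by move=> c u _ _; exact: hom_list_form.
- move=> c ac s; rewrite /list_field /list_form; case: eqP => _; first exact: sm.
  exact: (smooth_cst (cim_open ac)).
- move=> c c' u ac ac' ou; apply: list_form_ext => [|A].
    by apply: hom_map; exact: hom_list_form.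
  rewrite (tr c c') // /pull /= -mx_rows_mulmx.
  by rewrite -[LHS](list_form_rows (a c' (transition c c' u))).
Qed.

Lemma list_is_form k F : is_list_form k F -> is_form (@unlist_form k F).
Proof.
move=> [alt hom sm tr]; split.
- by move=> c u ac cu; apply: list_alternating_multilinear; exact: alt.
- by move=> c A ac; exact: sm.
- move=> c c' u A ac ac' ou; rewrite /unlist_form (tr c c') // /pull /=.
  by rewrite -mx_rows_mulmx.
Qed.

Lemma list_field_unlist k F c u : is_list_form k F -> atlas c -> cim c u ->
  list_field (@unlist_form k F) c u = F c u.
Proof. by move=> [_ hom _ _] ac cu; apply: list_formK; exact: hom. Qed.

Lemma is_list_form_lwedge k l F G : is_list_form k F -> is_list_form l G ->
  is_list_form (k + l)%N (fun c u => lwedge (F c u) (G c u)).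
Proof.
move=> [aF hF sF tF] [aG hG sG tG]; split.
- by move=> c u ac cu; apply: alt_lwedge; [exact: aF|exact: aG].
- by move=> c u ac cu; apply: hom_lwedge; [exact: hF|exact: hG].
- by move=> c ac; apply: sf_lwedge; [exact: cim_open|exact: sF|exact: sG].
- move=> c c' u ac ac' ou; rewrite (tF c c') // (tG c c') //.
  by apply/funext => s; rewrite /pull lwedge_map.
Qed.

Lemma is_list_form_lpow k F j : is_list_form k F ->
  is_list_form (j * k)%N (fun c u => lpow (F c u) j).
Proof.
move=> hF; elim: j => [|j IH]; last exact: is_list_form_lwedge.
split=> [c u _ _|c u _ _|c ac|c c' u _ _ _].
- exact: alt_lunit.
- exact: hom_lunit.
- exact: sf_cst (cim_open ac) _.
- by apply/funext => -[|x s].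
Qed.

Lemma is_list_form_scale k F (r : R) : is_list_form k F ->
  is_list_form k (fun c u => r *L F c u).
Proof.
move=> [aF hF sF tF]; split.
- by move=> c u ac cu; apply: altZ; exact: aF.
- by move=> c u ac cu; apply: homZ; exact: hF.
- move=> c ac; apply: sf_scale; [exact: cim_open| |exact: sF].
  exact: smooth_cst (cim_open ac) r.
- by move=> c c' u ac ac' ou; rewrite (tF c c').
Qed.

Lemma lext_list_form F c c' u : is_list_form 2 F -> atlas c -> atlas c' ->
  overlap c c' u ->
  lext (F c) u = pull c c' u (lext (F c') (transition c c' u)).
Proof.
move=> [aF hF sF tF] ac ac' ou; apply/funext => s.
apply: (@lext_natural _ _ (overlap c c') (cim c')) => //.
- exact: overlap_open.
- exact: cim_open.
- exact: transition_smooth.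
- by move=> y; exact: overlap_im.
- exact: sF.
- by move=> y; exact: aF.
- by move=> y; exact: hF.
- by move=> y oy; exact: tF.
- by move=> y /(overlap_sub ac); exact: hF.
Qed.

End ManifoldForms.

(** * The vector field generated by a 2-form *)

Section SymplecticManifold.
Variables (R : realType) (n : nat) (hn : (2 <= n)%N).
Local Notation m := (n + n)%N.
Local Notation V := 'rV[R]_m.
Variables (M : manifold R m) (w : local_form M 2).
Hypothesis hw : symplectic w.
Implicit Types (c : chart R m M) (u v : V).

Local Notation Om := (list_field w).
Local Notation P c u := (lpow (Om c u) (n - 2)).
Local Notation top c u := (top_power (Om c u)).
Local Notation nn := (n%:R * n.-1%:R : R).

Let nn0 : nn != 0. Proof. by rewrite mulf_eq0 !pnatr_eq0; lia. Qed.

Lemma symplectic_list_form : is_list_form 2 Om.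
Proof. by have [fw _ _] := hw; exact: is_form_list. Qed.

Let altOm c u : atlas c -> cim c u -> lalternating (Om c u).
Proof. by have [h _ _ _] := symplectic_list_form; exact: h. Qed.
Let homOm c u : homogeneous 2 (Om c u). Proof. exact: hom_list_form. Qed.
Let sfOm c : atlas c -> smooth_field (cim c) (Om c).
Proof. by have [_ _ h _] := symplectic_list_form; exact: h. Qed.
Let multOm c u : atlas c -> cim c u -> alternating_multilinear (w c u).
Proof. by have [[h _ _] _ _] := hw; exact: h. Qed.

Lemma list_field_pair c u v v' : Om c u [:: v; v'] = w c u (col_mx v v').
Proof.
have := mx_rows_col_mx v (v' : 'M[R]_(1, m)).
have -> : mx_rows v' = [:: v'].
  rewrite /mx_rows enum_ordSl /= enum_ord0 /=; congr [:: _].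
  by apply/rowP => j; rewrite mxE.
by move=> <-; rewrite /list_field list_form_rows.
Qed.

Lemma list_field_nondegenerate c u v : atlas c -> cim c u ->
  (forall v', Om c u [:: v; v'] = 0) -> v = 0.
Proof.
move=> ac cu h; have [_ _ nd] := hw; apply: (nd c u ac cu v) => v'.
by rewrite -list_field_pair.
Qed.

Lemma gram_unit c u : atlas c -> cim c u -> gram (Om c u) \in unitmx.
Proof.
move=> ac cu; rewrite -row_free_unit; apply: inj_row_free => v v0.
apply: (list_field_nondegenerate ac cu) => v'.
by rewrite gramE ?v0 ?mul0mx ?mxE //; exact: altOm.
Qed.

(** Since w in [c] is the pullback of w in [c'], a vector killed by the Jacobian is w-orthogonal to
    everything, hence zero. *)
Lemma jacobian_unit c c' u : atlas c -> atlas c' -> overlap c c' u ->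
  jacobian (transition c c') u \in unitmx.
Proof.
move=> ac ac' ou; rewrite -row_free_unit; apply: inj_row_free => v v0.
have cu := overlap_sub ac ou; have cu' := overlap_im ac ou.
apply: (list_field_nondegenerate ac cu) => v'.
have [_ _ _ tr] := symplectic_list_form; rewrite (tr c c') // /pull /= v0.
exact: (congr1 (fun h => h [:: _]) (contract_zero (altOm ac' cu'))).
Qed.

Lemma lext_symplectic c u : atlas c -> cim c u -> lext (Om c) u = 0.
Proof.
move=> ac cu; have [_ /form_eqP[_ h] _] := hw.
rewrite -list_field_ext_d h //; apply/funext => s.
by rewrite /list_field /list_form /zero_form; case: eqP.
Qed.

Lemma lext_lpow c u j : atlas c -> cim c u -> lext (fun y => lpow (Om c y) j) u = 0.
Proof.
move=> ac cu; have oc := cim_open ac; have sO := sfOm ac.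
elim: j => [|j IH] /=.
  (* The power 0 does not depend on the point; the induction runs over an arbitrary constant [a],
     because contraction does not preserve [lunit]. *)
  apply/funext => s; elim: s (lunit (R:=R) (m:=m)) => [//|v s IH] a.
  rewrite /lext /= derive_cst sub0r.
  by rewrite [ext_list _ _ _](IH (lcontract v a)) oppr0.
rewrite (lext_lwedge oc cu sO (sf_lpow oc j sO)) lext_symplectic // IH.
by rewrite lwedge0l lwedge0r addr0.
Qed.

Lemma lext_lwedge_lpow (F : V -> seq V -> R) c u j : atlas c -> cim c u ->
  smooth_field (cim c) F ->
  lext (fun y => lwedge (F y) (lpow (Om c y) j)) u = lwedge (lext F u) (lpow (Om c u) j).
Proof.
move=> ac cu sF; have oc := cim_open ac.
by rewrite (lext_lwedge oc cu sF (sf_lpow oc j (sfOm ac))) lext_lpow // lwedge0r addr0.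
Qed.

Definition list_generates (F : chart R m M -> V -> seq V -> R) (X : local_vfield M) :=
  forall c u, atlas c -> cim c u ->
    nn *L lwedge (lext (F c) u) (P c u) = - lcontract (X c u) (top c u).

Lemma generatesP (a : local_form M 2) X : is_form a ->
  generates w a X <-> list_generates (list_field a) X.
Proof.
move=> fa; have [aF hF sF _] := is_form_list fa.
have cast : (n * (n - 1))%:R = nn by rewrite natrM subn1.
have L c u : atlas c -> cim c u ->
    list_field (ext_d (wedge a (wpow w (n - 2)))) c u = lwedge (lext (list_field a c) u) (P c u).
  move=> ac cu; rewrite list_field_ext_d -lext_lwedge_lpow //; last exact: sF.
  apply: (lext_ext (cim_open ac) cu) => y cy.
  have [alt _ _] := fa.
  have [ap ep] := list_field_wpow (n - 2) (multOm ac cy).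
  by rewrite list_field_wedge ?ep //; exact: alt.
have Q c u : atlas c -> cim c u ->
    list_field (scale_form (- ((n * (n - 1))%:R)^-1) (interior_prod X (wpow w n))) c u =
    - nn^-1 *L lcontract (X c u) (top c u).
  move=> ac cu; rewrite list_field_scale list_field_interior cast.
  by have [_ ->] := list_field_wpow n (multOm ac cu).
split.
  move=> /form_eqP[_ h] c u ac cu; have := h c u ac cu; rewrite L // Q // => ->.
  by rewrite lscaleA mulrN divff // lscaleN1.
move=> h; apply/form_eqP; split; first lia.
move=> c u ac cu; rewrite L // Q //.
have -> : lwedge (lext (list_field a c) u) (P c u) =
    nn^-1 *L (nn *L lwedge (lext (list_field a c) u) (P c u)).
  by rewrite lscaleA mulVf // lscale1.
by rewrite h // lscaleN -lscaleN1 lscaleA mulN1r.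
Qed.

(** The pointwise equivalence [lwedge_three_powP] for the 3-form dF; the right side is a
    nondegenerate linear system for [X c u]. *)
Lemma list_generatesP F X c u : is_list_form 2 F -> atlas c -> cim c u ->
  (nn *L lwedge (lext (F c) u) (P c u) = - lcontract (X c u) (top c u)) <->
  (forall Y, Om c u [:: Y; X c u] = om_trace (Om c u) (lcontract Y (lext (F c) u))).
Proof.
move=> [aF hF sF _] ac cu; apply: lwedge_three_powP => //; try exact: altOm.
- exact: gram_unit.
- by apply: (alt_lext (cim_open ac) cu (sF c ac)) => y; exact: aF.
- by apply: (hom_lext (cim_open ac) cu) => y; exact: hF.
Qed.

Lemma pull_top c c' u : atlas c -> atlas c' -> overlap c c' u ->
  top c u = pull c c' u (top c' (transition c c' u)).
Proof.
move=> ac ac' ou; have [_ _ _ tr] := symplectic_list_form.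
by rewrite /top_power (tr c c') // /pull lpow_map.
Qed.

(** The equation in [c'], pulled back to [c], is the equation in [c]. So both candidate vectors have
    the same contraction with w^n, and [contract_top_inj] identifies them. *)
Lemma list_generates_transition F X : is_list_form 2 F -> list_generates F X ->
  forall c c' u, atlas c -> atlas c' -> overlap c c' u ->
    X c' (transition c c' u) = X c u *m jacobian (transition c c') u.
Proof.
move=> lF gX c c' u ac ac' ou; set J := jacobian _ _; set u' := transition _ _ _.
have cu := overlap_sub ac ou; have cu' := overlap_im ac ou.
have uJ := jacobian_unit ac ac' ou.
apply: (contract_top_inj (altOm ac' cu') (homOm c' u') (gram_unit ac' cu')); first lia.
apply: oppr_inj; rewrite -(gX c' u') //.
have [_ _ _ trO] := symplectic_list_form.
have e : pull c c' u (nn *L lwedge (lext (F c') u') (P c' u')) = - lcontract (X c u) (top c u).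
  rewrite -gX // (lext_list_form lF ac ac' ou) (trO c c') // /pull lpow_map.
  by apply/funext => s; rewrite [RHS]lf_scale lwedge_map.
apply/funext => s.
(* The Jacobian is invertible, so every list of arguments is the image of one from the chart [c]. *)
have -> : s = map (fun v => v *m J) (map (fun v => v *m invmx J) s).
  by rewrite -map_comp -[LHS]map_id; apply: eq_map => v /=; rewrite mulmxKV.
move: (map _ s) => t; rewrite [LHS](congr1 (fun h => h t) e) (pull_top ac ac' ou).
by [].
Qed.

(* The solution X of w(Y, X) = tr_w(i_Y dF) for all Y. *)
Definition generated_field (F : chart R m M -> V -> seq V -> R) : local_vfield M :=
  fun c u => (invmx (gram (Om c u)) *m
    \col_k om_trace (Om c u) (lcontract (bvec R k) (lext (F c) u)))^T.

Lemma generated_field_generates F : is_list_form 2 F -> list_generates F (generated_field F).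
Proof.
move=> lF c u ac cu; have [aF hF sF _] := lF; apply/(list_generatesP _ lF ac cu) => Y.
have aL : lalternating (lext (F c) u).
  by apply: (alt_lext (cim_open ac) cu (sF c ac)) => y; exact: aF.
rewrite gramE; last exact: altOm.
rewrite /generated_field trmxK mulmxA -(mulmxA Y) mulmxV ?mulmx1; last exact: gram_unit.
rewrite (contract_expand Y aL) om_trace_sum mxE.
by apply: eq_bigr => k _; rewrite mxE.
Qed.

Lemma smooth_gram c k l (F : V -> seq V -> R) : smooth_field (cim c) F ->
  smooth_on (cim c) (fun y => gram (F y) k l).
Proof.
by move=> sF; have := sF [:: bvec R k; bvec R l]; congr smooth_on; apply/funext => y; rewrite mxE.
Qed.

Lemma generated_field_smooth F c : is_list_form 2 F -> atlas c ->
  smooth_on (cim c) (generated_field F c).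
Proof.
move=> [aF hF sF _] ac; have oc := cim_open ac; apply/(smooth_rowP oc) => j.
have sinv : forall i k, smooth_on (cim c) (fun y => invmx (gram (Om c y)) i k).
  apply: (smooth_invmx oc) => [k l|y cy]; first exact/smooth_gram/sfOm.
  exact: gram_unit.
have strace k : smooth_on (cim c)
    (fun y => om_trace (Om c y) (lcontract (bvec R k) (lext (F c) y))).
  apply: (smoothZ oc); apply: (smooth_sum oc) => i.
  apply: (smooth_mulmx oc) => // i' k'.
  by apply: smooth_gram; apply: sf_contract; exact: (sf_lext oc (sF c ac)).
have : smooth_on (cim c) (fun y => (invmx (gram (Om c y)) *m
    \col_k om_trace (Om c y) (lcontract (bvec R k) (lext (F c) y))) j 0).
  apply: (smooth_mulmx oc) => // i k.
  by apply: (smooth_ext oc _ (strace i)) => y _; rewrite mxE.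
by apply: (smooth_ext oc) => y _; rewrite [RHS]mxE.
Qed.

(** The primitive is n (n - 1) F /\ w^(n-2), a form on the whole manifold. *)
Lemma list_generates_hamiltonian F X : is_list_form 2 F -> list_generates F X ->
  is_vfield X -> hamiltonian_vfield w X.
Proof.
move=> lF gX vX; split=> //.
have lG := is_list_form_scale nn (is_list_form_lwedge lF (is_list_form_lpow (n - 2)%N symplectic_list_form)).
exists (2 + (n - 2) * 2)%N, (@unlist_form _ _ M (2 + (n - 2) * 2)%N (fun c u => nn *L lwedge (F c u) (P c u))).
split; first exact: list_is_form.
have [_ _ sF _] := lF; have [_ _ sG _] := lG.
apply/form_eqP; split; first lia.
move=> c u ac cu; have oc := cim_open ac; rewrite list_field_ext_d.
rewrite (lext_ext oc (b := fun u => nn *L lwedge (F c u) (P c u))) //; last first.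
  by move=> y cy; rewrite list_field_unlist.
rewrite (lextZ oc) //; last first.
  by apply: (sf_lwedge oc (sF c ac)); exact: (sf_lpow oc _ (sfOm ac)).
rewrite (lext_lwedge_lpow _ ac cu (sF c ac)) gX //.
rewrite list_field_scale list_field_interior lscaleN1.
by have [_ ->] := list_field_wpow n (multOm ac cu).
Qed.

(** In Cartan's formula i_X d(w^n) is zero because w^n is closed, and d(i_X w^n) is zero because i_X
    w^n is the derivative of a multiple of F /\ w^(n-2). *)
Lemma list_generates_lie F X : is_list_form 2 F -> list_generates F X -> is_vfield X ->
  form_eq (lie_deriv X (wpow w n)) (zero_form M (n * 2)).
Proof.
move=> lF gX [sX _]; exists erefl => c u A ac cu; rewrite list_field_lie /zero_form.
have oc := cim_open ac; have [_ _ sF _] := lF.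
have sP := sf_lwedge oc (sF c ac) (sf_lpow oc (n - 2) (sfOm ac)).
have e y : cim c y -> list_field (wpow w n) c y = top c y.
  by move=> cy; have [_ ->] := list_field_wpow n (multOm ac cy).
have stop : smooth_field (cim c) (fun y => top c y) by exact: (sf_lpow oc n (sfOm ac)).
have -> : fderive (X c u) (list_field (wpow w n) c) u (mx_rows A) =
    fderive (X c u) (fun y => top c y) u (mx_rows A).
  by apply: (derive_eq_on oc _ cu) => y cy; rewrite e.
have atop y : cim c y -> lalternating (top c y).
  by move=> cy; apply: alt_lpow; exact: altOm.
rewrite e // (cartan_formula oc _ cu stop atop (sX c ac)) lext_lpow // lf_zero addr0.
rewrite (lext_ext oc (b := fun y => - nn *L lext (fun z => lwedge (F c z) (P c z)) y)) //.
  by rewrite (lextZ oc) ?(lext_lext oc) ?lscale0r //; exact: (sf_lext oc).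
move=> y cy; rewrite (lext_lwedge_lpow _ ac cy (sF c ac)).
by rewrite -[LHS]opprK -gX // -!lscaleN1 lscaleA mulN1r.
Qed.

End SymplecticManifold.

(** * Hamiltonian fields and Darboux coordinates *)

Section HamiltonianConverse.
Variables (R : realType) (n : nat) (hn : (2 <= n)%N).
Local Notation m := (n + n)%N.
Local Notation V := 'rV[R]_m.
Variables (M : manifold R m) (w : local_form M 2).
Hypothesis hw : symplectic w.
Implicit Types (c : chart R m M) (u v : V).

Local Notation Om := (list_field w).
Local Notation P c u := (lpow (Om c u) (n - 2)).
Local Notation top c u := (top_power (Om c u)).
Local Notation nn := (n%:R * n.-1%:R : R).

Let lOm := symplectic_list_form hw.
Let altOm c u : atlas c -> cim c u -> lalternating (Om c u).
Proof. by have [h _ _ _] := lOm; exact: h. Qed.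
Let homOm c u : homogeneous 2 (Om c u). Proof. exact: hom_list_form. Qed.
Let sfOm c : atlas c -> smooth_field (cim c) (Om c).
Proof. by have [_ _ h _] := lOm; exact: h. Qed.

Section Inverse.
Variable B : chart R m M -> V -> seq V -> R.
Hypothesis lB : is_list_form n.-1.*2 B.

Definition lefschetz_field : chart R m M -> V -> seq V -> R :=
  fun c u => lefschetz_inverse (Om c u) (B c u).

Let altB c u : atlas c -> cim c u -> lalternating (B c u).
Proof. by have [h _ _ _] := lB; exact: h. Qed.
Let homB c u : atlas c -> cim c u -> homogeneous n.-1.*2 (B c u).
Proof. by have [_ h _ _] := lB; exact: h. Qed.

Lemma lefschetz_fieldK c u : atlas c -> cim c u ->
  lwedge (lefschetz_field c u) (P c u) = B c u.
Proof.
move=> ac cu; apply: lwedge_lefschetz_inverse => //; [exact: altOm|exact: gram_unit hw _ _ ac cu|exact: altB|exact: homB].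
Qed.

(** Smoothness is read off the formula, whose denominator is the nonvanishing value of w^n on the
    basis. The transformation law is not visible there: the representative in [c] and the pullback
    of the one in [c'] have the same product with w^(n-2), so [om_trace_lefschetz] makes them
    equal. *)
Lemma lefschetz_field_form : is_list_form 2 lefschetz_field.
Proof.
have alt c u : atlas c -> cim c u -> lalternating (lefschetz_field c u).
  by move=> ac cu; apply: alt_lefschetz_inverse => //; [exact: altOm|exact: gram_unit hw _ _ ac cu|exact: altB|exact: homB].
have hom c u : homogeneous 2 (lefschetz_field c u) by exact: hom_bilinear_form.
split=> //.
- move=> c ac s; have oc := cim_open ac; have [_ _ sB _] := lB.
  have sW k j := sf_lwedge oc (sf_cst oc (dual_coord R j))
     (sf_lwedge oc (sf_contract (bvec R k) (sfOm ac)) (sB c ac)) (basis_list R m).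
  have sT := sf_lpow oc n (sfOm ac) (basis_list R m).
  have sC k j : smooth_on (cim c) (fun y => lefschetz_coef (Om c y) (B c y) k j).
    have T0 y : cim c y -> lpow (Om c y) n (basis_list R m) != 0.
      by move=> cy; apply: top_power_neq0 => //; [exact: altOm|exact: gram_unit hw _ _ ac cy].
    by apply: (smooth_ext oc _ (smoothM oc (sW k j) (smoothV oc T0 sT))) => y _; rewrite mxE.
  have sM k j : smooth_on (cim c) (fun y => lefschetz_matrix (Om c y) (B c y) k j).
    apply: (smooth_mulmx oc) => [i l|i l]; last by apply: smooth_gram; exact: sfOm.
    have h : smooth_on (cim c) (fun y => (2^-1 * n%:R * \tr (lefschetz_coef (Om c y) (B c y))) * (i == l)%:R
         - nn * lefschetz_coef (Om c y) (B c y) i l).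
      apply: (smoothB oc); last exact: (smoothZ oc).
      apply: (smoothM oc); last exact: smooth_cst oc _.
      by apply: (smoothZ oc); apply: (smooth_sum oc).
    by apply: (smooth_ext oc _ h) => y _; rewrite !mxE mulr_natr.
  case: s => [|x [|y [|z s]]]; try exact: smooth_cst oc (0 : R).
  apply: (smooth_mulmx oc) => [i l|i l]; last exact: smooth_cst oc _.
  by apply: (smooth_mulmx oc) => // i' l'; exact: smooth_cst oc _.
- move=> c c' u ac ac' ou.
  have cu := overlap_sub ac ou; have cu' := overlap_im ac ou.
  have [_ _ _ trO] := lOm; have [_ _ _ trB] := lB.
  apply/eqP; rewrite -subr_eq0; apply/eqP.
  apply: (om_trace_lefschetz (om := Om c u)) => //.
  + exact: altOm.
  + exact: gram_unit hw _ _ ac cu.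
  + by apply: altD; [exact: alt|apply: altN; apply: alt_map; exact: alt].
  + by apply: homD => //; apply: homN; exact: hom_map.
  + rewrite lwedgeDl lwedgeNl lefschetz_fieldK // (trO c c') // /pull lpow_map.
    apply/eqP; rewrite subr_eq0; apply/eqP/funext => s.
    by rewrite lwedge_map lefschetz_fieldK // (trB c c').
Qed.

End Inverse.

(** With [b] a primitive of - i_X w^n, F solves n (n - 1) F /\ w^(n-2) = b; differentiating gives
    the equation because w is closed. *)
Lemma hamiltonian_is_generated (X : local_vfield M) : hamiltonian_vfield w X ->
  exists2 F, is_list_form 2 F & list_generates w F X.
Proof.
move=> [vX [j [b [fb /form_eqP[jn eb]]]]].
have lb := is_form_list fb.
(* [exact_form] leaves the degree of the primitive free; equality of the degrees of the two forms
   determines it. *)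
have ej : j = n.-1.*2 by lia.
have lb' : is_list_form n.-1.*2 (list_field b) by rewrite -ej.
pose B := fun c u => nn^-1 *L list_field b c u.
have lB : is_list_form n.-1.*2 B by exact: is_list_form_scale.
have lL := lefschetz_field_form lB; have [_ _ sL _] := lL.
exists (lefschetz_field B) => // c u ac cu; have oc := cim_open ac.
rewrite -(lext_lwedge_lpow hw) //; last exact: sL.
rewrite (lext_ext oc (b := B c)) //; last by move=> y cy; exact: lefschetz_fieldK.
have [_ _ sb _] := lb.
rewrite (lextZ oc) //; last exact: sb.
rewrite lscaleA mulfV ?lscale1; last by rewrite mulf_eq0 !pnatr_eq0; lia.
rewrite -list_field_ext_d eb // list_field_scale list_field_interior lscaleN1.
have [[alt _ _] _ _] := hw.
by have [_ ->] := list_field_wpow n (alt c u ac cu).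
Qed.

End HamiltonianConverse.

(** * The generated field in Darboux coordinates *)

Section Darboux.
Variables (R : realType) (n : nat) (hn : (2 <= n)%N).
Local Notation m := (n + n)%N.
Local Notation V := 'rV[R]_m.

Lemma list_form_dq (i : 'I_n) : list_form (@dq R n i) = dual_coord R (lshift n i).
Proof.
apply: list_form_ext => [|A]; first exact: hom_lone.
by rewrite /mx_rows enum_ordSl /= enum_ord0 /= mxE.
Qed.

Lemma list_form_dp (i : 'I_n) : list_form (@dp R n i) = dual_coord R (rshift n i).
Proof.
apply: list_form_ext => [|A]; first exact: hom_lone.
by rewrite /mx_rows enum_ordSl /= enum_ord0 /= mxE.
Qed.

Lemma wedge_cov_pair (a b : 'M[R]_(1, m) -> R) (k l : 'I_m) x y :
  list_form a = dual_coord R k -> list_form b = dual_coord R l ->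
  wedge_cov a b (rows_mx 2 [:: x; y]) = x 0 k * y 0 l - y 0 k * x 0 l.
Proof.
move=> ea eb.
have aa : alternating_multilinear a by apply: alternating_list_form; rewrite ea; exact: alt_dual_coord.
have ab : alternating_multilinear b by apply: alternating_list_form; rewrite eb; exact: alt_dual_coord.
have := congr1 (fun h => h [:: x; y]) (list_form_wedge aa ab).
rewrite {1}/list_form /= => ->; rewrite ea eb.
rewrite /lwedge /= /grade_sign /lcontract /dual_coord /= expr0 expr1.
by ring.
Qed.

Variables (M : manifold R m) (w : local_form M 2).
Hypothesis hw : symplectic w.
Variable c : chart R m M.
Hypothesis dc : darboux w c.

Local Notation Om := (list_field w).
Local Notation q_ i := (bvec R (lshift n i)).
Local Notation p_ i := (bvec R (rshift n i)).

Lemma darboux_pair u x y : cim c u -> Om c u [:: x; y] =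
  \sum_(i < n) (x 0 (rshift n i) * y 0 (lshift n i) - y 0 (rshift n i) * x 0 (lshift n i)).
Proof.
move=> cu; have [_ h] := dc; rewrite /list_field /list_form /= h //.
by apply: eq_bigr => i _; rewrite (wedge_cov_pair _ _ (list_form_dp i) (list_form_dq i)).
Qed.

Lemma bvecE (k l : 'I_m) : (bvec R k) 0 l = (l == k)%:R.
Proof. by rewrite mxE eqxx. Qed.

Let shiftE := (bvecE, eq_lshift, eq_rshift, eq_lrshift, eq_rlshift).

Lemma darboux_p u y i : cim c u -> Om c u [:: p_ i; y] = y 0 (lshift n i).
Proof.
move=> cu; rewrite darboux_pair // (bigD1 i) //= big1 => [|j ji].
  by rewrite !shiftE eqxx mul1r mulr0 subr0 addr0.
by rewrite !shiftE (negbTE ji) mul0r mulr0 subr0.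
Qed.

Lemma darboux_q u y i : cim c u -> Om c u [:: q_ i; y] = - y 0 (rshift n i).
Proof.
move=> cu; rewrite darboux_pair // (bigD1 i) //= big1 => [|j ji].
  by rewrite !shiftE eqxx mul0r mulr1 sub0r addr0.
by rewrite !shiftE (negbTE ji) mul0r mulr0 subr0.
Qed.

(** In the order q, p the Gram matrix of w has off-diagonal blocks -1 and 1, and its inverse is [Q].
    The half trace then counts each pair (p_j, q_j) exactly once. *)
Lemma darboux_om_trace u (a : seq V -> R) : cim c u -> lalternating a ->
  om_trace (Om c u) a = \sum_(j < n) a [:: p_ j; q_ j].
Proof.
move=> cu aa; have [ac _] := dc.
have altO : lalternating (Om c u) by have [h _ _ _] := symplectic_list_form hw; exact: h.
pose Q : 'M[R]_(n + n) := block_mx 0 1%:M (- 1%:M) 0.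
have GQ : gram (Om c u) *m Q = 1%:M.
  have -> : gram (Om c u) = block_mx 0 (- 1%:M) 1%:M 0.
    apply/matrixP => k l; rewrite mxE.
    case: (splitP k) => i ki; case: (splitP l) => j lj.
    - have -> : k = lshift n i by exact/val_inj.
      have -> : l = lshift n j by exact/val_inj.
      by rewrite darboux_q // !shiftE block_mxEul mxE oppr0.
    - have -> : k = lshift n i by exact/val_inj.
      have -> : l = rshift n j by exact/val_inj.
      by rewrite darboux_q // !shiftE block_mxEur !mxE.
    - have -> : k = rshift n i by exact/val_inj.
      have -> : l = lshift n j by exact/val_inj.
      by rewrite darboux_p // !shiftE block_mxEdl !mxE.
    - have -> : k = rshift n i by exact/val_inj.
      have -> : l = rshift n j by exact/val_inj.
      by rewrite darboux_p // !shiftE block_mxEdr mxE.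
  rewrite mulmx_block !(mul0mx, mulmx0, mulNmx, mulmxN, mulmx1, mul1mx, opprK, add0r, addr0, oppr0).
  by rewrite -scalar_mx_block.
have iG : invmx (gram (Om c u)) = Q.
  have uG := gram_unit hw ac cu.
  by rewrite -[LHS]mulmx1 -GQ mulmxA mulVmx // mul1mx.
rewrite /om_trace iG -[gram a]submxK mulmx_block !mulmx0 !mulmxN !mulmx1 !add0r !addr0.
rewrite mxtrace_block /mxtrace -big_split /= mulr_sumr; apply: eq_bigr => j _.
rewrite !mxE; have [_ sa] := aa; rewrite (sa [::] (q_ j) (p_ j) [::]) opprK /=.
by field.
Qed.

Section Components.
Variables (a : local_form M 2) (Aqq Apq App : 'I_n -> 'I_n -> V -> R).
Hypotheses (fa : is_form a) (ca : components a c Aqq Apq App).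

Let F := list_field a c.

Let compE u x y : cim c u -> F u [:: x; y] =
  2^-1 * (\sum_(i < n) \sum_(j < n) Aqq i j u *
     (x 0 (lshift n i) * y 0 (lshift n j) - y 0 (lshift n i) * x 0 (lshift n j)))
  + \sum_(i < n) \sum_(j < n) Apq i j u *
     (x 0 (rshift n i) * y 0 (lshift n j) - y 0 (rshift n i) * x 0 (lshift n j))
  + 2^-1 * (\sum_(i < n) \sum_(j < n) App i j u *
     (x 0 (rshift n i) * y 0 (rshift n j) - y 0 (rshift n i) * x 0 (rshift n j))).
Proof.
move=> cu; have [_ _ h] := ca cu; rewrite /F /list_field /list_form /= h.
congr (_ * _ + _ + _ * _); apply: eq_bigr => i _; apply: eq_bigr => j _; congr (_ * _).
- exact: wedge_cov_pair (list_form_dq i) (list_form_dq j).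
- exact: wedge_cov_pair (list_form_dp i) (list_form_dq j).
- exact: wedge_cov_pair (list_form_dp i) (list_form_dp j).
Qed.

Let sum_delta (f : 'I_n -> 'I_n -> R) k l :
  \sum_(i < n) \sum_(j < n) f i j * ((i == k)%:R * (j == l)%:R) = f k l.
Proof.
rewrite (bigD1 k) //= [X in _ + X]big1 ?addr0 => [|i ik]; last first.
  by rewrite big1 // => j _; rewrite (negbTE ik) mul0r mulr0.
rewrite (bigD1 l) //= big1 ?addr0 => [|j jl]; first by rewrite !eqxx !mulr1.
by rewrite (negbTE jl) !mulr0.
Qed.

Let sum_delta2 (f : 'I_n -> 'I_n -> R) k l : (forall i j, f i j = - f j i) ->
  2^-1 * \sum_(i < n) \sum_(j < n) f i j * ((i == k)%:R * (j == l)%:R - (i == l)%:R * (j == k)%:R) = f k l.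
Proof.
move=> fs; under eq_bigr => i _ do under eq_bigr => j _ do rewrite mulrBr.
under eq_bigr => i _ do rewrite sumrB.
by rewrite sumrB !sum_delta (fs l k); field.
Qed.

Let sum_zero (f g : 'I_n -> 'I_n -> R) : (forall i j, g i j = 0) ->
  \sum_(i < n) \sum_(j < n) f i j * g i j = 0.
Proof. by move=> g0; rewrite big1 // => i _; rewrite big1 // => j _; rewrite g0 mulr0. Qed.

Let comp_pq u i j : cim c u -> F u [:: p_ i; q_ j] = Apq i j u.
Proof.
move=> cu; rewrite compE // [X in 2^-1 * X + _]sum_zero ?[X in _ + 2^-1 * X]sum_zero ?mulr0 ?add0r ?addr0; last 2 first.
- by move=> k l; rewrite !shiftE mul0r mulr0 subr0.
- by move=> k l; rewrite !shiftE mulr0 mul0r subr0.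
rewrite -[RHS](sum_delta (fun i j => Apq i j u)).
by apply: eq_bigr => k _; apply: eq_bigr => l _; rewrite !shiftE mul0r subr0.
Qed.

Let comp_pp u i j : cim c u -> F u [:: p_ i; p_ j] = App i j u.
Proof.
move=> cu; rewrite compE //; have [_ sp _] := ca cu.
rewrite [X in 2^-1 * X + _]sum_zero ?[X in _ + X + _]sum_zero ?mulr0 ?add0r; last 2 first.
- by move=> k l; rewrite !shiftE !mulr0 subr0.
- by move=> k l; rewrite !shiftE !mulr0 subr0.
rewrite -[RHS](sum_delta2 _ _ sp); congr (_ * _).
by apply: eq_bigr => k _; apply: eq_bigr => l _; rewrite !shiftE.
Qed.

Let comp_qq u i j : cim c u -> F u [:: q_ i; q_ j] = Aqq i j u.
Proof.
move=> cu; rewrite compE //; have [sq _ _] := ca cu.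
rewrite [X in _ + 2^-1 * X]sum_zero ?[X in _ + X + _]sum_zero ?mulr0 ?addr0; last 2 first.
- by move=> k l; rewrite !shiftE !mul0r subr0.
- by move=> k l; rewrite !shiftE !mul0r subr0.
rewrite -[RHS](sum_delta2 _ _ sq); congr (_ * _).
by apply: eq_bigr => k _; apply: eq_bigr => l _; rewrite !shiftE.
Qed.

(** The equation w(Y, X) = tr_w(i_Y da) is tested on coordinate vectors: Y = p_i isolates the
    q^i-component of X, and Y = q_i minus the p_i-component. The trace is the sum over j of da(Y,
    p_j, q_j), where each value of da has three terms. *)
Lemma generated_components (X : local_vfield M) : list_generates w (list_field a) X ->
  forall u, cim c u -> forall i : 'I_n,
      X c u 0 (lshift n i) =
        \sum_(j < n) (partial_q j (App i j) u + partial_p i (Apq j j) u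
                      - partial_p j (Apq i j) u) /\
      X c u 0 (rshift n i) =
        \sum_(j < n) (partial_p j (Aqq i j) u - partial_q i (Apq j j) u
                      + partial_q j (Apq j i) u).
Proof.
move=> gX u cu i; have [ac _] := dc; have oc := cim_open ac.
have lF := is_form_list fa; have [aF hF sF _] := lF.
have key := (list_generatesP hn hw X lF ac cu).1 (gX c u ac cu).
have aL : lalternating (lext F u).
  by apply: (alt_lext oc cu (sF c ac)) => y; exact: aF.
have L (x0 x1 x2 : V) : lext F u [:: x0; x1; x2] = 'D_x0 (fun y => F y [:: x1; x2]) u -
    ('D_x1 (fun y => F y [:: x0; x2]) u - 'D_x2 (fun y => F y [:: x0; x1]) u).
  by rewrite /lext /= subr0.
have dpq v k l : 'D_v (fun y => F y [:: p_ k; q_ l]) u = 'D_v (Apq k l) u.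
  by apply: (derive_eq_on oc _ cu) => y cy; exact: comp_pq.
have dpp v k l : 'D_v (fun y => F y [:: p_ k; p_ l]) u = 'D_v (App k l) u.
  by apply: (derive_eq_on oc _ cu) => y cy; exact: comp_pp.
have dqq v k l : 'D_v (fun y => F y [:: q_ k; q_ l]) u = 'D_v (Aqq k l) u.
  by apply: (derive_eq_on oc _ cu) => y cy; exact: comp_qq.
have dqp v k l : 'D_v (fun y => F y [:: q_ l; p_ k]) u = - 'D_v (Apq k l) u.
  rewrite -dpq -(smooth_deriveN oc _ (sF c ac _) cu).
  by apply: (derive_eq_on oc _ cu) => y cy; have [_ /(_ [::] _ _ [::])] := aF c y ac cy; apply.
split.
  rewrite -(darboux_p _ _ cu) key (darboux_om_trace cu); last exact: alt_contract.
  apply: eq_bigr => j _; rewrite [LHS]L dpq dpq dpp /partial_q /partial_p.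
  rewrite -!/(bvec R _).
  by move: ('D__ _ u) ('D__ _ u) ('D__ _ u) => *; ring.
rewrite -[LHS]opprK -(darboux_q _ _ cu) key (darboux_om_trace cu); last exact: alt_contract.
rewrite -sumrN; apply: eq_bigr => j _; rewrite [X in - X]L dpq dqq dqp /partial_q /partial_p.
rewrite -!/(bvec R _).
by move: ('D__ _ u) ('D__ _ u) ('D__ _ u) => *; ring.
Qed.

End Components.

End Darboux.

(** * Multiplication by functions, and integral curves in a single chart *)

Section FunctionForms.
Variables (R : realType) (m : nat) (M : manifold R m).
Local Notation V := 'rV[R]_m.

Lemma list_form_is_form k (a : local_form M k) : is_list_form k (list_field a) -> is_form a.
Proof.
move=> /list_is_form; congr is_form; apply/funext => c; apply/funext => u; apply/funext => A.
exact: list_form_rows.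
Qed.

Lemma is_list_form_fun k (H : M -> R) (F : chart R m M -> V -> seq V -> R) :
  smooth_function H -> is_list_form k F ->
  is_list_form k (fun c u => H (cinv c u) *L F c u).
Proof.
move=> sH [aF hF sF tF]; split.
- by move=> c u ac cu; apply: altZ; exact: aF.
- by move=> c u ac cu; apply: homZ; exact: hF.
- by move=> c ac; apply: (sf_scale (cim_open ac) (sH c ac)); exact: sF.
- move=> c c' u ac ac' ou; rewrite (tF c c') // /transition /=.
  have [_ _ K _ _] := atlas_chart ac'.
  by have [_ d'] := (overlapP c' u ac).1 ou; rewrite K.
Qed.

Lemma is_derive_row (f : R -> V) (t : R) (l : V) :
  is_derive t 1 f l <-> forall k, is_derive t 1 (fun s => f s 0 k) (l 0 k).
Proof.
split=> [[df <-] k|h].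
  split; first by have /derivable_mxP := df; apply.
  by rewrite derive_mx ?mxE.
have df : derivable f t 1.
  by apply/derivable_mxP => i k; rewrite (ord1 i); have [] := h k.
split=> //; rewrite derive_mx //; apply/rowP => k; rewrite mxE.
by have [_ ->] := h k.
Qed.

(** One chart suffices: continuity of [g] is recovered through [cinv c], and the equation in any
    other chart follows from the chain rule and the transformation law of [X]. *)
Lemma integral_curve_chart (X : local_vfield M) c (I : set R) (g : R -> M) :
  is_vfield X -> atlas c -> open I -> (forall t, I t -> cdom c (g t)) ->
  integral_curve X I g <->
  (forall t, I t -> is_derive t 1 (cmap c \o g) (X c (cmap c (g t)))).
Proof.
move=> [_ vX] ac oI gI; split=> [h t It|h t It].
  by have [_] := h t It; apply => //; exact: gI.
have [od oc K cc ci] := atlas_chart ac.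
have dt := h t It; have gt := gI t It.
have cu : cim c (cmap c (g t)) by exists (g t).
have dg : differentiable (cmap c \o g) t.
  by apply/derivable1_diffP; have [] := dt.
have cg : {for t, continuous (cmap c \o g)} by exact: differentiable_continuous.
have nI : \forall s \near t, I s by exact: open_nbhs_nbhs.
(* As [I] is open, [g] coincides near [t] with [cinv c] applied to its differentiable coordinate
   expression. *)
have cont : {for t, continuous g}.
  have e : \forall s \near t, (cinv c \o (cmap c \o g)) s = g s.
    by apply: filterS nI => s Is /=; rewrite K //; exact: gI.
  have cc' : {for t, continuous (cinv c \o (cmap c \o g))}.
    by apply: continuous_comp => //; exact: ci.
  have {}cc' : (cinv c \o (cmap c \o g)) @ t --> g t.
    by have := cc'; rewrite /prop_for /continuous_at /= K.
  suff : g @ t --> g t by [].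
  by apply: cvg_trans cc'; apply: near_eq_cvg.
split=> // c' ac' gt'.
have [od' _ K' _ _] := atlas_chart ac'.
have ou : overlap c c' (cmap c (g t)) by exists (g t).
have oo := overlap_open ac ac'.
have dtau := smooth_map_differentiable oo (transition_smooth ac ac') ou.
have e : \forall s \near t, (transition c c' \o (cmap c \o g)) s = (cmap c' \o g) s.
  by apply: filterS nI => s Is; rewrite /transition /= K //; exact: gI.
apply: (near_eq_is_derive e).
have dtau' : differentiable (transition c c') ((cmap c \o g) t) by exact: dtau.
have dcomp : differentiable (transition c c' \o (cmap c \o g)) t by exact: differentiable_comp.
split; first exact/derivable1_diffP.
have Xe : X c' (cmap c' (g t)) = X c (cmap c (g t)) *m jacobian (transition c c') (cmap c (g t)).
  by rewrite -vX // /transition /= K.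
have E1 : 'd (cmap c \o g) t 1 = X c (cmap c (g t)).
  by have [_ <-] := dt; exact/esym/deriveE.
have E2 : 'd (transition c c') (cmap c (g t)) (X c (cmap c (g t))) =
    X c (cmap c (g t)) *m jacobian (transition c c') (cmap c (g t)).
  exact: etrans (esym (deriveE _ dtau)) (deriveEjacobian _ dtau).
refine (etrans (@deriveE _ _ _ _ t 1 dcomp) _).
refine (etrans (congr1 (fun h : R -> V => h 1) (diff_comp dg dtau')) _).
by rewrite Xe -E2 -E1.
Qed.

End FunctionForms.

(** * The special case of a function times w *)

Section Hamilton.
Variables (R : realType) (n : nat) (hn : (2 <= n)%N).
Local Notation m := (n + n)%N.
Local Notation V := 'rV[R]_m.
Variables (M : manifold R m) (w : local_form M 2).
Hypothesis hw : symplectic w.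
Variables (H : M -> R) (X : local_vfield M) (c : chart R m M).
Hypotheses (sH : smooth_function H) (dc : darboux w c)
  (gX : generates w (scale_form ((n - 1)%:R)^-1 (fun_form H w)) X).

Let a := scale_form ((n - 1)%:R)^-1 (fun_form H w).
Let kappa : R := ((n - 1)%:R)^-1.
Let h := H \o cinv c.

Lemma hamilton_is_form : is_form a.
Proof.
apply: list_form_is_form.
have -> : list_field a = fun c u => kappa *L (H (cinv c u) *L list_field w c u).
  by apply/funext => c'; apply/funext => u; rewrite list_field_scale list_field_fun.
apply: is_list_form_scale; apply: is_list_form_fun => //.
exact: symplectic_list_form.
Qed.

Lemma hamilton_components :
  components a c (fun _ _ _ => 0) (fun i j u => (kappa * (i == j)%:R) * h u) (fun _ _ _ => 0).
Proof.
move=> u cu; split=> [i j|i j|A]; rewrite ?oppr0 //.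
have [_ e] := dc; rewrite /a /scale_form /fun_form e // -/kappa -/(h u).
have z (f : 'I_n -> 'I_n -> R) : \sum_(i < n) \sum_(j < n) 0 * f i j = 0.
  by rewrite big1 // => i _; rewrite big1 // => j _; rewrite mul0r.
rewrite !z mulr0 add0r addr0.
rewrite mulrA mulr_sumr; apply: eq_bigr => i _.
rewrite (bigD1 i) //= big1 ?addr0 => [|j ji]; first by rewrite eqxx mulr1.
by rewrite eq_sym (negbTE ji) mulr0 !mul0r.
Qed.

(** Here A^i_j = H delta_ij / (n - 1). The trace A^j_j contributes n copies of the partial
    derivative of H / (n - 1), and A^i_j removes one; the remaining factor n - 1 explains the
    normalisation of the form. *)
Lemma hamilton_field u : cim c u -> forall i : 'I_n,
  X c u 0 (lshift n i) = partial_p i h u /\ X c u 0 (rshift n i) = - partial_q i h u.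
Proof.
move=> cu i; have [ac _] := dc; have oc := cim_open ac.
have gl := (generatesP hn hw X hamilton_is_form).1 gX.
have [-> ->] := generated_components hn hw dc hamilton_is_form hamilton_components gl cu i.
have D (r : R) v : 'D_v (fun y => r * h y) u = r * 'D_v h u.
  exact: (smooth_deriveZ oc r v (sH ac) cu).
have n1 : kappa * (n%:R - 1) = 1.
  have -> : n%:R - 1 = (n - 1)%:R :> R by rewrite natrB //; lia.
  by rewrite mulVf // pnatr_eq0; lia.
have S (d : R) (e : 'I_n -> R) : d = e i ->
    \sum_(j < n) (kappa * d - kappa * (i == j)%:R * e j) = d.
  move=> de; rewrite sumrB sumr_const card_ord (bigD1 i) //= big1 => [|j ji].
    rewrite eqxx mulr1 addr0 -de -(mulr_natr (kappa * d)).
    by transitivity (kappa * (n%:R - 1) * d); [ring|rewrite n1 mul1r].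
  by rewrite eq_sym (negbTE ji) mulr0 mul0r.
split.
  rewrite -[RHS](S _ (fun j => partial_p j h u)) //; apply: eq_bigr => j _.
  by rewrite /partial_q /partial_p !D derive_cst eqxx mulr1 add0r.
rewrite -[X in _ = - X](S _ (fun j => partial_q j h u)) // -sumrN; apply: eq_bigr => j _.
rewrite /partial_q /partial_p !D derive_cst eqxx mulr1 add0r eq_sym.
by rewrite opprB addrC.
Qed.

End Hamilton.

Theorem mainTheorem7 (R : realType) (n : nat) (hn : (2 <= n)%N)
    (M : manifold R (n + n)) (w : local_form M 2) (hw : symplectic w) :
  (forall a : local_form M 2, is_form a ->
     exists X : local_vfield M,
       [/\ hamiltonian_vfield w X,
           form_eq (lie_deriv X (wpow w n)) (zero_form M (n * 2)),
           generates w a X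
         & darboux_expression w a X]) /\
  (forall X : local_vfield M, hamiltonian_vfield w X ->
     exists a : local_form M 2,
       [/\ is_form a, generates w a X & darboux_expression w a X]) /\
  (forall H : M -> R, smooth_function H ->
     forall X : local_vfield M, is_vfield X ->
     generates w (scale_form ((n - 1)%:R)^-1 (fun_form H w)) X ->
     forall (c : chart R (n + n) M) (I : set R) (g : R -> M),
       darboux w c -> open I -> is_interval I ->
       (forall t, I t -> cdom c (g t)) ->
       (integral_curve X I g <->
        forall t, I t -> forall i : 'I_n,
          is_derive t 1 (fun s => cmap c (g s) 0 (lshift n i))
            (partial_p i (H \o cinv c) (cmap c (g t))) /\
          is_derive t 1 (fun s => cmap c (g s) 0 (rshift n i))
            (- partial_q i (H \o cinv c) (cmap c (g t))))).
Proof.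
have expr (a : local_form M 2) X : is_form a -> list_generates w (list_field a) X ->
    darboux_expression w a X.
  by move=> fa gX c Aqq Apq App dc ca u cu i; exact: (generated_components hn hw dc fa ca gX cu i).
split; [|split].
- move=> a fa; have la := is_form_list fa; exists (generated_field w (list_field a)).
  have gX := generated_field_generates hn hw la.
  have vX : is_vfield (generated_field w (list_field a)).
    split; first by move=> c ac; exact: generated_field_smooth.
    exact: (list_generates_transition hn hw la gX).
  split.
  + exact: (list_generates_hamiltonian hn hw la gX vX).
  + exact: (list_generates_lie hw la gX vX).
  + exact/(generatesP hn hw).
  + exact: expr.
- move=> X hX; have [F lF gX] := hamiltonian_is_generated hn hw hX.
  have fa := list_is_form lF; exists (unlist_form F).
  have gX' : list_generates w (list_field (@unlist_form _ _ M 2 F)) X.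
    (* The matrix form reproduces [F] only on the images of charts; these are open, so the exterior
       derivatives agree as well. *)
    move=> c u ac cu; rewrite -gX //; congr (_ *L lwedge _ _).
    by apply: (lext_ext (cim_open ac) cu) => y cy; rewrite list_field_unlist.
  by split; [exact: fa|exact/(generatesP hn hw)|exact: expr].
- move=> H sH X vX gX c I g dc oI _ gI; have [ac _] := dc.
  have cu t : I t -> cim c (cmap c (g t)) by move=> It; exists (g t) => //; exact: gI.
  have hf t (It : I t) := hamilton_field hn hw sH dc gX (cu t It).
  (* In the one chart [c] the curve equation splits into its q and p components, whose right sides
     are supplied by [hamilton_field]. *)
  apply: (iff_trans (integral_curve_chart vX ac oI gI)); split=> h t It.
    move=> i; have [<- <-] := hf t It i.
    by have /is_derive_row hd := h t It; split; exact: hd.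
  apply/is_derive_row => k; case: (splitP k) => i ki.
    have -> : k = lshift n i by exact/val_inj.
    by have [-> _] := hf t It i; have [] := h t It i.
  have -> : k = rshift n i by exact/val_inj.
  by have [_ ->] := hf t It i; have [] := h t It i.
Qed.
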